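(* Let $T>0$, let $A:\mathbb{H}\rightrightarrows\mathbb{H}$ be a maximal monotone operator on a real separable Hilbert space $\mathbb{H}$, let $x_0\in\overline{\mathrm{Dom}(A)}$, and let $m:[0,\infty)\to\mathbb{H}$ be continuous with $m(0)=0$. Let $R>0$ and let $\alpha:\mathbb{R}_+\to\mathbb{R}_+$ be a continuous function with $\alpha(0)=0$. Let $\hat J:\mathbb{H}\times C([0,T];\mathbb{H})\times\mathbb{Y}_R\times\mathbb{X}\to\,]-\infty,+\infty]$ be defined by $$\hat J(a,x,k,\mu)=|a-x_0|^2+\mathcal{H}(x,k)-\langle\!\langle x,k\rangle\!\rangle+2R\|\mu-m\|_T+\sup_{\nu\in C_\alpha}\bigl\{\langle\!\langle \mu-\nu,k\rangle\!\rangle-R\|\nu-m\|_T\bigr\}.$$ Then: (a) $\hat J(a,x,k,\mu)\ge 0$ for all $(a,x,k,\mu)\in\mathbb{H}\times C([0,T];\mathbb{H})\times\mathbb{Y}_R\times C_\alpha$. (b) Let $(\hat a,\hat x,\hat k,\hat\mu)\in\mathbb{H}\times C([0,T];\mathbb{H})\times\mathbb{Y}_R\times C_\alpha$. Then $\hat J(\hat a,\hat x,\hat k,\hat\mu)=0$ if and only if $\hat a=x_0$, $\hat\mu=m$ (on $[0,T]$) and $\hat k\in\mathcal{A}(\hat x)$. (c) The restriction of $\hat J$ to the closed convex set $$\mathbb{K}=\{(a,x,k,\mu)\in\mathbb{H}\times C([0,T];\mathbb{H})\times\mathbb{Y}_R\times C_\alpha:\ x+k=a+\mu\}$$ is a convex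 lower semicontinuous function; and for $(\hat a,\hat x,\hat k,\hat\mu)\in\mathbb{K}$ we have $\hat J(\hat a,\hat x,\hat k,\hat\mu)=0$ if and only if $\hat a=x_0$, $\hat\mu=m$ (on $[0,T]$) and $(\hat x,\hat k)=\mathcal{GSP}(A;x_0,m)$.
   Context: $|\cdot|$, $\langle\cdot,\cdot\rangle$ are the norm and scalar product of $\mathbb{H}$; $A$ is identified with its graph. $\|y\|_T=\sup_{t\in[0,T]}|y(t)|$ is the norm of $C([0,T];\mathbb{H})$. $BV_0([0,T];\mathbb{H})$ is the space of functions $k:[0,T]\to\mathbb{H}$ of bounded variation with $k(0)=0$, with norm the total variation $\mathrm{Var}_T(k)$, identified (with the usual normalization of BV functions) with the dual of $C([0,T];\mathbb{H})$ through $\langle\!\langle z,g\rangle\!\rangle=\int_0^T\langle z(t),dg(t)\rangle$. The realization $\mathcal{A}:C([0,T];\mathbb{H})\rightrightarrows BV_0([0,T];\mathbb{H})$ of $A$ is the (maximal monotone) operator: $k\in\mathcal{A}(x)$, i.e. $(x,k)\in\mathcal{A}$, iff $\int_s^t\langle x(r)-z,dk(r)-z^*dr\rangle\ge0$ for all $(z,z^* )\in A$ and all $0\le s\le t\le T$. Its Fitzpatrick function $\mathcal{H}:C([0,T];\mathbb{H})\times BV_0([0,T];\mathbb{H})\to\,]-\infty,+\infty]$ is $$\mathcal{H}(x,k)=\sup\{\langle\!\langle u,k\rangle\!\rangle+\langle\!\langle x,u^*\rangle\!\rangle-\langle\!\langle u,u^*\rangle\!\rangle:(u,u^* )\in\mathcal{A}\}.$$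 $\mathbb{X}=\{\mu\in C([0,T];\mathbb{H}):\mu(0)=0\}$. $\mathbb{Y}_R=\{k\in C([0,T];\mathbb{H}):k(0)=0,\ \mathrm{Var}_T(k)\le R\}$, a metric space with the metric of $C([0,T];\mathbb{H})$. $C_\alpha=\{x\in\mathbb{X}:\mathbf{m}_x(\varepsilon)\le\alpha(\varepsilon)\ \forall\varepsilon\ge0\}$, where $\mathbf{m}_x(\delta)=\sup\{|x(t)-x(s)|:|t-s|\le\delta,\ t,s\in[0,T]\}$ is the modulus of continuity. All product spaces carry the product topology. $(x,k)=\mathcal{GSP}(A;x_0,m)$ (solution of the generalized Skorohod problem $dx(t)+Ax(t)(dt)\ni dm(t)$, $x(0)=x_0$ on $[0,T]$) means: $x\in C([0,T];\mathbb{H})$, $x(t)\in\overline{\mathrm{Dom}(A)}$ for all $t\in[0,T]$, $k\in C([0,T];\mathbb{H})\cap BV_0([0,T];\mathbb{H})$, $x(t)+k(t)=x_0+m(t)$ for all $t\in[0,T]$, and $\int_s^t\langle x(r)-z,dk(r)-z^*dr\rangle\ge0$ for all $(z,z^* )\in A$ and $0\le s\le t\le T$. *)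

(* Defs.v *)
From HB Require Import structures.
From mathcomp Require Export all_boot all_order all_algebra.
From mathcomp Require Export sesquilinear.
From mathcomp Require Export all_classical all_reals all_analysis.
Export numFieldNormedType.Exports.

Set Implicit Arguments.
Unset Strict Implicit.
Unset Printing Implicit Defensive.

Import Order.TTheory GRing.Theory Num.Theory.

Local Open Scope classical_set_scope.
Local Open Scope ring_scope.

(* A real separable Hilbert space is a complete normed module H over a realType
   whose norm comes from a positive definite symmetric bilinear form ip.

   C([0,T];H) and its subsets are predicates on total functions R -> H; only the
   values on [0,T] ever matter.  The topology is that of uniform convergence on
   [0,T], i.e. that of {uniform` `[0, T] -> H}. *)

Definition separable (X : topologicalType) : Prop :=
  exists2 S : set X, countable S & dense S.

Definition econvex_on (R : realType) (E : lmodType R) (D : set E)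
    (f : E -> \bar R) : Prop :=
  forall (x y : E) (t : R), D x -> D y -> 0 < t < 1 ->
    (f (t *: x + (1 - t) *: y)%R <= t%:E * f x + (1 - t)%:E * f y)%E.

Section Operators.
Context {R : realType} {H : completeNormedModType R}.
Variable ip : {dot H for idfun}.
Implicit Types A B : set (H * H).

Definition monotone A : Prop :=
  forall x xs y ys, A (x, xs) -> A (y, ys) -> 0 <= ip (x - y) (xs - ys).

Definition maximal_monotone A : Prop :=
  monotone A /\ forall B, monotone B -> A `<=` B -> B = A.

Definition Dom A : set H := [set z | exists zs, A (z, zs)].

(* Riemann-Stieltjes integral \int_a^b <z(r), dg(r)> (a <= b), as the limit of
   the Riemann-Stieltjes sums when the mesh tends to 0; the subdivision is
   a :: s and the tags are xi 0, ..., xi (size s).-1. It exists whenever z is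
   continuous and g has bounded variation on [a,b]; the default value is 0. *)
Definition RS_sum (z g : R -> H) (a b : R) (s : seq R) (xi : nat -> R) : R :=
  let F := nth b (a :: s) in
  \sum_(0 <= i < size s) ip (z (xi i)) (g (F i.+1) - g (F i)).

Definition tagged_mesh (a b : R) (s : seq R) (xi : nat -> R) (d : R) : Prop :=
  let F := nth b (a :: s) in
  forall i, (i < size s)%N -> F i <= xi i <= F i.+1 /\ F i.+1 - F i < d.

Definition is_RS_integral (z g : R -> H) (a b I : R) : Prop :=
  forall e : R, 0 < e -> exists2 d : R, 0 < d &
    forall s xi, itv_partition a b s -> tagged_mesh a b s xi d ->
      `|RS_sum z g a b s xi - I| < e.

Definition RS_integral (z g : R -> H) (a b : R) : R :=
  xget 0 [set I | is_RS_integral z g a b I].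

End Operators.

Section FunctionSpaces.
Context {R : realType} {H : completeNormedModType R}.
Variable T : R.
Implicit Types x y k mu : R -> H.

Definition CT : set (R -> H) := [set x | {within `[0, T], continuous x}].

Definition supnorm y : R := sup [set `|y t| | t in `[0, T]].

Definition vvariation k (s : seq R) : R :=
  let F := nth T (0 :: s) in \sum_(0 <= i < size s) `|k (F i.+1) - k (F i)|.

Definition Var k : \bar R :=
  ereal_sup [set (vvariation k s)%:E | s in itv_partition 0 T].

(* The usual normalization, making BV_0 the dual of C([0,T];H), is right
   continuity on the open interval ]0,T[. *)
Definition BV0 : set (R -> H) :=
  [set k | [/\ k 0 = 0, (Var k < +oo)%E &
    forall t, 0 < t < T -> k r @[r --> t^'+] --> k t]].

Definition XX : set (R -> H) := [set mu | CT mu /\ mu 0 = 0].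

Definition YY (rho : R) : set (R -> H) :=
  [set k | [/\ CT k, k 0 = 0 & (Var k <= rho%:E)%E]].

Definition modulus x (d : R) : R :=
  sup [set v | exists t s, [/\ t \in `[0, T], s \in `[0, T], `|t - s| <= d
                             & v = `|x t - x s|]].

Definition Calpha (alpha : R -> R) : set (R -> H) :=
  [set x | XX x /\ forall e, 0 <= e -> modulus x e <= alpha e].

End FunctionSpaces.

Section Skorohod.
Context {R : realType} {H : completeNormedModType R}.
Variables (ip : {dot H for idfun}) (T : R) (A : set (H * H)).
Implicit Types x k u us mu m : R -> H.

Definition pairing (z g : R -> H) : R := RS_integral ip z g 0 T.

Definition realization_ineq x k : Prop :=
  forall z zs, A (z, zs) -> forall s t, 0 <= s -> s <= t -> t <= T ->
    0 <= RS_integral ip (fun r => x r - z) (fun r => k r - r *: zs) s t.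

Definition realization : set ((R -> H) * (R -> H)) :=
  [set p | [/\ CT T p.1, BV0 T p.2 & realization_ineq p.1 p.2]].

Definition fitzpatrick x k : \bar R :=
  ereal_sup [set (pairing p.1 k + pairing x p.2 - pairing p.1 p.2)%:E
            | p in realization].

Definition is_GSP (x0 : H) m x k : Prop :=
  [/\ CT T x /\ (forall t, t \in `[0, T] -> closure (Dom A) (x t)),
      CT T k /\ BV0 T k,
      forall t, t \in `[0, T] -> x t + k t = x0 + m t
    & realization_ineq x k].

Definition Jhat (x0 : H) m (rho : R) (alpha : R -> R) (a : H) x k mu : \bar R :=
  ((`|a - x0| ^+ 2)%:E + fitzpatrick x k - (pairing x k)%:E
   + (2 * rho * supnorm T (mu - m))%:E
   + ereal_sup [set (pairing (mu - nu) k - rho * supnorm T (nu - m))%:E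
               | nu in Calpha T alpha])%E.

Definition KK (rho : R) (alpha : R -> R) :
    set (H * (R -> H) * (R -> H) * (R -> H)) :=
  [set p | let: (a, x, k, mu) := p in
    [/\ CT T x, YY T rho k, Calpha T alpha mu
      & forall t, t \in `[0, T] -> x t + k t = a + mu t]].

Definition Jhat4 (x0 : H) m (rho : R) (alpha : R -> R)
    (p : H * (R -> H) * (R -> H) * (R -> H)) : \bar R :=
  let: (a, x, k, mu) := p in Jhat x0 m rho alpha a x k mu.

End Skorohod.

(* The topology on H x C([0,T];H) x Y_R x X, as that of an ambient space. *)
Notation state_space R H T :=
  (H * {uniform` `[(0 : R), T]%classic -> H}
     * {uniform` `[(0 : R), T]%classic -> H}
     * {uniform` `[(0 : R), T]%classic -> H})%type.

(* Main.v *)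
Require Import Defs.
From mathcomp Require Import ring lra.
Import Order.TTheory GRing.Theory Num.Theory.
Set Implicit Arguments.
Unset Strict Implicit.
Unset Printing Implicit Defensive.
Local Open Scope classical_set_scope.
Local Open Scope ring_scope.

(** The functional is bounded below by
    |a - x0|^2 + (F(x, k) - <<x, k>>) + R |mu - m|, as one sees by taking nu = mu in
    the last supremum. So (a) and (b) amount to the two properties of the
    Fitzpatrick function F of the realization: F(x, k) >= <<x, k>>, with equality
    exactly on the realization. The first one is the maximality, and the second one
    the maximality and the monotonicity, of the realization.

    Both are proved with the resolvents J = (1 + lam A)^-1, which are everywhere
    defined by Minty's theorem (minty). That theorem is obtained by minimising the
    Fitzpatrick function of A plus half the squared norm, which is strongly convex.

    Monotonicity (realization_monotone) is local. On a short interval put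
    sig = length + variation; the defining inequality, tested at the resolvent point
    z + lam zs = x + dk / sig with lam = length / sig, shows that z is close to x and
    that lam zs is close to dk / sig (near_resolvent). The monotonicity of A, applied
    to the points obtained from two pairs, gives <x - y, dk - dl> >= - small * sig,
    and sig is additive. The same point z lies in Dom A, so that x takes its values
    in the closure of Dom A (realization_Dom).

    Maximality (not_realization_separated) needs test elements: for y continuous the
    pair made of J y and of the integral of (y - J y) / lam lies in the realization.
    If x leaves the closure of Dom A, the choice y = x with lam small separates
    (x, k) from the realization. Otherwise the defining inequality fails at some
    (z, zs) of A on some interval; choosing y so that J y is almost x outside this
    interval and equals z inside it, with quick transitions in between, makes the
    global pairing negative.

    For (c), the functional is the supremum of the real functions minorant. On the
    constraint x + k = a + mu the integral <<x, k>> is explicit up to <<mu, k>>,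
    because <<k, k>> = |k(T)|^2 / 2, and <<mu, k>> cancels against the last
    supremum. What is left is the convex quadratic expression
    |a - x0|^2 - <a, k(T)> + |k(T)|^2 / 2, a multiple of |mu - m| and terms that are
    affine in (x, k) (minorantE). Each minorant is therefore convex on the constraint
    set, and it is continuous there because k |-> <<u, k>> is continuous for uniform
    convergence with bounded variation (pairing_weak_cont).

    Stieltjes integrals are handled through primitives: a function G whose increment
    on [s, t] differs from <h, g t - g s> by at most eta times the increment of a
    dominating function v, whenever the integrand stays within eta of h. *)

(** * Inner product *)

Section InnerProduct.
Context {R : realType} {H : completeNormedModType R}.
Context (ip : {dot H for idfun}) (ip_norm : forall h : H, ip h h = `|h| ^+ 2).
Implicit Types (h p q : H).

Lemma ipDl p q h : ip (p + q) h = ip p h + ip q h.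
Proof. exact: linearDl. Qed.
Lemma ipDr p q h : ip h (p + q) = ip h p + ip h q.
Proof. exact: linearDr. Qed.
Lemma ipNl p h : ip (- p) h = - ip p h.
Proof. exact: linearNl. Qed.
Lemma ipNr p h : ip h (- p) = - ip h p.
Proof. exact: linearNr. Qed.
Lemma ip0l h : ip 0 h = 0.
Proof. exact: linear0l. Qed.
Lemma ip0r h : ip h 0 = 0.
Proof. exact: linear0r. Qed.
Lemma ipZl a p h : ip (a *: p) h = a * ip p h.
Proof. exact: linearZl_LR. Qed.
Lemma ipZr a p h : ip h (a *: p) = a * ip h p.
Proof. exact: linearZr_LR. Qed.
Lemma ipC p q : ip p q = ip q p.
Proof. by rewrite (hermC ip p q) expr0 mul1r. Qed.

Definition ipE := (ipDl, ipDr, ipNl, ipNr, ipZl, ipZr, ip0l, ip0r).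

Lemma Cauchy_Schwarz p q : `|ip p q| <= `|p| * `|q|.
Proof.
have [->|q0] := eqVneq q 0; first by rewrite ip0r !normr0 mulr0.
have q2 : 0 < `|q| ^+ 2 by rewrite exprn_gt0 // normr_gt0.
rewrite -(@ler_pXn2r _ 2) ?nnegrE ?mulr_ge0 // exprMn real_normK ?num_real //.
have : 0 <= ip (`|q| ^+ 2 *: p - ip p q *: q) (`|q| ^+ 2 *: p - ip p q *: q).
  by rewrite ip_norm exprn_ge0.
rewrite !ipE !ip_norm (ipC q p); move: (`|q| ^+ 2) (`|p| ^+ 2) (ip p q) q2 => b a c b0.
by move=> h; have : 0 <= b * (a * b - c ^+ 2); [lra | rewrite pmulr_rge0 // subr_ge0].
Qed.

Lemma ip_le p q : ip p q <= `|p| * `|q|.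
Proof. exact: le_trans (ler_norm _) (Cauchy_Schwarz p q). Qed.

Lemma ip_ge p q : - (`|p| * `|q|) <= ip p q.
Proof. by rewrite lerNl -ipNl (le_trans (ip_le _ _)) ?normrN. Qed.

End InnerProduct.

(** * Minty's theorem *)

Section Minty.
Context {R : realType} {H : completeNormedModType R}.
Context (ip : {dot H for idfun}) (ip_norm : forall h : H, ip h h = `|h| ^+ 2).
Implicit Types (A : set (H * H)) (x y z : H).

Lemma maximal_monotone_mem A x xs : maximal_monotone ip A ->
  (forall y ys, A (y, ys) -> 0 <= ip (x - y) (xs - ys)) -> A (x, xs).
Proof.
move=> [mA maxA] rel; have <- // : A `|` [set (x, xs)] = A; last by right.
apply: maxA; last exact: subsetUl.
move=> y ys z zs [Ay|[-> ->]] [Az|[-> ->]]; first exact: mA.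
- by rewrite -(opprB x y) -(opprB xs ys) ipNl ipNr opprK rel.
- exact: rel.
- by rewrite !subrr ip0l.
Qed.

(** First-order optimality: dividing by t and letting t tend to 0. *)
Lemma linear_part_ge0 (a b : R) :
  (forall t, 0 < t < 1 -> 0 <= t * a + t ^+ 2 * b) -> 0 <= a.
Proof.
move=> h; rewrite leNgt; apply/negP => a0.
pose t := - a / (2 * (`|b| - a)).
have b0 := normr_ge0 b; have bb := ler_norm b.
have d0 : 0 < 2 * (`|b| - a) by lra.
have t0 : 0 < t by rewrite divr_gt0 //; lra.
have t1 : t < 1 by rewrite ltr_pdivrMr //; lra.
have tE : t * (2 * (`|b| - a)) = - a by rewrite mulfVK // gt_eqF.
have := h t; rewrite t0 t1 => /(_ isT).
have -> : t * a + t ^+ 2 * b = t * (a + t * b) by ring.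
rewrite pmulr_rge0 // => k.
have : t * b <= t * `|b| by rewrite ler_pM2l.
have : t * a < 0 by rewrite pmulr_rlt0.
lra.
Qed.

(** c is at least the value at (x, xs) of the Fitzpatrick function of A; its
    epigraph replaces the function because the latter may be infinite. *)
Definition fitz_epi A x xs (c : R) :=
  forall y ys, A (y, ys) -> ip y xs + ip x ys - ip y ys <= c.

Definition energy x (xs : H) c : R := c + (`|x| ^+ 2 + `|xs| ^+ 2) / 2.

Lemma fitz_epi_convex A x xs c y ys d t : 0 < t < 1 -> fitz_epi A x xs c -> fitz_epi A y ys d ->
  fitz_epi A (x + t *: (y - x)) (xs + t *: (ys - xs)) (c + t * (d - c)).
Proof.
move=> /andP[t0 t1] Cx Cy z zs Az; rewrite !ipE.
have /(ler_wpM2l (ltW t0)) := Cy _ _ Az.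
have : 0 <= 1 - t by lra.
by move=> /ler_wpM2l /(_ _ _ (Cx _ _ Az)); lra.
Qed.

(** The energy is strongly convex: the last term is the gain that makes
    minimising sequences Cauchy and that yields the optimality condition. *)
Lemma energy_segment x xs c y ys d t :
  energy (x + t *: (y - x)) (xs + t *: (ys - xs)) (c + t * (d - c)) =
  energy x xs c + t * (energy y ys d - energy x xs c)
  - t * (1 - t) * (`|y - x| ^+ 2 + `|ys - xs| ^+ 2) / 2.
Proof.
by rewrite /energy -!ip_norm !ipE (ipC ip y x) (ipC ip ys xs); field.
Qed.

Lemma cauchy_sqr (u : nat -> H) :
  (forall n m, `|u n - u m| ^+ 2 <= 4 * (n.+1%:R^-1 + m.+1%:R^-1)) -> cvgn u.
Proof.
move=> hu; apply/cauchy_cvgP/cauchy_exP => e e0.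
have e20 : 0 < e ^+ 2 / 16 by rewrite divr_gt0 // exprn_gt0.
near \oo => N.
exists (u N); rewrite /= /nbhs /=; near=> m.
rewrite -ball_normE /= -(@ltr_pXn2r _ 2) ?nnegrE ?(ltW e0)//.
apply: le_lt_trans (hu _ _) _.
have N1 : N.+1%:R^-1 < e ^+ 2 / 16 by near: N; exact: (near_infty_natSinv_lt (PosNum e20)).
have m1 : m.+1%:R^-1 < e ^+ 2 / 16 by near: m; exact: (near_infty_natSinv_lt (PosNum e20)).
move: (N.+1%:R^-1) (m.+1%:R^-1) N1 m1 => a b; lra.
Unshelve. all: by end_near. Qed.

(** The infimum over the epigraph is attained: the midpoint of two almost
    minimising points lies in the epigraph, so by strong convexity the two
    points are close; the epigraph is closed since it is cut out by affine
    inequalities. *)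
Lemma epi_minimizer A (A0 : A !=set0) (mA : monotone ip A) :
  exists x xs c, fitz_epi A x xs c /\
    forall y ys d, fitz_epi A y ys d -> energy x xs c <= energy y ys d.
Proof.
have [[y0 ys0] Ay0] := A0.
pose V := [set energy p.1.1 p.1.2 p.2 | p in [set p | fitz_epi A p.1.1 p.1.2 p.2]].
have inV x xs c : fitz_epi A x xs c -> V (energy x xs c) by move=> h; exists ((x, xs), c).
have V0 : V !=set0.
  exists (energy y0 ys0 (ip y0 ys0)); apply: inV => y ys Ay.
  by have := mA _ _ _ _ Ay0 Ay; rewrite !ipE; lra.
have Vlb : has_lbound V.
  exists (- ip y0 ys0 - (`|ys0| ^+ 2 + `|y0| ^+ 2) / 2) => _ [[[x xs] c] /= Cx <-].
  have := Cx _ _ Ay0; rewrite /energy (ipC ip y0 xs).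
  have := sqr_ge0 `|x + ys0|; have := sqr_ge0 `|xs + y0|.
  by rewrite -!ip_norm !ipE (ipC ip ys0 x) (ipC ip y0 xs); lra.
set m := inf V.
have mle x xs c : fitz_epi A x xs c -> m <= energy x xs c.
  by move=> /inV; exact: ge_inf.
have seqV n : exists p : (H * H) * R,
    fitz_epi A p.1.1 p.1.2 p.2 /\ energy p.1.1 p.1.2 p.2 < m + n.+1%:R^-1.
  have [//|_ [p Cp <-] lt] := @inf_adherent _ V n.+1%:R^-1 _ (conj V0 Vlb).
  by exists p.
have {seqV}[p hp] := choice seqV.
pose u n := (p n).1.1; pose us n := (p n).1.2.
have Cuv n k : `|u n - u k| ^+ 2 + `|us n - us k| ^+ 2 <= 4 * (n.+1%:R^-1 + k.+1%:R^-1).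
  have [C1 E1] := hp n; have [C2 E2] := hp k.
  have h2 : 0 < (2^-1 : R) < 1 by apply/andP; split; lra.
  have := mle _ _ _ (fitz_epi_convex h2 C2 C1); rewrite energy_segment -/(u _) -/(us _).
  move: E1 E2; rewrite -/(u n) -/(us n) -/(u k) -/(us k).
  by move: (n.+1%:R^-1) (k.+1%:R^-1) => a b; lra.
have /cvg_ex[x ux] : cvgn u.
  apply: cauchy_sqr => n k; apply: le_trans (Cuv n k).
  by rewrite lerDl sqr_ge0.
have /cvg_ex[xs uxs] : cvgn us.
  apply: cauchy_sqr => n k; apply: le_trans (Cuv n k).
  by rewrite lerDr sqr_ge0.
exists x, xs, (m - (`|x| ^+ 2 + `|xs| ^+ 2) / 2); split=> [y ys Ay|]; last first.
  by move=> y ys d /mle h; rewrite [X in X <= _]/energy subrK.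
have sq z zs : ip y zs + ip z ys - ip y ys + (`|z| ^+ 2 + `|zs| ^+ 2) / 2 =
    (`|z + ys| ^+ 2 + `|zs + y| ^+ 2) / 2 - (`|ys| ^+ 2 + `|y| ^+ 2) / 2 - ip y ys.
  by rewrite -!ip_norm !ipE (ipC ip ys z) (ipC ip y zs); field.
suff : (`|x + ys| ^+ 2 + `|xs + y| ^+ 2) / 2
     - (`|ys| ^+ 2 + `|y| ^+ 2) / 2 - ip y ys <= m by rewrite -sq; lra.
pose f n := (`|u n + ys| ^+ 2 + `|us n + y| ^+ 2) / 2
     - (`|ys| ^+ 2 + `|y| ^+ 2) / 2 - ip y ys - n.+1%:R^-1.
have fm : f @ \oo --> (`|x + ys| ^+ 2 + `|xs + y| ^+ 2) / 2
     - (`|ys| ^+ 2 + `|y| ^+ 2) / 2 - ip y ys - 0.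
  have sqc (w : nat -> H) (l h : H) : w @ \oo --> l ->
      `|w n + h| ^+ 2 @[n --> \oo] --> `|l + h| ^+ 2.
    move=> wl; have wh : `|w n + h| @[n --> \oo] --> `|l + h|.
      by apply: cvg_norm; apply: cvgD => //; exact: cvg_cst.
    by under eq_fun do rewrite expr2; rewrite expr2; apply: cvgM.
  apply: cvgB; last exact: cvg_harmonic.
  apply: cvgB; last exact: cvg_cst.
  apply: cvgB; last exact: cvg_cst.
  apply: cvgM; last exact: cvg_cst.
  by apply: cvgD; exact: sqc.
rewrite -[X in X <= _]subr0; rewrite -(cvg_lim _ fm)//; apply: limr_le.
  by apply/cvg_ex; eexists; exact: fm.
apply: nearW => n; rewrite /f -sq; have [Cn En] := hp n.
have := Cn _ _ Ay; move: En; rewrite /energy -/(u _) -/(us _). move: (n.+1%:R^-1) => a; lra.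
Qed.

(** Let (x, xs) minimise F(x, xs) + |x|^2/2 + |xs|^2/2, with F the Fitzpatrick
    function. Maximality gives F(x, xs) >= <x, xs>, and the optimality condition
    tested on (y, ys) in A becomes |x + xs|^2 <= <y + xs, ys + x>. Hence
    (- xs, - x) is monotonically related to A, so belongs to A, and testing with
    this very point forces xs = - x. *)
Lemma minty_normalized A : maximal_monotone ip A -> exists x, A (x, - x).
Proof.
move=> maxA; have mA := maxA.1.
have A0 : A !=set0.
  apply: contrapT => nA; apply: (nA); exists (0, 0).
  by apply: (maximal_monotone_mem maxA) => y ys Ay; case: nA; exists (y, ys).
have [x [xs [c [Cx minx]]]] := epi_minimizer A0 mA.
have xc : ip x xs <= c.
  rewrite leNgt; apply/negP => cx.
  suff /Cx : A (x, xs) by lra.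
  apply: (maximal_monotone_mem maxA) => y ys /Cx.
  by rewrite !ipE; lra.
have key y ys : A (y, ys) -> `|x + xs| ^+ 2 <= ip (y + xs) (ys + x).
  move=> Ay; have Cy : fitz_epi A y ys (ip y ys).
    by move=> z zs Az; have := mA _ _ _ _ Ay Az; rewrite !ipE; lra.
  have : 0 <= energy y ys (ip y ys) - energy x xs c -
       (`|y - x| ^+ 2 + `|ys - xs| ^+ 2) / 2.
    apply: (@linear_part_ge0 _ ((`|y - x| ^+ 2 + `|ys - xs| ^+ 2) / 2)) => t t01.
    by have := minx _ _ _ (fitz_epi_convex t01 Cx Cy); rewrite energy_segment; lra.
  by rewrite /energy -!ip_norm !ipE (ipC ip y x) (ipC ip ys xs) (ipC ip xs x); lra.
have Am : A (- xs, - x).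
  apply: (maximal_monotone_mem maxA) => y ys /key /(le_trans (sqr_ge0 _)).
  by rewrite !ipE; lra.
have : `|x + xs| ^+ 2 <= 0 by have := key _ _ Am; rewrite addNr ip0l.
move=> e0; have : `|x + xs| ^+ 2 == 0 by rewrite eq_le e0 sqr_ge0.
rewrite sqrf_eq0 normr_eq0 => /eqP e.
by exists x; move: Am; rewrite -(addrK xs x) e sub0r opprK.
Qed.

(** Translating and rescaling A reduces solving z + lam A z = y to the
    normalised case. *)
Lemma minty A lam y : maximal_monotone ip A -> 0 < lam ->
  exists z, A (z, lam^-1 *: (y - z)).
Proof.
move=> maxA l0.
pose B := [set p : H * H | A (p.1 + y, lam^-1 *: p.2)].
have l0' : lam != 0 by rewrite gt_eqF.
have maxB : maximal_monotone ip B.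
  split=> [x xs z zs /= Bx Bz|C mC BC].
    have := maxA.1 _ _ _ _ Bx Bz; rewrite opprD addrACA subrr addr0 -scalerBr ipZr.
    by rewrite pmulr_rge0 // invr_gt0.
  apply/seteqP; split=> [[x xs] Cx|]; last exact: BC.
  apply: (maximal_monotone_mem maxA) => z zs Az /=.
  have Bz : B (z - y, lam *: zs) by rewrite /B /= subrK scalerK.
  have := mC _ _ _ _ Cx (BC _ Bz).
  have -> : lam^-1 *: xs - zs = lam^-1 *: (xs - lam *: zs).
    by rewrite scalerBr scalerK.
  have -> : x - (z - y) = x + y - z by rewrite opprB addrA.
  by rewrite ipZr => h; rewrite mulr_ge0 // invr_ge0 ltW.
have [x Bx] := minty_normalized maxB; exists (x + y).
by have -> : y - (x + y) = - x by rewrite opprD addrCA subrr addr0.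
Qed.

End Minty.

(** * Uniform continuity on [0,T] *)

Section UniformContinuity.
Context {R : realType} {H : normedModType R}.
Variable T : R.
Implicit Types x y : R -> H.

Definition ucont x := forall e, 0 < e -> exists2 d, 0 < d & forall s t,
  0 <= s <= T -> 0 <= t <= T -> `|s - t| < d -> `|x s - x t| <= e.

Lemma ucontP x : {within `[0, T], continuous x} <-> ucont x.
Proof.
split=> [cx e e0|ux].
  have /compact_near_coveringP cpt := @segment_compact R 0 T.
  pose P (d t : R) := 0 <= t <= T ->
    forall s, 0 <= s <= T -> `|s - t| < d -> `|x s - x t| <= e.
  have [|d /= d0 Pd] := cpt _ 0^'+ P _.
    move=> t tT; have /subspace_continuousP/(_ t tT)/cvgrPdist_lt := cx.
    have e20 : 0 < e / 2 by rewrite divr_gt0.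
    move=> /(_ _ e20); rewrite near_withinE => -[r /= r0 hr].
    exists (ball t (r / 2), [set d : R | d < r / 2]) => /=.
      split; first by apply: nbhsx_ballx; rewrite divr_gt0.
      by apply: nbhs_right_lt; rewrite divr_gt0.
    move=> [t' d] /= [tt' dr] t'T s sT st'.
    have {}dr : d < r / 2 := dr.
    have {}tt' : `|t - t'| < r / 2 := tt'.
    have ht' : `|x t - x t'| < e / 2.
      apply: hr; last by rewrite /= in_itv.
      by apply: lt_trans tt' _; rewrite ltr_pdivrMr //; lra.
    have hs : `|x t - x s| < e / 2.
      apply: hr; last by rewrite /= in_itv.
      suff : `|t - s| < r by [].
      by have := ler_distD t' t s; rewrite (distrC t' s); lra.
    have := ler_distD (x t) (x s) (x t'); rewrite (distrC (x s) (x t)).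
    by lra.
  exists (d / 2); first by rewrite divr_gt0.
  move=> s t sT tT st; apply: (Pd (d / 2)) => //=.
  - by rewrite sub0r normrN gtr0_norm ?divr_gt0 // ltr_pdivrMr //; lra.
  - by rewrite divr_gt0.
apply/subspace_continuousP => t tT; apply/cvgrPdist_le => e /ux[d d0 hd].
rewrite near_withinE; exists d => //= s ts sT.
by apply: hd => //; rewrite -?in_itv.
Qed.

End UniformContinuity.

Section Chain.
Context {R : realType}.
Variable T : R.

(** A relation between the end points of an interval that holds on all short
    intervals and is stable under concatenation holds on all intervals. Most
    passages from local estimates to [0,T] below are instances of this, which
    avoids explicit partitions. *)
Lemma chain_interval (P : R -> R -> Prop) d : 0 < d ->
    (forall r s t, 0 <= r -> r <= s -> s <= t -> t <= T ->
      P r s -> P s t -> P r t) ->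
    (forall s t, 0 <= s -> s <= t -> t <= T -> t - s < d -> P s t) ->
  forall s t, 0 <= s -> s <= t -> t <= T -> P s t.
Proof.
move=> d0 Ptrans Ploc.
suff ind n s t : 0 <= s -> s <= t -> t <= T -> t - s < n%:R * (d / 2) -> P s t.
  move=> s t s0 st tT; have d20 : 0 < d / 2 by rewrite divr_gt0.
  have ts : 0 <= (t - s) / (d / 2) by rewrite divr_ge0 ?subr_ge0 // ltW.
  apply: (ind (Num.truncn ((t - s) / (d / 2))).+1) => //.
  by rewrite -ltr_pdivrMr // truncnS_gt.
elim: n s t => [|n IH] s t s0 st tT hn; first by move: hn; rewrite mul0r; lra.
have [td|td] := ltP (t - s) d; first exact: Ploc.
have nS : n.+1%:R * (d / 2) = n%:R * (d / 2) + d / 2 by rewrite -natr1 mulrDl mul1r.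
apply: (Ptrans s (t - d / 2) t) => //; [lra|lra| |by apply: Ploc; lra].
by apply: IH; [|lra|lra|move: hn; rewrite nS; lra].
Qed.

Lemma ucont_bounded {H : normedModType R} (x : R -> H) : ucont T x ->
  exists2 M, 0 <= M & forall t, 0 <= t <= T -> `|x t| <= M.
Proof.
move=> ux; have [d d0 hd] := ux 1 ltr01.
have [T0|T0] := ltP T 0.
  by exists 0 => // t /andP[t0 tT]; lra.
have [M hM] : exists M, forall r, 0 <= r <= T -> `|x r| <= M.
  apply: (@chain_interval (fun s t => exists M, forall r, s <= r <= t -> `|x r| <= M)
     d d0 _ _ 0 T) => //.
    move=> r s t r0 rs st tT [M hM] [N hN].
    exists (Num.max M N) => q /andP[rq qt]; rewrite le_max.
    by have [qs|qs] := leP q s; [rewrite hM ?rq|rewrite hN ?(ltW qs) ?orbT].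
  move=> s t s0 st tT ts; exists (`|x s| + 1) => r /andP[sr rt].
  have rT : 0 <= r <= T by apply/andP; split; lra.
  have sT : 0 <= s <= T by apply/andP; split; lra.
  have := hd r s rT sT; rewrite ger0_norm; last by lra.
  move=> /(_ ltac:(lra)); have := ler_distD 0 (x r) (x s).
  by have := lerB_dist (x r) (x s); lra.
exists M => //; apply: le_trans (hM 0 _); first exact: normr_ge0.
by rewrite lexx.
Qed.

End Chain.

(** * Indefinite Stieltjes integrals *)

Section Primitive.
Context {R : realType} {E F : normedModType R} {V : completeNormedModType R}.
Variables (T : R) (B : E -> F -> V).
Hypothesis BDr : forall h p q, B h (p + q) = B h p + B h q.
Hypothesis BBl : forall h k p, B (h - k) p = B h p - B k p.
Hypothesis Bnorm : forall h p, `|B h p| <= `|h| * `|p|.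
Variables (z : R -> E) (g : R -> F) (v : R -> R).

(** Bounded variation enters only through a dominating function v: its
    increments bound those of g on every interval, and they are additive. *)
Definition dominated := forall s t, 0 <= s -> s <= t -> t <= T ->
  `|g t - g s| <= v t - v s.

(** G behaves like the integral of B (z r) against dg, up to e times the
    variation; h stands for an approximate value of z on [s, t]. *)
Definition approx_primitive (e c : R) (G : R -> V) := forall s t h eta,
  0 <= s -> s <= t -> t <= c -> (forall r, s <= r <= t -> `|h - z r| <= eta) ->
  `|G t - G s - B h (g t - g s)| <= (e + eta) * (v t - v s).

(** The estimate characterises the indefinite integral of B (z r) against dg up
    to a constant, and replaces every later manipulation of Riemann sums. *)
Definition primitive (G : R -> V) := forall s t h eta,
  0 <= s -> s <= t -> t <= T -> (forall r, s <= r <= t -> `|h - z r| <= eta) ->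
  `|G t - G s - B h (g t - g s)| <= eta * (v t - v s).

Hypothesis gv : dominated.
Hypothesis uz : ucont T z.

(** G is the integral of a step function: z is frozen at the left end of steps
    so short that z moves by at most e. The steps are added one at a time. *)
Lemma approx_primitive_exists e : 0 < e -> 0 <= T -> exists G, approx_primitive e T G.
Proof.
move=> e0 T0; have [d d0 hd] := uz e0.
suff ind n c : 0 <= c -> c <= T -> c <= n%:R * (d / 2) ->
    exists G, approx_primitive e c G.
  have d20 : 0 < d / 2 by rewrite divr_gt0.
  apply: (ind (Num.truncn (T / (d / 2))).+1) => //.
  by rewrite -ler_pdivrMr // ltW // truncnS_gt.
elim: n c => [|n IH] c c0 cT cn.
  exists (fun=> 0) => s t h eta s0 st tc _.
  have -> : t = s by move: cn; rewrite mul0r; lra.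
  rewrite !subrr mulr0 sub0r normrN; apply: le_trans (Bnorm _ _) _.
  by rewrite normr0 mulr0.
pose c1 := Num.max 0 (c - d / 2).
have c1E : c1 = 0 \/ c1 = c - d / 2.
  by rewrite /c1; case: (leP 0 (c - d / 2)) => _; [right|left].
have c10 : 0 <= c1 by rewrite le_max lexx.
have c1c : c1 <= c by rewrite ge_max c0 /=; lra.
have cc1 : c - c1 < d.
  have h : c - d / 2 <= c1 by rewrite le_max lexx orbT.
  by lra.
have nS : n.+1%:R * (d / 2) = n%:R * (d / 2) + d / 2 by rewrite -natr1 mulrDl mul1r.
have [||G hG] := IH c1 c10; first by lra.
  rewrite ge_max mulr_ge0 ?ler0n ?(ltW (divr_gt0 _ _)) //=.
  by move: cn; rewrite nS; lra.
exists (fun t => if t <= c1 then G t else G c1 + B (z c1) (g t - g c1)).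
move=> s t h eta s0 st tc heta.
have [tc1|tc1] := leP t c1.
  by rewrite (le_trans st tc1); apply: hG.
have c1T : 0 <= c1 <= T by apply/andP; split; lra.
have [sc1|sc1] := leP s c1.
  have h1 : `|h - z c1| <= eta by apply: heta; rewrite sc1 ltW.
  have h2 : `|B (h - z c1) (g t - g c1)| <= (e + eta) * (v t - v c1).
    apply: le_trans (Bnorm _ _) _.
    apply: ler_pM => //; [lra | apply: gv; lra].
  have h3 : `|G c1 - G s - B h (g c1 - g s)| <= (e + eta) * (v c1 - v s).
    by apply: hG => // r /andP[sr rc1]; apply: heta; apply/andP; split; lra.
  have -> : G c1 + B (z c1) (g t - g c1) - G s - B h (g t - g s) =
     G c1 - G s - B h (g c1 - g s) - B (h - z c1) (g t - g c1).
    have -> : g t - g s = (g c1 - g s) + (g t - g c1) by rewrite [RHS]addrC addrA subrK.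
    by rewrite (BDr h (g c1 - g s)) BBl opprD opprB !addrA [LHS](ACl (1*3*4*2*5)).
  by have := ler_normB (G c1 - G s - B h (g c1 - g s)) (B (h - z c1) (g t - g c1)); lra.
have -> : G c1 + B (z c1) (g t - g c1) - (G c1 + B (z c1) (g s - g c1)) -
   B h (g t - g s) = - B (h - z c1) (g t - g s).
  have -> : g t - g c1 = (g s - g c1) + (g t - g s) by rewrite [RHS]addrC addrA subrK.
  by rewrite BBl (BDr (z c1) (g s - g c1)) opprB opprD !addrA [LHS](ACl (3*6*1*4*2*5)) /= !addrK.
rewrite normrN; apply: le_trans (Bnorm _ _) _; apply: ler_pM => //; last first.
  by apply: gv; lra.
have sT : 0 <= s <= T by apply/andP; split; lra.
have : `|s - c1| < d by rewrite gtr0_norm; lra.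
move=> /(hd _ _ sT c1T) sc; have /heta hs : s <= s <= t by rewrite lexx.
by have := ler_distD (z s) h (z c1); lra.
Qed.

Lemma cauchy_harmonic (u : nat -> V) C : 0 <= C ->
  (forall n m, `|u n - u m| <= C * (n.+1%:R^-1 + m.+1%:R^-1)) -> cvgn u.
Proof.
move=> C0 hu; apply/cauchy_cvgP/cauchy_exP => e e0.
have e1 : 0 < e / (2 * (C + 1)) by rewrite divr_gt0 //; lra.
near \oo => N; exists (u N); rewrite /= /nbhs /=; near=> m.
rewrite -ball_normE /=; apply: le_lt_trans (hu _ _) _.
have N1 : N.+1%:R^-1 < e / (2 * (C + 1)).
  by near: N; exact: (near_infty_natSinv_lt (PosNum e1)).
have m1 : m.+1%:R^-1 < e / (2 * (C + 1)).
  by near: m; exact: (near_infty_natSinv_lt (PosNum e1)).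
have a0 : 0 < N.+1%:R^-1 :> R by rewrite invr_gt0.
have b0 : 0 < m.+1%:R^-1 :> R by rewrite invr_gt0.
have : (C + 1) * (N.+1%:R^-1 + m.+1%:R^-1) < e.
  rewrite mulrC -ltr_pdivlMr; last lra.
  have -> : e / (C + 1) = e / (2 * (C + 1)) + e / (2 * (C + 1)).
    by field; lra.
  exact: ltrD.
move: (N.+1%:R^-1) (m.+1%:R^-1) a0 b0 => a b a0 b0; rewrite mulrDl; lra.
Unshelve. all: by end_near. Qed.

(** The approximate primitives are uniformly Cauchy, by comparing two of them
    on short intervals and chaining; the estimate passes to the limit. *)
Lemma primitive_exists : 0 <= T -> exists G, primitive G.
Proof.
move=> T0; have e0 n : 0 < n.+1%:R^-1 :> R by rewrite invr_gt0.
have /choice[G hG] n := approx_primitive_exists (e0 n) T0.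
pose u n t := G n t - G n 0.
have Cu n m t : 0 <= t <= T ->
    `|u n t - u m t| <= 4 * (v t - v 0) * (n.+1%:R^-1 + m.+1%:R^-1).
  move=> /andP[t0 tT].
  have [d d0 hd] := uz (e0 n).
  have en := e0 n; have em := e0 m.
  pose P s t := `|(G n t - G n s) - (G m t - G m s)| <=
     4 * (n.+1%:R^-1 + m.+1%:R^-1) * (v t - v s).
  rewrite mulrAC; apply: (@chain_interval _ T P d d0 _ _ 0 t) => //.
    move=> r s q r0 rs sq qT; rewrite /P => h1 h2.
    have -> : G n q - G n r - (G m q - G m r) =
        (G n s - G n r - (G m s - G m r)) + (G n q - G n s - (G m q - G m s)).
      by rewrite !opprD !opprK !addrA [RHS](ACl (5*2*7*4*1*6*8*3)) /= addrK addrK.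
    apply: le_trans (ler_normD _ _) _; apply: le_trans (lerD h1 h2) _.
    rewrite -mulrDr ler_wpM2l ?mulr_ge0 ?addr_ge0 ?(ltW en) ?(ltW em) //; lra.
  move=> s q s0 sq qT qs; rewrite /P.
  have hz r : s <= r <= q -> `|z s - z r| <= n.+1%:R^-1.
    move=> /andP[sr rq]; apply: hd; [apply/andP; split; lra|apply/andP; split; lra|].
    by rewrite ler0_norm; lra.
  have h1 := hG n s q _ _ s0 sq qT hz; have h2 := hG m s q _ _ s0 sq qT hz.
  have vv : 0 <= v q - v s by apply: le_trans (gv _ _ _); [exact: normr_ge0|..].
  have -> : G n q - G n s - (G m q - G m s) = (G n q - G n s - B (z s) (g q - g s))
       - (G m q - G m s - B (z s) (g q - g s)).
    by rewrite !opprD !opprK !addrA [RHS](ACl (1*2*4*5*6*3)) /= addrK.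
  apply: le_trans (ler_normB _ _) _; apply: le_trans (lerD h1 h2) _.
  rewrite -mulrDl; apply: ler_wpM2r => //.
  by move: (n.+1%:R^-1) (m.+1%:R^-1) en em => a b; lra.
have vmono s t : 0 <= s -> s <= t -> t <= T -> v s <= v t.
  by move=> s0 st tT; rewrite -subr_ge0; apply: le_trans (gv _ _ _); [exact: normr_ge0|..].
have [U hU] : exists U, forall t, 0 <= t <= T -> u n t @[n --> \oo] --> (U t : V).
  suff /choice[U hU] : forall t, exists l : V, 0 <= t <= T -> u n t @[n --> \oo] --> l.
    by exists U.
  move=> t; have [tT|ntT] := pselect (0 <= t <= T); last by exists 0.
  suff /cvg_ex[l ul] : cvgn (u ^~ t) by exists l.
  apply: (@cauchy_harmonic _ (4 * (v t - v 0))) => [|n m]; last exact: Cu.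
  by rewrite mulr_ge0 // subr_ge0 vmono //; case/andP: tT.
exists U => s t h eta s0 st tT hz.
have uc q : u n q @[n --> \oo] --> (U q : V) -> True by [].
have lhs : `|u n t - u n s - B h (g t - g s)| @[n --> \oo] -->
    `|U t - U s - B h (g t - g s)|.
  apply: cvg_norm; apply: cvgB; last exact: cvg_cst.
  by apply: cvgB; apply: hU; apply/andP; split; lra.
have rhs : (n.+1%:R^-1 + eta) * (v t - v s) @[n --> \oo] --> (0 + eta) * (v t - v s).
  apply: cvgM; last exact: cvg_cst.
  by apply: cvgD; [exact: cvg_harmonic|exact: cvg_cst].
rewrite -[eta]add0r; apply: (ler_cvg_to lhs rhs); apply: nearW => n.
have -> : u n t - u n s = G n t - G n s by rewrite /u opprB addrA subrK.
exact: hG.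
Qed.

End Primitive.

(** * Riemann-Stieltjes sums and integrals *)

Section RiemannStieltjes.
Context {R : realType} {H : completeNormedModType R}.
Context (ip : {dot H for idfun}) (ip_norm : forall h : H, ip h h = `|h| ^+ 2).
Implicit Types (z g : R -> H) (v G : R -> R) (a b c : R).

(** Working on a subinterval lets the integrand and the integrator be changed
    outside of it. *)
Definition primitive_on a b z g v G := forall s t h eta,
  a <= s -> s <= t -> t <= b -> (forall r, s <= r <= t -> `|h - z r| <= eta) ->
  `|G t - G s - ip h (g t - g s)| <= eta * (v t - v s).

Lemma RS_sum_cons z g a b x s xi : RS_sum ip z g a b (x :: s) xi =
  ip (z (xi 0%N)) (g x - g a) + RS_sum ip z g x b s (xi \o succn).
Proof. by rewrite /RS_sum /= big_nat_recl. Qed.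

Lemma path_le_last a (s : seq R) : path <%O a s -> a <= last a s.
Proof.
by elim: s a => [|x s IH] a //= /andP[ax /IH]; apply: le_trans; exact: ltW.
Qed.

(** Each term of the sum differs from the increment of G by at most eta times
    the increment of v; these bounds telescope. *)
Lemma RS_sum_approx z g v G a b s xi d eta : primitive_on a b z g v G ->
  (forall r t, a <= r <= b -> a <= t <= b -> `|r - t| < d -> `|z r - z t| <= eta) ->
  itv_partition a b s -> tagged_mesh a b s xi d ->
  `|RS_sum ip z g a b s xi - (G b - G a)| <= eta * (v b - v a).
Proof.
elim: s a xi => [|x s IH] a xi pG zd [ps /eqP ls] tm.
  by rewrite -ls /RS_sum /= big_geq // !subrr mulr0 normr0.
move: ps ls => /= /andP[ax ps] ls.
have xb : x <= b by rewrite -ls path_le_last.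
have [/andP[/= a1 a2] xad] := tm 0%N isT.
rewrite RS_sum_cons.
have pGx : primitive_on x b z g v G.
  by move=> r t h et xr rt tb; apply: pG => //; rewrite (le_trans (ltW ax)).
have {IH} : `|RS_sum ip z g x b s (xi \o succn) - (G b - G x)| <= eta * (v b - v x).
  apply: IH => //.
  - move=> r t /andP[xr rb] /andP[xt tb]; apply: zd; apply/andP; split=> //.
      exact: le_trans (ltW ax) _.
    exact: le_trans (ltW ax) _.
  - by split=> //; rewrite ls.
  - by move=> i; exact: (tm i.+1).
have : `|G x - G a - ip (z (xi 0%N)) (g x - g a)| <= eta * (v x - v a).
  apply: pG => //; first exact: ltW.
  move=> r /andP[ar rx]; apply: zd; [apply/andP; split; lra..|].
  by rewrite ltr_norml; apply/andP; split; move: xad; lra.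
set A := ip _ _; set S := RS_sum _ _ _ _ _ _ _ => h1 h2.
have -> : A + S - (G b - G a) = (S - (G b - G x)) - (G x - G a - A) by ring.
by apply: le_trans (ler_normB _ _) _; lra.
Qed.

Lemma fine_partition a b d : a <= b -> 0 < d ->
  exists s xi, itv_partition a b s /\ tagged_mesh a b s xi d.
Proof.
move=> ab d0; suff ind n : forall a, a <= b -> b - a < n%:R * (d / 2) ->
    exists s xi, itv_partition a b s /\ tagged_mesh a b s xi d.
  have d20 : 0 < d / 2 by rewrite divr_gt0.
  have ts : 0 <= (b - a) / (d / 2) by rewrite divr_ge0 ?subr_ge0 // ltW.
  apply: (ind (Num.truncn ((b - a) / (d / 2))).+1) => //.
  by rewrite -ltr_pdivrMr // truncnS_gt.
elim: n => [|n IH] {}a {}ab hn; first by move: hn; rewrite mul0r; lra.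
have [->|aNb] := eqVneq a b; first by exists [::], (fun=> b); split.
have {}ab : a < b by rewrite lt_neqAle aNb.
have [bd|bd] := ltP (b - a) d.
  exists [:: b], (fun=> a); split; first by split=> //=; rewrite ab.
  by move=> [|i] // _; split=> /=; [rewrite lexx ltW|].
have nS : n.+1%:R * (d / 2) = n%:R * (d / 2) + d / 2 by rewrite -natr1 mulrDl mul1r.
have [||s [xi [[ps ls] tm]]] := IH (a + d / 2); [lra|by move: hn; rewrite nS; lra|].
exists (a + d / 2 :: s), (fun i => if i is j.+1 then xi j else a); split.
  by split=> //=; rewrite ps andbT; lra.
move=> [_|i ilt]; last exact: (tm i ilt).
by split; [apply/andP; split; rewrite /=; lra|rewrite /=; lra].
Qed.

Lemma is_RS_integral_uniq z g a b I J : a <= b ->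
  is_RS_integral ip z g a b I -> is_RS_integral ip z g a b J -> I = J.
Proof.
move=> ab hI hJ; apply/eqP; rewrite -subr_eq0 -normr_eq0 eq_le normr_ge0 andbT.
rewrite leNgt; apply/negP => IJ.
have e0 : 0 < `|I - J| / 2 by rewrite divr_gt0.
have [d1 d10 h1] := hI _ e0; have [d2 d20 h2] := hJ _ e0.
have d0 : 0 < Num.min d1 d2 by rewrite lt_min d10.
have [s [xi [ps tm]]] := fine_partition ab d0.
have := h1 s xi ps _; have := h2 s xi ps _.
move=> /(_ ltac:(by move=> i /tm; rewrite lt_min => -[? /andP[]])) k2.
move=> /(_ ltac:(by move=> i /tm; rewrite lt_min => -[? /andP[]])) k1.
have := ler_distD (RS_sum ip z g a b s xi) I J.
by rewrite (distrC I (RS_sum _ _ _ _ _ _ _)); lra.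
Qed.

Lemma RS_integral_eq z g a b I : a <= b ->
  is_RS_integral ip z g a b I -> RS_integral ip z g a b = I.
Proof.
move=> ab hI; rewrite /RS_integral; case: xgetP => [J -> /= hJ|/(_ I)//].
exact: is_RS_integral_uniq hJ hI.
Qed.

Lemma primitive_is_RS z g v G a b : primitive_on a b z g v G ->
  (forall e, 0 < e -> exists2 d, 0 < d & forall r t,
    a <= r <= b -> a <= t <= b -> `|r - t| < d -> `|z r - z t| <= e) ->
  is_RS_integral ip z g a b (G b - G a).
Proof.
move=> pG uz e e0; have V0 := normr_ge0 (v b - v a).
have e1 : 0 < e / (`|v b - v a| + 1) by rewrite divr_gt0 //; lra.
have [d d0 zd] := uz _ e1; exists d => // s xi ps tm.
apply: le_lt_trans (RS_sum_approx pG zd ps tm) _.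
have N0 : 0 < `|v b - v a| + 1 by lra.
rewrite mulrAC ltr_pdivrMr // ltr_pM2l //.
by have := ler_norm (v b - v a); lra.
Qed.

(** Linearity of the integral in either argument follows from linearity of the
    sums, which is why it is assumed here at the level of the sums. *)
Lemma is_RS_lin z g z1 g1 z2 g2 c a b I J :
  (forall s xi, RS_sum ip z g a b s xi =
    c * RS_sum ip z1 g1 a b s xi + RS_sum ip z2 g2 a b s xi) ->
  is_RS_integral ip z1 g1 a b I -> is_RS_integral ip z2 g2 a b J ->
  is_RS_integral ip z g a b (c * I + J).
Proof.
move=> sumE hI hJ e e0.
have c0 := normr_ge0 c.
have e1 : 0 < e / (2 * (`|c| + 1)) by rewrite divr_gt0 //; lra.
have e2 : 0 < e / 2 by rewrite divr_gt0.
have [d1 d10 h1] := hI _ e1; have [d2 d20 h2] := hJ _ e2.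
exists (Num.min d1 d2); first by rewrite lt_min d10.
move=> s xi ps tm.
have := h1 s xi ps _; have := h2 s xi ps _.
move=> /(_ ltac:(by move=> i /tm; rewrite lt_min => -[? /andP[]])) k2.
move=> /(_ ltac:(by move=> i /tm; rewrite lt_min => -[? /andP[]])) k1.
rewrite sumE.
set S1 := RS_sum ip z1 _ _ _ _ _ in k1 *; set S2 := RS_sum ip z2 _ _ _ _ _ in k2 *.
have -> : c * S1 + S2 - (c * I + J) = c * (S1 - I) + (S2 - J) by ring.
apply: le_lt_trans (ler_normD _ _) _; rewrite normrM.
have : (`|c| + 1) * `|S1 - I| <= e / 2.
  rewrite mulrC -ler_pdivlMr; last lra.
  by apply: le_trans (ltW k1) _; rewrite -mulrA invfM mulrA.
by have := normr_ge0 (S1 - I); lra.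
Qed.

Lemma is_RS_lin_l z z1 z2 g c a b I J :
  (forall r, z r = c *: z1 r + z2 r) ->
  is_RS_integral ip z1 g a b I -> is_RS_integral ip z2 g a b J ->
  is_RS_integral ip z g a b (c * I + J).
Proof.
move=> zE; apply: is_RS_lin => s xi.
rewrite /RS_sum mulr_sumr -big_split; apply: eq_bigr => i _ /=.
by rewrite zE ipDl ipZl.
Qed.

Lemma is_RS_lin_r z g g1 g2 c a b I J :
  (forall r, g r = c *: g1 r + g2 r) ->
  is_RS_integral ip z g1 a b I -> is_RS_integral ip z g2 a b J ->
  is_RS_integral ip z g a b (c * I + J).
Proof.
move=> gE; apply: is_RS_lin => s xi.
rewrite /RS_sum mulr_sumr -big_split; apply: eq_bigr => i _ /=.
by rewrite !gE !ipE; ring.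
Qed.

End RiemannStieltjes.

Section StieltjesOnCT.
Context {R : realType} {H : completeNormedModType R}.
Context (ip : {dot H for idfun}) (ip_norm : forall h : H, ip h h = `|h| ^+ 2).
Variables (T : R) (T_ge0 : 0 <= T).
Implicit Types (z g : R -> H) (v G : R -> R) (a b c : R).

Lemma ip_primitive_exists z g v : ucont T z -> dominated T g v ->
  exists G, primitive_on ip 0 T z g v G.
Proof.
move=> uz gv; apply: (@primitive_exists _ _ _ R T (fun h p => ip h p)) => //.
- by move=> h p q; rewrite ipDr.
- by move=> h k p; rewrite ipDl ipNl.
- exact: Cauchy_Schwarz.
Qed.

Lemma primitive_RS z g v G a b : ucont T z -> primitive_on ip 0 T z g v G ->
  0 <= a -> a <= b -> b <= T ->
  is_RS_integral ip z g a b (G b - G a).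
Proof.
move=> uz pG a0 ab bT; apply: (@primitive_is_RS _ _ ip z g v).
  by move=> s t h eta As st tb; apply: pG; [lra|lra|lra].
move=> e /uz[d d0 hd]; exists d => // r t /andP[ar rb] /andP[At tb].
by apply: hd; apply/andP; split; lra.
Qed.

Section FixIntegrand.
Variables (z g : R -> H) (v : R -> R).
Hypotheses (uz : ucont T z) (gv : dominated T g v).

Lemma RS_integralP a b : 0 <= a -> a <= b -> b <= T ->
  is_RS_integral ip z g a b (RS_integral ip z g a b).
Proof.
move=> a0 ab bT; have [G pG] := ip_primitive_exists uz gv.
have h := primitive_RS uz pG a0 ab bT.
by rewrite (RS_integral_eq ab h).
Qed.

Lemma RS_integral_primitive : exists G, primitive_on ip 0 T z g v G /\
  forall a b, 0 <= a -> a <= b -> b <= T -> RS_integral ip z g a b = G b - G a.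
Proof.
have [G pG] := ip_primitive_exists uz gv; exists G; split=> // a b a0 ab bT.
by apply: RS_integral_eq => //; exact: primitive_RS pG _ _ _.
Qed.

Lemma RS_integral_cat a b c : 0 <= a -> a <= b -> b <= c -> c <= T ->
  RS_integral ip z g a c = RS_integral ip z g a b + RS_integral ip z g b c.
Proof.
move=> a0 ab bc cT; have [G [_ GE]] := RS_integral_primitive.
rewrite !GE //; lra.
Qed.

Lemma RS_integral_approx a b h eta : 0 <= a -> a <= b -> b <= T ->
  (forall r, a <= r <= b -> `|h - z r| <= eta) ->
  `|RS_integral ip z g a b - ip h (g b - g a)| <= eta * (v b - v a).
Proof.
move=> a0 ab bT hz; have [G [pG GE]] := RS_integral_primitive.
by rewrite GE //; exact: pG.
Qed.

Lemma RS_integral_norm a b eta : 0 <= a -> a <= b -> b <= T ->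
  (forall r, a <= r <= b -> `|z r| <= eta) ->
  `|RS_integral ip z g a b| <= eta * (v b - v a).
Proof.
move=> a0 ab bT hz; rewrite -[X in `|X|]subr0 -(ip0l ip (g b - g a)).
by apply: RS_integral_approx => // r /hz; rewrite sub0r normrN.
Qed.

(** Only increments of the integrator on [a, b] matter, so g' may differ from g
    by a constant. *)
Lemma eq_RS_integral z' g' a b : 0 <= a -> a <= b -> b <= T ->
  (forall r, a <= r <= b -> z' r = z r) ->
  (forall r s, a <= r -> r <= s -> s <= b -> g' s - g' r = g s - g r) ->
  RS_integral ip z' g' a b = RS_integral ip z g a b.
Proof.
move=> a0 ab bT zz gg; have [G [pG ->//]] := RS_integral_primitive.
apply: RS_integral_eq => //; apply: (@primitive_is_RS _ _ ip z' g' v).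
  move=> s t h eta As st tb hz; rewrite gg //; apply: pG; [lra|lra|lra|].
  by move=> r /andP[sr rt]; rewrite -zz ?hz ?sr //; apply/andP; split; lra.
move=> e /uz[d d0 hd]; exists d => // r t rI tI rt; rewrite !zz //.
by move: rI tI => /andP[ar rb] /andP[At tb]; apply: hd => //; apply/andP; split; lra.
Qed.

End FixIntegrand.

Lemma RS_integral_linl z z1 z2 g v c a b :
  ucont T z1 -> ucont T z2 -> dominated T g v ->
  (forall r, z r = c *: z1 r + z2 r) -> 0 <= a -> a <= b -> b <= T ->
  RS_integral ip z g a b = c * RS_integral ip z1 g a b + RS_integral ip z2 g a b.
Proof.
move=> u1 u2 gv zE a0 ab bT; apply: RS_integral_eq => //.
by apply: is_RS_lin_l zE _ _; exact: RS_integralP gv _ _ _ _ _.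
Qed.

Lemma RS_integral_linr z g g1 g2 v1 v2 c a b :
  ucont T z -> dominated T g1 v1 -> dominated T g2 v2 ->
  (forall r, g r = c *: g1 r + g2 r) -> 0 <= a -> a <= b -> b <= T ->
  RS_integral ip z g a b = c * RS_integral ip z g1 a b + RS_integral ip z g2 a b.
Proof.
move=> uz gv1 gv2 gE a0 ab bT; apply: RS_integral_eq => //.
by apply: is_RS_lin_r gE _ _; [exact: RS_integralP gv1 _ _ _ _ _|exact: RS_integralP gv2 _ _ _ _ _].
Qed.

End StieltjesOnCT.

(** * Total variation *)

Section Variation.
Context {R : realType} {H : completeNormedModType R}.
Variables (T : R) (T_gt0 : 0 < T).
Implicit Types (k : R -> H) (v : R -> R).

Fixpoint vsum k (a : R) (s : seq R) : R :=
  if s is x :: s' then `|k x - k a| + vsum k x s' else 0.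

Lemma vvariation_vsum k s : vvariation T k s = vsum k 0 s.
Proof.
suff E a : \sum_(0 <= i < size s)
    `|k (nth T (a :: s) i.+1) - k (nth T (a :: s) i)| = vsum k a s by exact: E.
elim: s a => [|x s IH] a /=; first by rewrite big_geq.
by rewrite big_nat_recl //= IH.
Qed.

Lemma vsum_cat k a s1 s2 : vsum k a (s1 ++ s2) = vsum k a s1 + vsum k (last a s1) s2.
Proof. by elim: s1 a => [|x s IH] a /=; rewrite ?add0r // IH addrA. Qed.

(** The dominating function is t |-> variation of k on [0, t]; appending t to a
    partition of [0, s] shows that its increments bound those of k. *)
Lemma Var_dominated k M : (Var T k <= M%:E)%E ->
  exists2 v, dominated T k v & v T - v 0 <= M.
Proof.
move=> VM.
pose S t := [set vsum k 0 s | s in [set s | path <%O 0 s /\ last 0 s = t]].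
have SM t x : t <= T -> S t x -> x <= M.
  move=> tT [s [ps ls] <-].
  have Tle s' : itv_partition 0 T s' -> vsum k 0 s' <= M.
    move=> ps'; rewrite -lee_fin; apply: le_trans VM; apply: ereal_sup_ubound.
    by exists s' => //; rewrite vvariation_vsum.
  have [tE|tNT] := eqVneq t T; first by apply: Tle; split=> //; rewrite ls tE.
  apply: (@le_trans _ _ (vsum k 0 (s ++ [:: T]))).
    by rewrite vsum_cat lerDl /= addr0 normr_ge0.
  apply: Tle; split; last by rewrite last_cat.
  by rewrite cat_path ps /= ls lt_neqAle tNT tT.
have Ssup t : 0 <= t -> t <= T -> has_sup (S t).
  move=> t0 tT; split; last by exists M => x; exact: SM.
  have [->|tN0] := eqVneq t 0; first by exists 0; exists [::].
  by exists (vsum k 0 [:: t]); exists [:: t] => //=; rewrite lt_neqAle eq_sym tN0 t0.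
exists (fun t => sup (S t)).
  move=> s t s0 st tT.
  have [->|sNt] := eqVneq s t; first by rewrite !subrr normr0.
  rewrite lerBrDr -lerBrDl; apply: ge_sup; first exact: (Ssup s s0 (le_trans st tT)).1.
  move=> _ [p [pp lp] <-]; rewrite lerBrDl; apply: ub_le_sup.
    exact: (Ssup t (le_trans s0 st) tT).2.
  exists (p ++ [:: t]).
    by split; [rewrite cat_path pp /= lp lt_neqAle sNt st|rewrite last_cat].
  by rewrite vsum_cat /= addr0 lp addrC.
have T0 : 0 <= T by exact: ltW.
have h1 : sup (S T) <= M by apply: ge_sup; [exact: (Ssup T T0 (lexx T)).1|move=> x; exact: SM].
have h2 : 0 <= sup (S 0) by apply: ub_le_sup; [exact: (Ssup 0 (lexx 0) T0).2|exists [::]].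
lra.
Qed.

Lemma dominated_Var k v : dominated T k v -> (Var T k <= (v T - v 0)%:E)%E.
Proof.
move=> kv; apply: ge_ereal_sup => _ [s [ps /eqP ls] <-].
rewrite lee_fin vvariation_vsum.
suff E a : 0 <= a -> path <%O a s -> last a s = T -> vsum k a s <= v T - v a.
  exact: E.
elim: s a {ps ls} => [|x s IH] a a0 /=; first by move=> _ ->; rewrite subrr.
move=> /andP[ax ps] ls.
have x0 : 0 <= x := le_trans a0 (ltW ax).
have := IH x x0 ps ls.
have xT : x <= T by rewrite -ls path_le_last.
by have := kv _ _ a0 (ltW ax) xT; lra.
Qed.

Lemma dominated_ge0 {F : normedModType R} (g : R -> F) v : dominated T g v ->
  forall s t, 0 <= s -> s <= t -> t <= T -> v s <= v t.
Proof.
move=> gv s t s0 st tT; rewrite -subr_ge0.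
by apply: le_trans (gv _ _ _ _ _); [exact: normr_ge0|..].
Qed.

Lemma BV0_dominated k : BV0 T k -> exists v, dominated T k v.
Proof.
move=> [_ + _]; case E : (Var T k) => [r| |] // _.
  by have [|v kv _] := @Var_dominated k r; [rewrite E|exists v].
by have [|v kv _] := @Var_dominated k 0; [rewrite E leNye|exists v].
Qed.

End Variation.

(** * Monotonicity of the realization *)

Section UcontAlgebra.
Context {R : realType} {H : normedModType R}.
Variable T : R.
Implicit Types (x y : R -> H).

Lemma ucont_lin c x y : ucont T x -> ucont T y -> ucont T (fun r => c *: x r + y r).
Proof.
move=> ux uy e e0.
have c1 : 0 < `|c| + 1 by have := normr_ge0 c; lra.
have e1 : 0 < e / (2 * (`|c| + 1)) by rewrite divr_gt0 //; lra.
have e2 : 0 < e / 2 by rewrite divr_gt0.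
have [d1 d10 h1] := ux _ e1; have [d2 d20 h2] := uy _ e2.
exists (Num.min d1 d2); first by rewrite lt_min d10.
move=> s t sT tT; rewrite lt_min => /andP[/(h1 _ _ sT tT) k1 /(h2 _ _ sT tT) k2].
rewrite opprD addrACA -scalerBr.
apply: le_trans (ler_normD _ _) _; rewrite normrZ.
have : (`|c| + 1) * `|x s - x t| <= e / 2.
  rewrite mulrC -ler_pdivlMr //.
  by apply: le_trans k1 _; rewrite -mulrA invfM mulrA.
by have := normr_ge0 (x s - x t); lra.
Qed.

Lemma ucont_cst (h : H) : ucont T (fun=> h).
Proof. by move=> e e0; exists 1 => // s t _ _ _; rewrite subrr normr0 ltW. Qed.

Lemma ucontB x y : ucont T x -> ucont T y -> ucont T (fun r => x r - y r).
Proof.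
move=> ux uy; have := ucont_lin (-1) uy ux.
by congr ucont; apply/funext => r; rewrite scaleN1r addrC.
Qed.

Lemma ucontD x y : ucont T x -> ucont T y -> ucont T (fun r => x r + y r).
Proof.
move=> ux uy; have := ucont_lin 1 ux uy.
by congr ucont; apply/funext => r; rewrite scale1r.
Qed.

Lemma dominated_lin c (x y : R -> H) v w : dominated T x v -> dominated T y w ->
  dominated T (fun r => c *: x r + y r) (fun r => `|c| * v r + w r).
Proof.
move=> xv yw s t s0 st tT; rewrite opprD addrACA -scalerBr.
apply: le_trans (ler_normD _ _) _; rewrite normrZ opprD addrACA -mulrBr.
by apply: lerD; [apply: ler_wpM2l; [exact: normr_ge0|exact: xv]|exact: yw].
Qed.

Lemma dominatedB (x y : R -> H) v w : dominated T x v -> dominated T y w ->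
  dominated T (fun r => x r - y r) (fun r => v r + w r).
Proof.
move=> xv yw s t s0 st tT.
have -> : x t - y t - (x s - y s) = (x t - x s) - (y t - y s).
  by rewrite !opprD !opprK addrACA.
apply: le_trans (ler_normB _ _) _; have := xv _ _ s0 st tT; have := yw _ _ s0 st tT.
by lra.
Qed.

Lemma dominated_scale (h : H) : dominated T (fun r => r *: h) (fun r => r * `|h|).
Proof.
by move=> s t s0 st tT; rewrite -scalerBl normrZ ger0_norm ?subr_ge0 // mulrBl.
Qed.

End UcontAlgebra.

Section Monotonicity.
Context {R : realType} {H : completeNormedModType R}.
Context (ip : {dot H for idfun}) (ip_norm : forall h : H, ip h h = `|h| ^+ 2).
Variables (A : set (H * H)) (A_maxmon : maximal_monotone ip A).
Variables (T : R) (T_gt0 : 0 < T).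
Implicit Types (x y k l : R -> H) (v w : R -> R).

Definition resolvent lam p : H := xget 0 [set z | A (z, lam^-1 *: (p - z))].

Lemma resolventP lam p : 0 < lam ->
  A (resolvent lam p, lam^-1 *: (p - resolvent lam p)).
Proof.
move=> l0; rewrite /resolvent; case: xgetP => [z _ //|none].
by have [z Az] := minty ip_norm p A_maxmon l0; case: (none z).
Qed.

(** This is the discrete form of parametrising by arc length. The inequality
    defining the realization, tested against the point (z, zs) of A determined by
    z + lam zs = xb + (k t - k s) / sig, reads sig |xb - z|^2 <= error, because
    (k t - k s) - (t - s) zs = sig (z - xb). Choosing lam = (t - s) / sig, with
    sig the length of [s, t] plus a bound on the variation, makes the error
    proportional to sig, however large the variation is compared with t - s. *)
Lemma near_resolvent x k v s t xb om V :
  ucont T x -> dominated T k v -> realization_ineq ip T A x k ->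
  0 <= s -> s < t -> t <= T -> (forall r, s <= r <= t -> `|xb - x r| <= om) ->
  v t - v s <= V ->
  let sig := t - s + V in
  let z := resolvent ((t - s) / sig) (xb + sig^-1 *: (k t - k s)) in
  is_true (`|xb - z| ^+ 2 <= om * (2 + `|xb - z|)).
Proof.
move=> ux kv xk s0 st tT hx vV sig.
set lam := (t - s) / sig; set f := sig^-1 *: _; move=> z.
have ts : 0 < t - s by lra.
have dk := kv _ _ s0 (ltW st) tT.
have V0 : 0 <= V by apply: le_trans vV; exact: le_trans dk.
have sig0 : 0 < sig by rewrite /sig; lra.
have lam0 : 0 < lam by rewrite divr_gt0.
have Az := resolventP (xb + f) lam0; rewrite -/z in Az.
set zs := lam^-1 *: _ in Az.
have f1 : `|f| <= 1.
  rewrite normrZ ger0_norm ?invr_ge0 ?(ltW sig0) // mulrC ler_pdivrMr // mul1r.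
  by rewrite /sig; lra.
have om0 : 0 <= om by apply: le_trans (hx s _); [exact: normr_ge0|rewrite lexx ltW].
have uxz : ucont T (fun r => x r - z) by apply: ucontB ux (ucont_cst _ z).
have dom := dominatedB kv (dominated_scale zs).
have hxz r : s <= r <= t -> `|(xb - z) - (x r - z)| <= om.
  by move=> /hx; rewrite opprB addrA subrK.
have := RS_integral_approx ip_norm (ltW T_gt0) uxz dom s0 (ltW st) tT hxz.
have := xk _ _ Az _ _ s0 (ltW st) tT.
set I := RS_integral _ _ _ _ _ => I0.
have tszs : (t - s) *: zs = sig *: (xb + f - z).
  by rewrite /zs scalerA /lam invf_div mulrC divfK // gt_eqF.
have ktks : k t - k s = sig *: f by rewrite /f scalerA divff ?scale1r // gt_eqF.
have -> : k t - t *: zs - (k s - s *: zs) = sig *: (z - xb).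
  have -> : k t - t *: zs - (k s - s *: zs) = (k t - k s) - (t - s) *: zs.
    by rewrite scalerBl !opprD !opprK addrACA.
  rewrite tszs ktks -scalerBr; congr (_ *: _).
  by rewrite !opprD opprK !addrA [LHS](ACl (4*2*1*3)) /= addrK.
have -> : v t + t * `|zs| - (v s + s * `|zs|) = v t - v s + (t - s) * `|zs| by ring.
have -> : (t - s) * `|zs| = sig * `|xb + f - z|.
  by rewrite -[t - s]ger0_norm ?ltW // -normrZ tszs normrZ gtr0_norm.
have nn : `|xb + f - z| <= `|xb - z| + 1.
  by rewrite addrAC; apply: le_trans (ler_normD _ _) _; rewrite lerD2l.
rewrite -(opprB xb z) scalerN ipNr ipZr ip_norm opprK => hI.
have h1 : sig * `|xb - z| ^+ 2 <= om * (v t - v s + sig * `|xb + f - z|).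
  by apply: le_trans hI; apply: le_trans (ler_norm _); rewrite lerDr.
have h2 : v t - v s + sig * `|xb + f - z| <= sig * (2 + `|xb - z|).
  have : sig * `|xb + f - z| <= sig * (`|xb - z| + 1) by rewrite ler_pM2l.
  by rewrite !mulrDr /sig; lra.
rewrite -(ler_pM2l sig0); apply: le_trans h1 _.
by rewrite mulrCA ler_wpM2l.
Qed.

(** The value e^2 / (2 + e) makes the estimate of near_resolvent give d <= e. *)
Lemma le_of_sqr_le (d e om : R) : 0 <= d -> 0 < e -> om <= e ^+ 2 / (2 + e) ->
  d ^+ 2 <= om * (2 + d) -> d <= e.
Proof.
move=> d0 e0 hom hd; rewrite leNgt; apply/negP => ed.
have : d ^+ 2 * (2 + e) <= e ^+ 2 * (2 + d).
  have e2 : 0 < 2 + e by lra.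
  rewrite -ler_pdivlMr //; apply: le_trans hd _.
  rewrite mulrAC; apply: ler_wpM2r => //; lra.
have : e * e < d * d by apply: ltr_pM => //; exact: ltW.
have : e * e * d < d * d * e.
  have -> : e * e * d = e * d * e by ring.
  by rewrite ltr_pM2r // ltr_pM2r //; lra.
by rewrite !expr2; lra.
Qed.

Lemma small_interval t d : 0 <= t <= T -> 0 < d ->
  exists a b, [/\ 0 <= a, a < b, b <= T, b - a < d & a <= t <= b].
Proof.
move=> /andP[t0 tT] d0; have [tlT|Tlt] := ltP t T.
  exists t, (Num.min T (t + d / 2)); split=> //.
  - by rewrite lt_min tlT; lra.
  - by rewrite ge_min lexx.
  - by have : Num.min T (t + d / 2) <= t + d / 2; [rewrite ge_min lexx orbT|lra].
  - by rewrite lexx le_min tT; lra.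
have tE : t = T by lra.
exists (Num.max 0 (T - d / 2)), T; split=> //.
- by rewrite le_max lexx.
- by rewrite gt_max T_gt0; lra.
- have : T - d / 2 <= Num.max 0 (T - d / 2) by rewrite le_max lexx orbT.
  lra.
- by rewrite tE lexx ge_max ltW //=; lra.
Qed.

(** The point z of near_resolvent lies in Dom A and tends to x t when the
    interval shrinks to t. *)
Lemma realization_Dom x k v : ucont T x -> dominated T k v ->
  realization_ineq ip T A x k -> forall t, 0 <= t <= T -> closure (Dom A) (x t).
Proof.
move=> ux kv xk t tT B /nbhs_ballP[e /= e0 tB].
pose e' := e / 2; have e'0 : 0 < e' by rewrite divr_gt0.
pose om := e' ^+ 2 / (2 + e').
have om0 : 0 < om by rewrite divr_gt0 ?exprn_gt0 //; lra.
have [d d0 hd] := ux _ om0.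
have [a [b [a0 ab bT abd /andP[At tb]]]] := small_interval tT d0.
have hx r : a <= r <= b -> `|x t - x r| <= om.
  move=> /andP[ar rb]; apply: hd => //; first by apply/andP; split; lra.
  by rewrite ltr_norml; apply/andP; split; lra.
have /= := near_resolvent ux kv xk a0 ab bT hx (lexx _); set z := resolvent _ _ => hz.
exists z; split; last first.
  apply: tB; rewrite -ball_normE /=.
  have := le_of_sqr_le (normr_ge0 _) e'0 (lexx _) hz; rewrite /e'; lra.
eexists; apply: resolventP; rewrite divr_gt0 //; first lra.
by have := dominated_ge0 kv a0 (ltW ab) bT; lra.
Qed.

(** The pointwise core of monotonicity: xb and yb are replaced by nearby points z
    and w of Dom A, where the monotonicity of A applies. *)
Lemma resolvent_pair_ge (xb yb z w f g zs ws : H) (lam eps M : R) :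
  0 <= lam -> lam *: zs = f + (xb - z) -> lam *: ws = g + (yb - w) ->
  0 <= ip (z - w) (zs - ws) -> `|f| <= 1 -> `|g| <= 1 ->
  `|xb - z| <= eps -> `|yb - w| <= eps -> eps <= 1 -> `|xb - yb| <= M ->
  - ((2 * M + 8) * eps) <= ip (xb - yb) (f - g).
Proof.
move=> lam0 zE wE zw f1 g1 xz yw e1 xy.
have e0 : 0 <= eps by apply: le_trans xz.
have M0 : 0 <= M by apply: le_trans xy.
set a := xb - z in zE xz; set b := yb - w in wE yw.
have fg : f - g = lam *: (zs - ws) - (a - b).
  by rewrite scalerBr zE wE opprD addrACA addrK.
have xyE : xb - yb = (z - w) + (a - b).
  by rewrite [RHS]addrACA -opprD [z + _]addrC [w + _]addrC /a /b !subrK.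
have ab : `|a - b| <= 2 * eps by apply: le_trans (ler_normB _ _) _; lra.
have fg2 : `|f - g| <= 2 by apply: le_trans (ler_normB _ _) _; lra.
have zwn : `|z - w| <= M + 2.
  have -> : z - w = (xb - yb) - (a - b) by rewrite xyE addrK.
  by apply: le_trans (ler_normB _ _) _; lra.
have h1 : ip (z - w) (a - b) <= (M + 2) * (2 * eps).
  by apply: le_trans (ip_le ip_norm _ _) _; apply: ler_pM.
have h2 : - (2 * eps * 2) <= ip (a - b) (f - g).
  by apply: le_trans (ip_ge ip_norm _ _); rewrite lerN2; apply: ler_pM.
rewrite xyE ipDl {1}fg (ipDr ip (lam *: _)) ipZr ipNr.
have : 0 <= lam * ip (z - w) (zs - ws) by rewrite mulr_ge0.
have -> : (2 * M + 8) * eps = (M + 2) * (2 * eps) + 2 * eps * 2 by ring.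
lra.
Qed.

(** On a short interval both pairs are replaced, through near_resolvent with a
    common lam, by points of A; the monotonicity of A then bounds the increment of
    the integral below by - C eps times an additive function sig of the interval
    (its length plus the variations). These bounds chain to [0,T], and eps is
    arbitrary. *)
Lemma realization_monotone x k v y l w :
  ucont T x -> dominated T k v -> realization_ineq ip T A x k ->
  ucont T y -> dominated T l w -> realization_ineq ip T A y l ->
  0 <= RS_integral ip (fun r => x r - y r) (fun r => k r - l r) 0 T.
Proof.
move=> ux kv xk uy lw yl.
have uxy := ucontB ux uy; have klvw := dominatedB kv lw.
have [G [pG GE]] := RS_integral_primitive ip_norm (ltW T_gt0) uxy klvw.
have T0 := ltW T_gt0; rewrite GE //.
have [M M0 hM] := ucont_bounded uxy.
pose sig r := r + (v r + w r).
pose C := 2 * M + 10.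
suff key eps : 0 < eps -> eps <= 1 -> - (C * eps * (sig T - sig 0)) <= G T - G 0.
  have vT := dominated_ge0 kv (lexx 0) (ltW T_gt0) (lexx T).
  have wT := dominated_ge0 lw (lexx 0) (ltW T_gt0) (lexx T).
  have S0 : 0 < sig T - sig 0. have Tg := T_gt0; rewrite /sig; lra.
  rewrite leNgt; apply/negP => G0.
  have CS : 0 < C * (sig T - sig 0) by rewrite mulr_gt0 //; rewrite /C; lra.
  pose e := Num.min 1 (- (G T - G 0) / 2 / (C * (sig T - sig 0))).
  have e0 : 0 < e.
    by rewrite lt_min ltr01 /= divr_gt0 // divr_gt0 // oppr_gt0.
  have e1 : e <= 1 by rewrite ge_min lexx.
  have := key e e0 e1.
  have : e * (C * (sig T - sig 0)) <= - (G T - G 0) / 2.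
    by rewrite -ler_pdivlMr // ge_min lexx orbT.
  by rewrite mulrAC [_ * e]mulrC; lra.
move=> e0 e1.
pose om := eps ^+ 2 / (2 + eps).
have om0 : 0 < om by rewrite divr_gt0 ?exprn_gt0 //; lra.
have ome : om <= eps.
  rewrite ler_pdivrMr; last lra.
  by rewrite expr2 ler_pM2l //; lra.
have [d1 d10 h1] := ux _ om0; have [d2 d20 h2] := uy _ om0.
have d0 : 0 < Num.min d1 d2 by rewrite lt_min d10.
apply: (@chain_interval _ T (fun s t => - (C * eps * (sig t - sig s)) <= G t - G s)
  _ d0 _ _ 0 T) => //.
  by move=> r s t r0 rs st tT; lra.
move=> s t s0 st tT; rewrite lt_min => /andP[ts1 ts2].
have [->|sNt] := eqVneq s t; first by rewrite !subrr mulr0 oppr0.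
have {sNt}st : s < t by rewrite lt_neqAle sNt.
have sT : 0 <= s <= T by apply/andP; split; lra.
have hx r : s <= r <= t -> `|x s - x r| <= om.
  move=> /andP[sr rt]; apply: h1 => //; first by apply/andP; split; lra.
  by rewrite ltr_norml; apply/andP; split; lra.
have hy r : s <= r <= t -> `|y s - y r| <= om.
  move=> /andP[sr rt]; apply: h2 => //; first by apply/andP; split; lra.
  by rewrite ltr_norml; apply/andP; split; lra.
have dv := dominated_ge0 kv s0 (ltW st) tT.
have dw := dominated_ge0 lw s0 (ltW st) tT.
have dk := kv _ _ s0 (ltW st) tT; have dl := lw _ _ s0 (ltW st) tT.
pose V := (v t - v s) + (w t - w s).
have vV : v t - v s <= V by rewrite /V; lra.
have wV : w t - w s <= V by rewrite /V; lra.
have /= := near_resolvent ux kv xk s0 st tT hx vV.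
have /= := near_resolvent uy lw yl s0 st tT hy wV.
set S := t - s + V; set lam := (t - s) / S.
have S0 : 0 < S by rewrite /S /V; lra.
have lam0 : 0 < lam by rewrite divr_gt0 //; lra.
set f := S^-1 *: (k t - k s); set g := S^-1 *: (l t - l s).
have Az := resolventP (x s + f) lam0; have Aw := resolventP (y s + g) lam0.
move: Az Aw; set z := resolvent lam _; set w' := resolvent lam _ => Az Aw.
move=> /(le_of_sqr_le (normr_ge0 _) e0 (lexx _)) yw /(le_of_sqr_le (normr_ge0 _) e0 (lexx _)) xz.
have lamE p : lam *: (lam^-1 *: p) = p by rewrite scalerA divff ?scale1r // gt_eqF.
have core : - ((2 * M + 8) * eps) <= ip (x s - y s) (f - g).
  apply: (@resolvent_pair_ge _ _ z w' f g _ _ lam eps M (ltW lam0) _ _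
    (A_maxmon.1 _ _ _ _ Az Aw)) => //.
  - by rewrite lamE addrAC addrC.
  - by rewrite lamE addrAC addrC.
  - rewrite normrZ ger0_norm ?invr_ge0 ?(ltW S0) // mulrC ler_pdivrMr // mul1r.
    by rewrite /S /V; lra.
  - rewrite normrZ ger0_norm ?invr_ge0 ?(ltW S0) // mulrC ler_pdivrMr // mul1r.
    by rewrite /S /V; lra.
  - exact: hM.
have : `|G t - G s - ip (x s - y s) (k t - l t - (k s - l s))| <=
    2 * om * (v t + w t - (v s + w s)).
  apply: pG => //; first exact: ltW.
  move=> r rI; have -> : x s - y s - (x r - y r) = (x s - x r) - (y s - y r).
    by rewrite !opprD !opprK addrACA.
  by apply: le_trans (ler_normB _ _) _; have := hx r rI; have := hy r rI; lra.
have -> : k t - l t - (k s - l s) = S *: (f - g).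
  rewrite scalerBr !scalerA divff ?gt_eqF // !scale1r.
  by rewrite !opprD !opprK addrACA.
rewrite ipZr => hG.
have : S * - ((2 * M + 8) * eps) <= S * ip (x s - y s) (f - g) by rewrite ler_pM2l.
have : 2 * om * (v t + w t - (v s + w s)) <= 2 * eps * S.
  by apply: ler_pM; rewrite /S /V; lra.
have -> : sig t - sig s = S by rewrite /sig /S /V; ring.
have -> : C * eps * S = S * ((2 * M + 8) * eps) + 2 * eps * S by rewrite /C; ring.
move: hG; rewrite ler_norml => /andP[]; lra.
Qed.

End Monotonicity.

(** * Trajectories built from the resolvent *)

Section Resolvent.
Context {R : realType} {H : completeNormedModType R}.
Context (ip : {dot H for idfun}) (ip_norm : forall h : H, ip h h = `|h| ^+ 2).
Variables (A : set (H * H)) (A_maxmon : maximal_monotone ip A).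
Implicit Types (p q z : H) (lam : R).
Local Notation J := (resolvent A).

Lemma resolvent_nonexpansive lam p q : 0 < lam -> `|J lam p - J lam q| <= `|p - q|.
Proof.
move=> l0; have := A_maxmon.1 _ _ _ _ (resolventP ip_norm A_maxmon p l0)
  (resolventP ip_norm A_maxmon q l0).
set a := J lam p; set b := J lam q.
rewrite -scalerBr ipZr pmulr_rge0 ?invr_gt0 //.
have -> : p - a - (q - b) = (p - q) - (a - b) by rewrite !opprD !opprK addrACA.
rewrite ipDr ipNr ip_norm subr_ge0 => h.
have := le_trans h (ip_le ip_norm _ _).
have [->|ab] := eqVneq (a - b) 0; first by rewrite !normr0.
by rewrite expr2 ler_pM2l // normr_gt0.
Qed.

Lemma resolvent_graph lam z zs : 0 < lam -> A (z, zs) -> J lam (z + lam *: zs) = z.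
Proof.
move=> l0 Az; set p := z + _.
have := A_maxmon.1 _ _ _ _ (resolventP ip_norm A_maxmon p l0) Az.
set a := J lam p.
have -> : lam^-1 *: (p - a) - zs = - (lam^-1 *: (a - z)).
  have l1 : lam != 0 by rewrite gt_eqF.
  rewrite -[zs in LHS](scalerK l1) -scalerBr -(scalerN lam^-1); congr (_ *: _).
  by rewrite /p opprB [LHS]addrAC addrK.
rewrite ipNr ipZr ip_norm => h.
have : lam^-1 * `|a - z| ^+ 2 <= 0 by lra.
rewrite pmulr_rle0 ?invr_gt0 // => h0.
apply/eqP; rewrite -subr_eq0 -normr_eq0 -sqrf_eq0.
by rewrite eq_le h0 sqr_ge0.
Qed.

(** Compare with z, which is the image under J of z + lam zs. *)
Lemma resolvent_dist lam p z zs : 0 < lam -> A (z, zs) ->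
  `|p - J lam p| <= 2 * `|p - z| + lam * `|zs|.
Proof.
move=> l0 Az; have := resolvent_nonexpansive (z + lam *: zs) p l0.
rewrite (resolvent_graph l0 Az) => h.
have h2 : `|z + lam *: zs - p| <= `|p - z| + lam * `|zs|.
  rewrite addrAC; apply: le_trans (ler_normD _ _) _.
  by rewrite distrC normrZ gtr0_norm.
by have := ler_distD z p (J lam p); lra.
Qed.

Lemma maximal_monotone_neq0 : exists z zs, A (z, zs).
Proof.
by have [z Az] := minty ip_norm 0 A_maxmon ltr01; exists z; eexists; exact: Az.
Qed.

End Resolvent.

Section VectorPrimitive.
Context {R : realType} {H : completeNormedModType R}.
Context (ip : {dot H for idfun}) (ip_norm : forall h : H, ip h h = `|h| ^+ 2).
Variables (T : R) (T_gt0 : 0 < T).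
Implicit Types (x y k w W p : R -> H) (v : R -> R).

(** W is an indefinite integral of w with respect to time; this is the notion of
    primitive for the bilinear map c, h |-> c h and the integrator r |-> r. *)
Definition antiderivative w W := forall s t h eta,
  0 <= s -> s <= t -> t <= T -> (forall r, s <= r <= t -> `|h - w r| <= eta) ->
  `|W t - W s - (t - s) *: h| <= eta * (t - s).

Lemma antiderivative_exists w : ucont T w -> exists W, W 0 = 0 /\ antiderivative w W.
Proof.
move=> uw; have dom : dominated T (fun r : R => r) (fun r => r).
  by move=> s t s0 st tT; rewrite ger0_norm // subr_ge0.
have [||||G pG] := @primitive_exists R H R H T (fun h c => c *: h) _ _ _ _ _ _ dom uw.
- by move=> h p q; rewrite scalerDl.
- by move=> h k p; rewrite scalerBr.
- by move=> h p; rewrite normrZ mulrC.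
- exact: ltW.
exists (fun r => G r - G 0); split; first by rewrite subrr.
move=> s t h eta s0 st tT hw.
by rewrite opprB addrA subrK; exact: pG.
Qed.

Lemma antiderivative_dominated w W : ucont T w -> antiderivative w W ->
  exists2 L, 0 <= L & dominated T W (fun r => L * r).
Proof.
move=> uw pW; have [M M0 hM] := ucont_bounded uw; exists M => // s t s0 st tT.
have := @pW s t 0 M s0 st tT; rewrite scaler0 subr0 mulrBr; apply.
by move=> r /andP[sr rt]; rewrite sub0r normrN hM //; apply/andP; split; lra.
Qed.

Lemma antiderivative_sub_scale w W z : antiderivative w W ->
  antiderivative (fun r => w r - z) (fun r => W r - r *: z).
Proof.
move=> pW s t h eta s0 st tT hw.
have -> : W t - t *: z - (W s - s *: z) - (t - s) *: h =
    W t - W s - (t - s) *: (h + z).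
  rewrite !scalerDr !scalerBl !opprD !opprK !addrA.
  by rewrite [LHS](ACl (1*3*5*6*2*4)).
apply: pW => // r /hw; by rewrite opprB addrA.
Qed.

(** The measure dW is w dr: on short intervals the increment of the integral is
    nearly <p, w> (t - s), and the errors are proportional to t - s. *)
Lemma RS_integral_ge p w W a b c : ucont T p -> ucont T w -> antiderivative w W ->
  0 <= a -> a <= b -> b <= T ->
  (forall r, a <= r <= b -> c <= ip (p r) (w r)) ->
  c * (b - a) <= RS_integral ip p W a b.
Proof.
move=> up uw pW a0 ab bT hc.
have [L L0 domW] := antiderivative_dominated uw pW.
have [G [pG ->//]] := RS_integral_primitive ip_norm (ltW T_gt0) up domW.
have [M M0 hM] := ucont_bounded up.
suff key e : 0 < e -> (c - (L + M) * e) * (b - a) <= G b - G a.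
  rewrite leNgt; apply/negP => G1.
  have ba : 0 < b - a.
    rewrite lt_neqAle subr_ge0 ab andbT; apply/eqP => ba; move: G1.
    have -> : b = a by lra.
    by rewrite !subrr mulr0 ltxx.
  pose q := c * (b - a) - (G b - G a).
  have e0 : 0 < q / (2 * (L + M + 1) * (b - a)).
    by rewrite divr_gt0 ?mulr_gt0 //; rewrite /q; lra.
  have := key _ e0; set e := q / _ in e0 *.
  have eE : e * (2 * (L + M + 1) * (b - a)) = q.
    by rewrite divfK // gt_eqF // !mulr_gt0 //; lra.
  have : 0 < e * (b - a) by rewrite mulr_gt0.
  have : q = 2 * ((L + M) * e * (b - a)) + 2 * (e * (b - a)) by rewrite -[LHS]eE; ring.
  have : 0 <= (L + M) * (e * (b - a)).
    by apply: mulr_ge0; [exact: addr_ge0|apply: mulr_ge0; exact: ltW].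
  by rewrite /q; rewrite mulrA; lra.
move=> e0; have [d1 d10 h1] := up _ e0; have [d2 d20 h2] := uw _ e0.
have d0 : 0 < Num.min d1 d2 by rewrite lt_min d10.
suff : forall s t, 0 <= s -> s <= t -> t <= T ->
   a <= s -> t <= b -> (c - (L + M) * e) * (t - s) <= G t - G s.
  by apply.
apply: (@chain_interval _ T (fun s t => a <= s -> t <= b ->
  (c - (L + M) * e) * (t - s) <= G t - G s) _ d0).
  move=> r s t r0 rs st tT P1 P2 ar tb.
  have := P1 ar (le_trans st tb); have := P2 (le_trans ar rs) tb; lra.
move=> s t s0 st tT; rewrite lt_min => /andP[ts1 ts2] As tb.
have sT : 0 <= s <= T by apply/andP; split; lra.
have hp r : s <= r <= t -> `|p s - p r| <= e.
  move=> /andP[sr rt]; apply: h1 => //; first by apply/andP; split; lra.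
  by rewrite ltr_norml; apply/andP; split; lra.
have hw r : s <= r <= t -> `|w s - w r| <= e.
  move=> /andP[sr rt]; apply: h2 => //; first by apply/andP; split; lra.
  by rewrite ltr_norml; apply/andP; split; lra.
have := pG _ _ _ _ s0 st tT hp; have := pW _ _ _ _ s0 st tT hw.
set dW := W t - W s => k1 k2.
have cs : c <= ip (p s) (w s) by apply: hc; apply/andP; split; lra.
have ts : 0 <= t - s by lra.
have : c * (t - s) <= ip (p s) (w s) * (t - s) by rewrite ler_wpM2r.
have : - (M * (e * (t - s))) <= ip (p s) (dW - (t - s) *: w s).
  apply: le_trans (ip_ge ip_norm _ _); rewrite lerN2.
  by apply: ler_pM => //; exact: hM.
rewrite ipDr ipNr ipZr; move: k2; rewrite ler_norml => /andP[k2 _].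
rewrite -!mulrBr in k2; rewrite !mulrBl !mulrDl; lra.
Qed.

Lemma ucont_right k t : ucont T k -> 0 < t < T -> k r @[r --> t^'+] --> k t.
Proof.
move=> uk /andP[t0 tT]; apply/cvgrPdist_le => e e0; have [d d0 hd] := uk _ e0.
have tI : 0 <= t <= T by apply/andP; split; lra.
near=> r; have tr : t < r by near: r; exact: nbhs_right_gt.
have rT : r < T by near: r; exact: nbhs_right_lt.
have rd : r < t + d by near: r; apply: nbhs_right_lt; lra.
apply: hd => //; first by apply/andP; split; lra.
by rewrite ltr_norml; apply/andP; split; lra.
Unshelve. all: by end_near. Qed.

Lemma ucont_BV0 k v : ucont T k -> dominated T k v -> k 0 = 0 -> BV0 T k.
Proof.
move=> uk kv k0; split=> //.
  by apply: le_lt_trans (dominated_Var kv) _; rewrite ltry.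
by move=> t; exact: ucont_right.
Qed.

Lemma dominated_ucont k L : dominated T k (fun r => L * r) -> ucont T k.
Proof.
move=> kL e e0.
have L1 : 0 < `|L| + 1 by have := normr_ge0 L; lra.
exists (e / (`|L| + 1)); first by rewrite divr_gt0.
have main s t : 0 <= s -> s <= t -> t <= T -> t - s < e / (`|L| + 1) -> `|k t - k s| <= e.
  move=> s0 st tT; rewrite ltr_pdivlMr // => h; apply: le_trans (kL _ _ s0 st tT) _.
  rewrite -mulrBr; have : L * (t - s) <= `|L| * (t - s).
    by rewrite ler_wpM2r ?ler_norm //; lra.
  lra.
move=> s t /andP[s0 sT] /andP[t0 tT] st.
have [ts|ts] := leP s t; last first.
  by apply: main => //; [exact: ltW|apply: le_lt_trans (ler_norm _) st].
by rewrite distrC; apply: main => //; apply: le_lt_trans (ler_norm _) _; rewrite distrC.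
Qed.

Section Curve.
Variables (A : set (H * H)) (A_maxmon : maximal_monotone ip A).
Local Notation J := (resolvent A).

Lemma ucont_resolvent lam y : 0 < lam -> ucont T y -> ucont T (fun r => J lam (y r)).
Proof.
move=> l0 uy e /uy[d d0 hd]; exists d => // s t sT tT st.
by apply: le_trans (resolvent_nonexpansive ip_norm A_maxmon _ _ l0) _; exact: hd.
Qed.

Lemma ucont_yosida lam y : 0 < lam -> ucont T y ->
  ucont T (fun r => lam^-1 *: (y r - J lam (y r))).
Proof.
move=> l0 uy.
have := ucont_lin lam^-1 (ucontB uy (ucont_resolvent l0 uy)) (ucont_cst T 0).
by congr ucont; apply/funext => r; rewrite addr0.
Qed.

(** The source of elements of the realization: for y continuous take J y and the
    integral W of the Yosida approximation (y - J y) / lam, which belongs to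
    A (J y) at every time. *)
Lemma realization_resolvent lam y W : 0 < lam -> ucont T y -> W 0 = 0 ->
  antiderivative (fun r => lam^-1 *: (y r - J lam (y r))) W ->
  realization ip T A (fun r => J lam (y r), W).
Proof.
move=> l0 uy W0 pW; have uw := ucont_yosida l0 uy; have uJ := ucont_resolvent l0 uy.
have [L L0 WL] := antiderivative_dominated uw pW.
split => /=; first exact/ucontP.
  exact: ucont_BV0 (dominated_ucont WL) WL W0.
move=> z zs Az s t s0 st tT; rewrite -(mul0r (t - s)).
apply: (@RS_integral_ge (fun r => J lam (y r) - z) _ _ s t 0 _ _
  (@antiderivative_sub_scale _ _ zs pW)) => //.
- exact: ucontB uJ (ucont_cst T z).
- exact: ucontB uw (ucont_cst T zs).
- move=> r _; exact: (A_maxmon.1 _ _ _ _ (resolventP ip_norm A_maxmon (y r) l0) Az).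
Qed.

End Curve.

Lemma RS_integral_le x u k w W v a b kap c :
  ucont T x -> ucont T u -> dominated T k v -> ucont T w -> antiderivative w W ->
  0 <= a -> a <= b -> b <= T ->
  (forall r, a <= r <= b -> `|x r - u r| <= kap) ->
  (forall r, a <= r <= b -> c <= ip (x r - u r) (w r)) ->
  RS_integral ip (fun r => x r - u r) (fun r => k r - W r) a b <=
    kap * (v b - v a) - c * (b - a).
Proof.
move=> ux uu kv uw pW a0 ab bT hk hc.
have uxu := ucontB ux uu.
have [L L0 WL] := antiderivative_dominated uw pW.
have -> : RS_integral ip (fun r => x r - u r) (fun r => k r - W r) a b =
    -1 * RS_integral ip (fun r => x r - u r) W a b + RS_integral ip (fun r => x r - u r) k a b.
  apply: (RS_integral_linr ip_norm (ltW T_gt0) uxu WL kv) => // r.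
  by rewrite scaleN1r addrC.
have := RS_integral_ge uxu uw pW a0 ab bT hc.
have := RS_integral_norm ip_norm (ltW T_gt0) uxu kv a0 ab bT hk.
rewrite ler_norml => /andP[_]; lra.
Qed.

End VectorPrimitive.

(** * Maximality of the realization *)

Section Blend.
Context {R : realType} {H : normedModType R}.
Variable T : R.
Implicit Types (x q : R -> H) (a b : R).

Definition ramp a b (r : R) := Num.max 0 (Num.min 1 ((r - a) / (b - a))).

Lemma ramp_ge0 a b r : 0 <= ramp a b r.
Proof. by rewrite le_max lexx. Qed.

Lemma ramp_le1 a b r : ramp a b r <= 1.
Proof. by rewrite ge_max ler01 ge_min lexx. Qed.

Lemma ramp0 a b r : a < b -> r <= a -> ramp a b r = 0.
Proof.
move=> ab ra; apply/max_idPl; rewrite ge_min; apply/orP; right.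
by rewrite ler_pdivrMr; lra.
Qed.

Lemma ramp1 a b r : a < b -> b <= r -> ramp a b r = 1.
Proof.
move=> ab br; rewrite /ramp min_l; first by rewrite max_r.
by rewrite ler_pdivlMr; lra.
Qed.

Lemma ramp_lipschitz a b r s : a < b -> `|ramp a b r - ramp a b s| <= `|r - s| / (b - a).
Proof.
move=> ab; have clamp (p q : R) :
    `|Num.max 0 (Num.min 1 p) - Num.max 0 (Num.min 1 q)| <= `|p - q|.
  have h1 := ler_norm (p - q); have h2 := ler_norm (q - p).
  rewrite (distrC q p) in h2; rewrite ler_norml.
  by case: (leP 1 p) => ?; case: (leP 1 q) => ?; rewrite ?(max_r ler01);
     case: (leP 0 p) => ?; case: (leP 0 q) => ?; apply/andP; split; lra.
apply: le_trans (clamp _ _) _; rewrite -mulrBl normrM.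
have -> : r - a - (s - a) = r - s by ring.
by rewrite [X in _ * X]gtr0_norm // invr_gt0; lra.
Qed.

Definition blend a b x q (r : R) := x r + ramp a b r *: (q r - x r).

Lemma ucont_blend a b x q : a < b -> ucont T x -> ucont T q -> ucont T (blend a b x q).
Proof.
move=> ab ux uq; apply: ucontD => //.
have uz := ucontB uq ux.
set z := fun r => _ in uz.
have [M M0 hM] := ucont_bounded uz.
have ba : 0 < b - a by lra.
move=> e e0; have e2 : 0 < e / 2 by rewrite divr_gt0.
have e3 : 0 < e / 2 * (b - a) / (M + 1) by rewrite divr_gt0 ?mulr_gt0 //; lra.
have [d d0 hd] := uz _ e2; exists (Num.min d (e / 2 * (b - a) / (M + 1))).
  by rewrite lt_min d0.
move=> s t sT tT; rewrite lt_min => /andP[st1 st2].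
have -> : ramp a b s *: (q s - x s) - ramp a b t *: (q t - x t) =
   ramp a b s *: (z s - z t) + (ramp a b s - ramp a b t) *: z t.
  by rewrite (scalerBr _ (z s)) scalerBl addrA subrK.
apply: le_trans (ler_normD _ _) _; rewrite !normrZ.
have h1 : `|ramp a b s| * `|z s - z t| <= 1 * (e / 2).
  apply: ler_pM => //; last exact: hd.
  by rewrite ger0_norm ?ramp_ge0 // ramp_le1.
have h2 : `|ramp a b s - ramp a b t| * `|z t| <= e / 2 * (b - a) / (M + 1) / (b - a) * (M + 1).
  apply: ler_pM => //; last by apply: le_trans (hM _ tT) _; lra.
  apply: le_trans (ramp_lipschitz _ _ ab) _; rewrite ler_pM2r ?invr_gt0 //.
  exact: ltW.
have E : e / 2 * (b - a) / (M + 1) / (b - a) * (M + 1) = e / 2.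
  by field; apply/andP; split; lra.
by rewrite E in h2; lra.
Qed.

Lemma blend_left a b x q r : a < b -> r <= a -> blend a b x q r = x r.
Proof. by move=> ab ra; rewrite /blend ramp0 // scale0r addr0. Qed.

Lemma blend_right a b x q r : a < b -> b <= r -> blend a b x q r = q r.
Proof. by move=> ab br; rewrite /blend ramp1 // scale1r addrC subrK. Qed.

Lemma blend_dist a b x q r p D : `|x r - p| <= D -> `|q r - p| <= D ->
  `|blend a b x q r - p| <= D.
Proof.
move=> xp qp; rewrite /blend; set c := ramp a b r.
have c0 : 0 <= c by exact: ramp_ge0.
have c1 : c <= 1 by exact: ramp_le1.
have -> : x r + c *: (q r - x r) - p = (1 - c) *: (x r - p) + c *: (q r - p).
  rewrite scalerBl scale1r -[RHS]addrA [- _ + _]addrC -scalerBr.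
  have -> : q r - p - (x r - p) = q r - x r by rewrite opprB addrA subrK.
  by rewrite addrAC.
apply: le_trans (ler_normD _ _) _; rewrite !normrZ !ger0_norm //; last lra.
have : (1 - c) * `|x r - p| <= (1 - c) * D by rewrite ler_wpM2l //; lra.
have : c * `|q r - p| <= c * D by rewrite ler_wpM2l.
lra.
Qed.

End Blend.

Section LowVariation.
Context {R : realType}.
Variables (v : R -> R) (s t : R).
Hypothesis (st : s < t).
Hypothesis vmono : forall p q, s <= p -> p <= q -> q <= t -> v p <= v q.

(** Close to the infimum of v on ]s, t[ the increments of v are small. This
    finds places for rapid transitions of the test curve without using the
    continuity of the variation function. *)
Lemma exists_low_variation e : 0 < e ->
  exists a b, [/\ s < a, a < b, b < t & v b - v a <= e].
Proof.
move=> e0; have st' := st; pose S := [set v r | r in [set r | s < r < t]].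
have S0 : has_inf S.
  split; first by exists (v ((s + t) / 2)); exists ((s + t) / 2) => //=; apply/andP; split; lra.
  by exists (v s) => _ [r /= /andP[sr rt] <-]; apply: vmono => //; exact: ltW.
have [_ [b /= /andP[sb bt] <-] hb] := inf_adherent e0 S0.
exists ((s + b) / 2), b; split=> //; [lra|lra|].
have : inf S <= v ((s + b) / 2).
  by apply: ge_inf; [exact: S0.2|exists ((s + b) / 2) => //=; apply/andP; split; lra].
lra.
Qed.

End LowVariation.

Section EscapeOffDomain.
Context {R : realType} {H : completeNormedModType R}.
Context (ip : {dot H for idfun}) (ip_norm : forall h : H, ip h h = `|h| ^+ 2).
Variables (A : set (H * H)) (A_maxmon : maximal_monotone ip A).
Variables (T : R) (T_gt0 : 0 < T).
Implicit Types (x y k g u us : R -> H) (v : R -> R).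
Local Notation J := (resolvent A).

Lemma sub_itv0T a b r : 0 <= a -> b <= T -> a <= r <= b -> 0 <= r <= T.
Proof.
by move=> a0 bT /andP[ar rb]; rewrite (le_trans a0 ar) (le_trans rb bT).
Qed.

Lemma primitive_ucont z g v G : ucont T z -> ucont T g -> dominated T g v ->
  primitive_on ip 0 T z g v G -> forall e, 0 < e -> exists2 d, 0 < d &
  forall a b, 0 <= a -> a <= b -> b <= T -> b - a < d -> `|G b - G a| <= e.
Proof.
move=> uz ug gv pG e e0; have [M M0 hM] := ucont_bounded uz.
have vT := dominated_ge0 gv (lexx 0) (ltW T_gt0) (lexx T).
have e1 : 0 < e / (2 * (v T - v 0 + 1)) by rewrite divr_gt0 //; lra.
have e2 : 0 < e / (2 * (M + 1)) by rewrite divr_gt0 //; lra.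
have [d1 d10 h1] := uz _ e1; have [d2 d20 h2] := ug _ e2.
exists (Num.min d1 d2); first by rewrite lt_min d10.
move=> a b a0 ab bT; rewrite lt_min => /andP[ba1 ba2].
have aT : 0 <= a <= T by apply/andP; split; lra.
have bI : 0 <= b <= T by apply/andP; split; lra.
have := @pG a b (z a) _ a0 ab bT; move=> /(_ (e / (2 * (v T - v 0 + 1)))) hG.
have {hG} : `|G b - G a - ip (z a) (g b - g a)| <= e / (2 * (v T - v 0 + 1)) * (v b - v a).
  apply: hG => r /andP[ar rb]; apply: h1 => //; first by apply/andP; split; lra.
  by rewrite ltr_norml; apply/andP; split; lra.
have gba : `|g b - g a| <= e / (2 * (M + 1)) by apply: h2 => //; rewrite ger0_norm; lra.
have : `|ip (z a) (g b - g a)| <= (M + 1) * (e / (2 * (M + 1))).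
  apply: le_trans (Cauchy_Schwarz ip_norm _ _) _; apply: ler_pM => //.
  by apply: le_trans (hM _ aT) _; lra.
have -> : (M + 1) * (e / (2 * (M + 1))) = e / 2 by field; lra.
have : e / (2 * (v T - v 0 + 1)) * (v b - v a) <= e / (2 * (v T - v 0 + 1)) * (v T - v 0 + 1).
  rewrite ler_pM2l //; have := dominated_ge0 gv (lexx 0) a0 (le_trans ab bT).
  have := dominated_ge0 gv (le_trans a0 ab) bT (lexx T); lra.
have -> : e / (2 * (v T - v 0 + 1)) * (v T - v 0 + 1) = e / 2 by field; lra.
have := ler_normD (G b - G a - ip (z a) (g b - g a)) (ip (z a) (g b - g a)).
rewrite subrK; lra.
Qed.

(** J lam converges to the identity on the closure of Dom A, uniformly along a
    curve because J lam is nonexpansive. *)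
Lemma resolvent_cvg x kap : ucont T x ->
  (forall r, 0 <= r <= T -> closure (Dom A) (x r)) -> 0 < kap ->
  exists2 l0, 0 < l0 & forall lam, 0 < lam -> lam <= l0 ->
    forall r, 0 <= r <= T -> `|x r - J lam (x r)| <= kap.
Proof.
move=> ux xD k0; have k4 : 0 < kap / 8 by rewrite divr_gt0.
have [d d0 hd] := ux _ k4.
have T0 := ltW T_gt0.
have [l0 [l00 hl]] : exists l0, 0 < l0 /\ forall lam, 0 < lam -> lam <= l0 ->
    forall r, 0 <= r <= T -> `|x r - J lam (x r)| <= kap.
  apply: (@chain_interval _ T (fun s t => exists l0, 0 < l0 /\
    forall lam, 0 < lam -> lam <= l0 ->
    forall r, s <= r <= t -> `|x r - J lam (x r)| <= kap) d) => //.
    move=> r s t r0 rs st tT [l1 [l10 h1]] [l2 [l20 h2]].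
    exists (Num.min l1 l2); rewrite lt_min l10; split=> // lam lam0.
    rewrite le_min => /andP[lam1 lam2] q /andP[rq qt].
    have [qs|sq] := leP q s; first by apply: h1 => //; rewrite rq.
    by apply: h2 => //; rewrite (ltW sq).
  move=> s t s0 st tT ts.
  have sT : 0 <= s <= T by apply/andP; split; lra.
  have [z [[zs Az] xz]] := xD s sT _ (nbhsx_ballx (x s) _ k4).
  move: xz; rewrite -ball_normE /= => xz.
  have zs0 := normr_ge0 zs.
  have n0 : 0 < `|zs| + 1 by lra.
  exists (kap / (4 * (`|zs| + 1))); split; first by rewrite divr_gt0 //; lra.
  move=> lam lam0 hlam r /andP[sr rt].
  have rT : 0 <= r <= T by apply/andP; split; lra.
  have rs : `|r - s| < d by rewrite ger0_norm; lra.
  have xr := hd _ _ rT sT rs.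
  apply: le_trans (resolvent_dist ip_norm A_maxmon (x r) lam0 Az) _.
  have := ler_distD (x s) (x r) z.
  have : lam * (`|zs| + 1) <= kap / 4.
    move: hlam; rewrite ler_pdivlMr; last lra.
    by move=> h; rewrite ler_pdivlMr //; lra.
  by rewrite mulrDr; lra.
by exists l0.
Qed.

(** The pair (x, k) fails to be monotonically related to some element of the
    realization. *)
Definition separated_from_realization x k := exists u us,
  [/\ realization ip T A (u, us), ucont T u &
      RS_integral ip (fun r => x r - u r) (fun r => k r - us r) 0 T < 0].

(** Take u = J x, and for us the integral of (x - J x) / lam. Against dk the integral of x - u is
    bounded uniformly in lam, while against dus it is the integral of
    |x - J x|^2 / lam, which blows up as lam tends to 0 since x stays away from
    Dom A on an interval around r0. *)
Lemma separated_off_Dom x k v r0 : ucont T x -> dominated T k v ->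
  0 <= r0 <= T -> ~ closure (Dom A) (x r0) -> separated_from_realization x k.
Proof.
move=> ux kv r0T nD.
have [e e0 he] : exists2 e, 0 < e & forall z, Dom A z -> e <= `|x r0 - z|.
  apply: contrapT => nE; apply: nD => B /nbhs_ballP[e /= e0 eB].
  apply: contrapT => nB; apply: nE; exists e => // z Dz.
  rewrite leNgt; apply/negP => ze; apply: nB; exists z; split=> //.
  by apply: eB; rewrite -ball_normE.
have e20 : 0 < e / 2 by rewrite divr_gt0.
have [d d0 hd] := ux _ e20.
have [a [b [a0 ab bT bd /andP[ar0 r0b]]]] := small_interval T_gt0 r0T d0.
have [z0 [zs0 Az0]] := maximal_monotone_neq0 ip_norm A_maxmon.
have [X X0 hX] := ucont_bounded ux.
pose kap := 2 * (X + `|z0|) + `|zs0|.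
have kap0 : 0 <= kap by rewrite /kap; have := normr_ge0 z0; have := normr_ge0 zs0; lra.
have vT := dominated_ge0 kv (lexx 0) (ltW T_gt0) (lexx T).
pose c := (e / 2) ^+ 2.
have c0 : 0 < c by rewrite exprn_gt0.
have N0 : 0 < kap * (v T - v 0) + 1.
  by apply: ltr_wpDl => //; rewrite mulr_ge0 // subr_ge0.
pose lam := Num.min 1 (c * (b - a) / (kap * (v T - v 0) + 1)).
have ba : 0 < b - a by lra.
have lam0 : 0 < lam by rewrite lt_min ltr01 divr_gt0 // mulr_gt0.
have lam1 : lam <= 1 by rewrite ge_min lexx.
have lamE : lam * (kap * (v T - v 0) + 1) <= c * (b - a).
  by rewrite -ler_pdivlMr // ge_min lexx orbT.
pose u r := J lam (x r); pose w r := lam^-1 *: (x r - u r).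
have uu : ucont T u := ucont_resolvent ip_norm A_maxmon lam0 ux.
have uw : ucont T w := ucont_yosida ip_norm A_maxmon lam0 ux.
have [W [W0 pW]] := antiderivative_exists T_gt0 uw.
exists u, W; split=> //.
  exact: (realization_resolvent ip_norm T_gt0 A_maxmon lam0 ux W0 pW).
have [L L0 WL] := antiderivative_dominated uw pW.
have hk r : 0 <= r <= T -> `|x r - u r| <= kap.
  move=> rT; apply: le_trans (resolvent_dist ip_norm A_maxmon (x r) lam0 Az0) _.
  have : lam * `|zs0| <= 1 * `|zs0| by rewrite ler_wpM2r.
  have := ler_normB (x r) z0; have := hX r rT; rewrite /kap; lra.
have ipw r : ip (x r - u r) (w r) = lam^-1 * `|x r - u r| ^+ 2.
  by rewrite /w ipZr ip_norm.
have lV : 0 <= lam^-1 by rewrite invr_ge0 ltW.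
have hw r : 0 <= ip (x r - u r) (w r) by rewrite ipw mulr_ge0 // sqr_ge0.
have hab r : a <= r <= b -> c / lam <= ip (x r - u r) (w r).
  move=> /andP[ar rb]; rewrite ipw mulrC; apply: ler_wpM2l => //.
  rewrite /c ler_pXn2r ?nnegrE ?(ltW e20) //.
  have uD : Dom A (u r) by exists (w r); exact: (resolventP ip_norm A_maxmon (x r) lam0).
  have := he _ uD.
  have rr : `|x r0 - x r| <= e / 2.
    apply: hd => //; first by apply/andP; split; lra.
    by rewrite ltr_norml; apply/andP; split; lra.
  have := ler_distD (x r) (x r0) (u r); lra.
have uxu := ucontB ux uu; have kW := dominatedB kv WL.
have T0 := ltW T_gt0.
have b0 := le_trans a0 (ltW ab); have aT := le_trans (ltW ab) bT.
rewrite (RS_integral_cat ip_norm T0 uxu kW (lexx 0) a0 _ (lexx T)); last lra.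
rewrite (RS_integral_cat ip_norm T0 uxu kW a0 (ltW ab) bT (lexx T)).
have piece p r c' := @RS_integral_le _ _ _ ip_norm _ T_gt0 x u k w W v p r kap c' ux uu kv uw pW.
have I1 : RS_integral ip (fun r => x r - u r) (fun r => k r - W r) 0 a <=
    kap * (v a - v 0) - 0 * (a - 0).
  by apply: piece => // r /(sub_itv0T (lexx 0) aT); exact: hk.
have I2 : RS_integral ip (fun r => x r - u r) (fun r => k r - W r) a b <=
    kap * (v b - v a) - c / lam * (b - a).
  by apply: piece => //; [exact: ltW|move=> r /(sub_itv0T a0 bT); exact: hk].
have I3 : RS_integral ip (fun r => x r - u r) (fun r => k r - W r) b T <=
    kap * (v T - v b) - 0 * (T - b).
  by apply: piece => // r /(sub_itv0T b0 (lexx T)); exact: hk.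
have : kap * (v T - v 0) < c / lam * (b - a).
  rewrite mulrAC ltr_pdivlMr //; apply: lt_le_trans lamE; rewrite mulrC ltr_pM2l //; lra.
lra.
Qed.

End EscapeOffDomain.

Section EscapeOnDomain.
Context {R : realType} {H : completeNormedModType R}.
Context (ip : {dot H for idfun}) (ip_norm : forall h : H, ip h h = `|h| ^+ 2).
Variables (A : set (H * H)) (A_maxmon : maximal_monotone ip A).
Variables (T : R) (T_gt0 : 0 < T).
Implicit Types (x y k g u us : R -> H) (v : R -> R).
Local Notation J := (resolvent A).

(** The test curve u is J y, where y equals x outside [a1, b2] and
    p = z + lam zs on [b1, a2], so that u = z and us has slope zs there. Outside
    [a1, b2], x - u is at most kap and pairs nonnegatively with the slope of us; on
    the two transitions [a1, b1] and [a2, b2] everything is bounded, by constants that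
    depend on lam but not on the transitions. *)
Lemma bridge_curve x k v z zs lam kap D a1 b1 a2 b2 :
  ucont T x -> dominated T k v -> A (z, zs) -> 0 < lam -> lam <= 1 ->
  (forall r, 0 <= r <= T -> `|x r - J lam (x r)| <= kap) ->
  (forall r, 0 <= r <= T -> `|x r - (z + lam *: zs)| <= D) ->
  0 <= a1 -> a1 < b1 -> b1 <= a2 -> a2 < b2 -> b2 <= T ->
  let M := 2 * D + `|zs| in
  exists u us, [/\ realization ip T A (u, us), ucont T u &
   RS_integral ip (fun r => x r - u r) (fun r => k r - us r) 0 T <=
     kap * (v T - v 0) + M * (v b1 - v a1 + (v b2 - v a2)) +
     M * (lam^-1 * M) * (b1 - a1 + (b2 - a2)) +
     RS_integral ip (fun r => x r - z) (fun r => k r - r *: zs) b1 a2].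
Proof.
have total (i1 i2 i3 i4 i5 kk va1 v0 vT vb2 k1 k2 c e1 e2 : R) :
    i1 <= kk * (va1 - v0) -> i2 <= k1 + c * e1 -> i4 <= k2 + c * e2 ->
    i5 <= kk * (vT - vb2) -> 0 <= kk * (vb2 - va1) ->
    i1 + (i2 + (i3 + (i4 + i5))) <= kk * (vT - v0) + (k1 + k2) + c * (e1 + e2) + i3.
  by move=> *; lra.
move=> ux kv Az lam0 lam1 hJ xp a10 ab1 b1a2 ab2 b2T M.
have T0 := ltW T_gt0.
have b10 : 0 <= b1 := le_trans a10 (ltW ab1).
have a20 : 0 <= a2 := le_trans b10 b1a2.
have b20 : 0 <= b2 := le_trans a20 (ltW ab2).
have a2T : a2 <= T := le_trans (ltW ab2) b2T.
have b1T : b1 <= T := le_trans b1a2 a2T.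
have a1T : a1 <= T := le_trans (ltW ab1) b1T.
have a1a2 : a1 <= a2 := le_trans (ltW ab1) b1a2.
have b1b2 : b1 <= b2 := le_trans b1a2 (ltW ab2).
have lV : 0 <= lam^-1 by rewrite invr_ge0 ltW.
set p := z + lam *: zs in xp *.
have Jp : J lam p = z by exact: (resolvent_graph ip_norm A_maxmon lam0 Az).
have pz : `|p - z| <= `|zs|.
  rewrite /p addrC addKr normrZ gtr0_norm // -[X in _ <= X]mul1r.
  exact: ler_wpM2r.
have D0 : 0 <= D by apply: le_trans (xp 0 _); rewrite ?lexx.
have M0 : 0 <= M by rewrite addr_ge0 // mulr_ge0.
have ME : D + `|zs| + D = M by rewrite /M; ring.
pose y1 := blend a1 b1 x (fun=> p); pose y := blend a2 b2 y1 x.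
have uy1 : ucont T y1 := ucont_blend ab1 ux (ucont_cst T p).
have uy : ucont T y := ucont_blend ab2 uy1 ux.
have yx r : r <= a1 \/ b2 <= r -> y r = x r.
  move=> [ra|br]; last by rewrite /y blend_right.
  by rewrite /y blend_left ?(le_trans ra) // /y1 blend_left.
have yp r : b1 <= r <= a2 -> y r = p.
  by move=> /andP[br ra]; rewrite /y blend_left // /y1 blend_right.
have ypD r : 0 <= r <= T -> `|y r - p| <= D.
  move=> rT; apply: blend_dist; last exact: xp.
  by apply: blend_dist; [exact: xp|rewrite subrr normr0].
pose u r := J lam (y r); pose w r := lam^-1 *: (y r - u r).
have uu : ucont T u := ucont_resolvent ip_norm A_maxmon lam0 uy.
have uw : ucont T w := ucont_yosida ip_norm A_maxmon lam0 uy.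
have [W [W0 pW]] := antiderivative_exists T_gt0 uw.
have [L L0 WL] := antiderivative_dominated uw pW.
exists u, W; split=> //.
  exact: (realization_resolvent ip_norm T_gt0 A_maxmon lam0 uy W0 pW).
have uz r : 0 <= r <= T -> `|z - u r| <= D.
  move=> rT; rewrite distrC -Jp; apply: le_trans (ypD _ rT).
  exact: (resolvent_nonexpansive ip_norm A_maxmon).
have far (q : H) r : 0 <= r <= T -> `|q - p| <= D -> `|q - u r| <= M.
  move=> rT qp; rewrite -ME; apply: le_trans (ler_distD z _ _) _.
  apply: lerD; last exact: uz.
  by apply: le_trans (ler_distD p _ _) _; apply: lerD.
have xuM r : 0 <= r <= T -> `|x r - u r| <= M.
  by move=> rT; apply: far => //; exact: xp.
have wN r : 0 <= r <= T -> `|w r| <= lam^-1 * M.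
  move=> rT; rewrite normrZ ger0_norm //; apply: ler_wpM2l => //.
  by apply: far => //; exact: ypD.
have xuw r : 0 <= r <= T -> - (M * (lam^-1 * M)) <= ip (x r - u r) (w r).
  move=> rT; apply: le_trans (ip_ge ip_norm _ _); rewrite lerN2.
  by apply: ler_pM => //; [exact: xuM|exact: wN].
have xuk r : 0 <= r <= T -> r <= a1 \/ b2 <= r -> `|x r - u r| <= kap.
  by move=> rT /yx e; rewrite /u e; exact: hJ.
have xuw0 r : r <= a1 \/ b2 <= r -> 0 <= ip (x r - u r) (w r).
  move=> /yx e; rewrite /w ipZr e.
  by rewrite mulr_ge0 // ip_norm sqr_ge0.
have uxu := ucontB ux uu; have kW := dominatedB kv WL.
have piece a b kap' c := @RS_integral_le _ _ _ ip_norm _ T_gt0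
  x u k w W v a b kap' c ux uu kv uw pW.
have I1 : RS_integral ip (fun r => x r - u r) (fun r => k r - W r) 0 a1 <=
    kap * (v a1 - v 0) - 0 * (a1 - 0).
  apply: piece => // r rI.
    by apply: xuk; [exact: sub_itv0T rI|left; case/andP: rI].
  by apply: xuw0; left; case/andP: rI.
have I2 : RS_integral ip (fun r => x r - u r) (fun r => k r - W r) a1 b1 <=
    M * (v b1 - v a1) - - (M * (lam^-1 * M)) * (b1 - a1).
  by apply: piece; rewrite ?(ltW ab1) // => r /(sub_itv0T a10 b1T) rI; [exact: xuM|exact: xuw].
have I4 : RS_integral ip (fun r => x r - u r) (fun r => k r - W r) a2 b2 <=
    M * (v b2 - v a2) - - (M * (lam^-1 * M)) * (b2 - a2).
  by apply: piece; rewrite ?(ltW ab2) // => r /(sub_itv0T a20 b2T) rI; [exact: xuM|exact: xuw].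
have I5 : RS_integral ip (fun r => x r - u r) (fun r => k r - W r) b2 T <=
    kap * (v T - v b2) - 0 * (T - b2).
  apply: piece => // r rI.
    by apply: xuk; [exact: sub_itv0T rI|right; case/andP: rI].
  by apply: xuw0; right; case/andP: rI.
have wzs r : b1 <= r <= a2 -> w r = zs.
  move=> rI; rewrite /w /u yp // Jp /p addrC addKr scalerA mulVf ?scale1r //.
  by rewrite gt_eqF.
have I3 : RS_integral ip (fun r => x r - u r) (fun r => k r - W r) b1 a2 =
    RS_integral ip (fun r => x r - z) (fun r => k r - r *: zs) b1 a2.
  apply: (eq_RS_integral ip_norm T0 (ucontB ux (ucont_cst T z))
    (dominatedB kv (dominated_scale zs))) => //.
    by move=> r rI; rewrite /u yp // Jp.
  move=> r r' br rr ra.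
  have hz j : r <= j <= r' -> `|zs - w j| <= 0.
    move=> /andP[rj jr]; rewrite wzs ?subrr ?normr0 //.
    by rewrite (le_trans br rj) (le_trans jr ra).
  have := pW r r' zs 0 (le_trans b10 br) rr (le_trans ra a2T) hz.
  rewrite mul0r normr_le0 subr_eq0 => /eqP WE.
  have -> : k r' - W r' - (k r - W r) = (k r' - k r) - (W r' - W r).
    by rewrite !opprD !opprK addrACA.
  by rewrite WE scalerBl !opprD !opprK addrACA.
have kc a b c := RS_integral_cat ip_norm T0 uxu kW (a := a) (b := b) (c := c).
rewrite (kc 0 a1 T) // (kc a1 b1 T) // ?(ltW ab1) // (kc b1 a2 T) //.
rewrite (kc a2 b2 T) // ?(ltW ab2) // I3.
have k0 : 0 <= kap by apply: le_trans (hJ 0 _); rewrite ?lexx.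
rewrite (mulrDr M); apply: (total _ _ _ _ _ _ (v a1) _ _ (v b2)).
- by move: I1; rewrite mul0r subr0.
- by move: I2; rewrite mulNr opprK.
- by move: I4; rewrite mulNr opprK.
- by move: I5; rewrite mul0r subr0.
- by rewrite mulr_ge0 // subr_ge0 (dominated_ge0 kv) // (le_trans (ltW ab1)).
Qed.

(** When x takes its values in the closure of Dom A, a violation of the defining
    inequality at (z, zs) on [s, t] is turned into a violation on [0,T] by
    bridge_curve: first lam is chosen so that J lam is close to the identity along
    x, then the transitions so short, and of so small variation for k, that their
    contribution is negligible. *)
Lemma separated_on_Dom x k v z zs s t : ucont T x -> ucont T k -> dominated T k v ->
  (forall r, 0 <= r <= T -> closure (Dom A) (x r)) -> A (z, zs) ->
  0 <= s -> s <= t -> t <= T ->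
  RS_integral ip (fun r => x r - z) (fun r => k r - r *: zs) s t < 0 ->
  separated_from_realization ip A T x k.
Proof.
have gap (p r d : R) : d <= (r - p) / 2 -> p + d <= r - d by move=> *; lra.
have len (c1 p1 p2 p3 p4 d r1 : R) : c1 < p1 -> p2 < c1 + d -> r1 - d < p3 ->
    p4 < r1 -> p2 - p1 + (p4 - p3) <= d + d by move=> *; lra.
have total (q g1 g2 g3 Gt Gs Gb Ga d c : R) : q = - (Gt - Gs) -> 0 < q -> g1 <= q / 8 ->
    g2 <= c + c -> c <= q / 16 -> g3 <= d + d -> d <= q / 16 ->
    - (q / 8) <= Gb - Gs -> - (q / 8) <= Gt - Ga ->
    g1 + g2 + g3 + (Ga - Gb) < 0.
  by move=> *; lra.
move=> ux uk kv xD Az s0 st tT.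
have T0 := ltW T_gt0.
have uxz := ucontB ux (ucont_cst T z).
have zsd := dominated_scale (T := T) zs.
have kz := dominatedB kv zsd.
have uzs : ucont T (fun r => r *: zs).
  apply: (dominated_ucont (L := `|zs|)) => p r p0 pr rT.
  by rewrite [_ * r]mulrC [_ * p]mulrC; exact: zsd.
have [G [pG GE]] := RS_integral_primitive ip_norm T0 uxz kz.
have cG := primitive_ucont ip_norm T_gt0 uxz (ucontB uk uzs) kz pG.
rewrite GE // => I0; set q := - (G t - G s).
have q0 : 0 < q by rewrite oppr_gt0.
have {}st : s < t.
  by rewrite lt_neqAle st andbT; apply/eqP => E; move: I0; rewrite E subrr ltxx.
have vmono := dominated_ge0 kv.
have vT := vmono 0 T (lexx 0) T0 (lexx T).
have [X X0 hX] := ucont_bounded ux.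
have z0 := normr_ge0 z; have zs0 := normr_ge0 zs.
(* The deficit q > 0 is shared out: at most q / 8 to the part outside [a1, b2],
   q / 4 to the transitions and q / 4 to the change from [s, t] to [b1, a2]. *)
pose kap := q / (8 * (v T - v 0 + 1)).
have kap0 : 0 < kap by rewrite divr_gt0 // mulr_gt0 // ltr_wpDl // subr_ge0.
have kapV : kap * (v T - v 0) <= q / 8.
  have -> : q / 8 = kap * (v T - v 0 + 1).
    by rewrite /kap; field; rewrite gt_eqF // ltr_wpDl // subr_ge0.
  by rewrite ler_pM2l // lerDl.
have [l0 l00 hl0] := resolvent_cvg ip_norm A_maxmon T_gt0 ux xD kap0.
pose lam := Num.min 1 l0.
have lam0 : 0 < lam by rewrite lt_min ltr01.
have lam1 : lam <= 1 by rewrite ge_min lexx.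
have hJ : forall r, 0 <= r <= T -> `|x r - J lam (x r)| <= kap.
  by apply: hl0 => //; rewrite ge_min lexx orbT.
pose D := X + `|z| + `|zs|.
have xp r : 0 <= r <= T -> `|x r - (z + lam *: zs)| <= D.
  move=> rT; rewrite opprD addrA; apply: le_trans (ler_normB _ _) _.
  apply: lerD; first by apply: le_trans (ler_normB _ _) _; rewrite lerD2r hX.
  rewrite normrZ gtr0_norm // -[X in _ <= X]mul1r; exact: ler_wpM2r.
pose M := 2 * D + `|zs|.
have M0 : 0 <= M by rewrite !addr_ge0 // mulr_ge0 // !addr_ge0.
pose C := M * (lam^-1 * M).
have C0 : 0 <= C by rewrite !mulr_ge0 // invr_ge0 ltW.
have q80 : 0 < q / 8 by rewrite divr_gt0.
have [dG dG0 hG] := cG _ q80.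
have C1 : 0 < C + 1 by rewrite ltr_wpDl.
have M1 : 0 < M + 1 by rewrite ltr_wpDl.
pose dl := Num.min (Num.min dG (q / 16 / (C + 1))) ((t - s) / 2).
have ts0 : 0 < t - s by rewrite subr_gt0.
have dl0 : 0 < dl by rewrite !lt_min dG0 !divr_gt0.
have dlG : dl <= dG by rewrite !ge_min lexx.
have dlP : dl * (C + 1) <= q / 16 by rewrite -ler_pdivlMr // !ge_min lexx orbT.
have dlt : dl <= (t - s) / 2 by rewrite !ge_min lexx orbT.
pose eps := q / (16 * (M + 1)).
have eps0 : 0 < eps by rewrite divr_gt0 // mulr_gt0.
have Meps : M * eps <= q / 16.
  have -> : q / 16 = (M + 1) * eps by rewrite /eps; field; rewrite gt_eqF.
  by rewrite ler_pM2r // lerDl.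
have sdt : s + dl <= t - dl by exact: gap.
have sdl : s < s + dl by rewrite ltrDl.
have tdl : t - dl < t by rewrite gtrBl.
have sdT : s + dl <= T by apply: le_trans sdt _; apply: le_trans (ltW tdl) tT.
have td0 : 0 <= t - dl by apply: le_trans sdt; apply: le_trans (ltW sdl).
have mono1 p r : s <= p -> p <= r -> r <= s + dl -> v p <= v r.
  by move=> sp pr rs; apply: vmono => //; [exact: le_trans sp|exact: le_trans rs sdT].
have mono2 p r : t - dl <= p -> p <= r -> r <= t -> v p <= v r.
  by move=> sp pr rs; apply: vmono => //; [exact: le_trans sp|exact: le_trans rs tT].
have [a1 [b1 [sa1 ab1 bs1 V1]]] := exists_low_variation sdl mono1 eps0.
have [a2 [b2 [ta2 ab2 bt2 V2]]] := exists_low_variation tdl mono2 eps0.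
have b1a2 : b1 <= a2.
  by apply: le_trans (ltW bs1) _; apply: le_trans sdt (ltW ta2).
have a10 : 0 <= a1 := le_trans s0 (ltW sa1).
have b2T : b2 <= T := le_trans (ltW bt2) tT.
have [u [us [uus uu le]]] :=
  bridge_curve ux kv Az lam0 lam1 hJ xp a10 ab1 b1a2 ab2 b2T.
exists u, us; split=> //; apply: le_lt_trans le _.
have b10 : 0 <= b1 := le_trans a10 (ltW ab1).
rewrite GE //; last exact: le_trans (ltW ab2) b2T.
have G1 : `|G b1 - G s| <= q / 8.
  apply: hG => //; [exact: le_trans (ltW sa1) (ltW ab1)| |].
    exact: le_trans (ltW bs1) sdT.
  by apply: lt_le_trans dlG; rewrite ltrBlDl.
have G2 : `|G t - G a2| <= q / 8.
  apply: hG => //; [exact: le_trans b1a2| |].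
    exact: le_trans (ltW ab2) (ltW bt2).
  by apply: lt_le_trans dlG; rewrite ltrBlDl -ltrBlDr.
move: G1 G2; rewrite !ler_norml => /andP[G1 _] /andP[G2 _].
apply: (total q _ _ _ (G t) (G s) _ _ ((C + 1) * dl) (M * eps)) => //.
- by rewrite -mulrDr ler_wpM2l // lerD.
- rewrite -mulrDr; apply: ler_pM; rewrite ?lerDl //.
    by rewrite addr_ge0 // subr_ge0 ltW.
  exact: len sa1 bs1 ta2 bt2.
- by rewrite mulrC.
Qed.

(** Maximality of the realization among continuous k of bounded variation. *)
Lemma not_realization_separated x k v : ucont T x -> ucont T k -> dominated T k v ->
  ~ realization_ineq ip T A x k -> separated_from_realization ip A T x k.
Proof.
move=> ux uk kv nr.
have [xD|nD] := pselect (forall r, 0 <= r <= T -> closure (Dom A) (x r)).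
  apply: contrapT => ne; apply: nr => z zs Az s t s0 st tT.
  by rewrite leNgt; apply/negP => /(separated_on_Dom ux uk kv xD Az s0 st tT).
have /existsNP[r /not_implyP[rT nr0]] := nD.
exact: (separated_off_Dom ip_norm A_maxmon T_gt0 ux kv rT nr0).
Qed.

End EscapeOnDomain.

(** * Uniform norm, modulus of continuity and the duality pairing *)

Section Norms.
Context {R : realType} {H : completeNormedModType R}.
Variables (T : R) (T_gt0 : 0 < T).
Implicit Types (x y k : R -> H).

Lemma CT_ucont x : CT T x <-> ucont T x.
Proof. exact: ucontP. Qed.

Lemma supnorm_ub y t : ucont T y -> 0 <= t <= T -> `|y t| <= supnorm T y.
Proof.
move=> uy tT; have [M M0 hM] := ucont_bounded uy.
apply: ub_le_sup; last by exists t => //=; rewrite in_itv.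
by exists M => _ [r /= rT <-]; apply: hM; rewrite in_itv in rT.
Qed.

Lemma supnorm_le y c : (forall t, 0 <= t <= T -> `|y t| <= c) -> supnorm T y <= c.
Proof.
move=> hy; apply: ge_sup.
  by exists `|y 0|; exists 0 => //=; rewrite in_itv /= lexx ltW.
by move=> _ [r /= rT <-]; apply: hy; rewrite in_itv in rT.
Qed.

Lemma supnorm_ge0 y : ucont T y -> 0 <= supnorm T y.
Proof.
by move=> uy; apply: le_trans (supnorm_ub uy (t := 0) _); rewrite // lexx ltW.
Qed.

Lemma modulusP x e c : ucont T x -> 0 <= e -> modulus T x e <= c <->
  forall t s, 0 <= t <= T -> 0 <= s <= T -> `|t - s| <= e -> `|x t - x s| <= c.
Proof.
move=> ux e0; have [M M0 hM] := ucont_bounded ux; split=> [xc t s tT sT ts|hx].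
  apply: le_trans xc; apply: ub_le_sup; last by exists t, s; rewrite !in_itv.
  exists (M + M) => _ [p [q [+ + _ ->]]]; rewrite !in_itv /= => pT qT.
  by apply: le_trans (ler_normB _ _) _; apply: lerD; exact: hM.
apply: ge_sup.
  exists `|x 0 - x 0|; exists 0, 0; rewrite subrr normr0 in_itv /= lexx ltW //.
by move=> _ [p [q [+ + pq ->]]]; rewrite !in_itv /= => pT qT; exact: hx.
Qed.

Lemma YY_dominated rho k : YY T rho k ->
  [/\ ucont T k, k 0 = 0 & exists2 v, dominated T k v & v T - v 0 <= rho].
Proof. by move=> [/CT_ucont uk k0 /(Var_dominated T_gt0)]. Qed.

Lemma dominated_YY rho k v : ucont T k -> k 0 = 0 -> dominated T k v ->
  v T - v 0 <= rho -> YY T rho k.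
Proof.
move=> /CT_ucont uk k0 /dominated_Var kv vr; split=> //.
by apply: le_trans kv _; rewrite lee_fin.
Qed.

End Norms.

Section Pairing.
Context {R : realType} {H : completeNormedModType R}.
Context (ip : {dot H for idfun}) (ip_norm : forall h : H, ip h h = `|h| ^+ 2).
Variables (T : R) (T_gt0 : 0 < T).
Implicit Types (x y k u us z g : R -> H) (v w : R -> R).
Let T_ge0 := ltW T_gt0.
Local Notation "<< z , g >>" := (pairing ip T z g).

Lemma pairing_norm z g v c : ucont T z -> dominated T g v ->
  (forall t, 0 <= t <= T -> `|z t| <= c) -> `|<<z, g>>| <= c * (v T - v 0).
Proof.
move=> uz gv zc;
exact: (RS_integral_norm ip_norm T_ge0 uz gv (lexx 0) T_ge0 (lexx T) zc).
Qed.

Lemma pairing_linl c z z1 z2 g v : ucont T z1 -> ucont T z2 -> dominated T g v ->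
  (forall r, z r = c *: z1 r + z2 r) -> <<z, g>> = c * <<z1, g>> + <<z2, g>>.
Proof.
move=> u1 u2 gv zE;
exact: (RS_integral_linl ip_norm T_ge0 u1 u2 gv zE (lexx 0) T_ge0 (lexx T)).
Qed.

Lemma pairing_linr c z g g1 g2 v1 v2 : ucont T z -> dominated T g1 v1 -> dominated T g2 v2 ->
  (forall r, g r = c *: g1 r + g2 r) -> <<z, g>> = c * <<z, g1>> + <<z, g2>>.
Proof.
move=> uz gv1 gv2 gE;
exact: (RS_integral_linr ip_norm T_ge0 uz gv1 gv2 gE (lexx 0) T_ge0 (lexx T)).
Qed.

Lemma pairingBl z1 z2 g v : ucont T z1 -> ucont T z2 -> dominated T g v ->
  <<fun r => z1 r - z2 r, g>> = <<z1, g>> - <<z2, g>>.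
Proof.
move=> u1 u2 gv; rewrite (pairing_linl (c := -1) u2 u1 gv).
  by rewrite mulN1r addrC.
by move=> r; rewrite scaleN1r addrC.
Qed.

Lemma pairingBr z g1 g2 v1 v2 : ucont T z -> dominated T g1 v1 -> dominated T g2 v2 ->
  <<z, fun r => g1 r - g2 r>> = <<z, g1>> - <<z, g2>>.
Proof.
move=> uz gv1 gv2; rewrite (pairing_linr (c := -1) uz gv2 gv1).
  by rewrite mulN1r addrC.
by move=> r; rewrite scaleN1r addrC.
Qed.

Lemma pairing_cst h g v : dominated T g v -> g 0 = 0 -> <<fun=> h, g>> = ip h (g T).
Proof.
move=> gv g0; have h0 r : 0 <= r <= T -> `|h - h| <= 0 by rewrite subrr normr0.
have := RS_integral_approx ip_norm T_ge0 (ucont_cst T h) gv (lexx 0) T_ge0 (lexx T) h0.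
by rewrite mul0r g0 subr0 normr_le0 subr_eq0 => /eqP.
Qed.

Lemma eq_pairing z z' g v : ucont T z -> dominated T g v ->
  (forall t, 0 <= t <= T -> z' t = z t) -> <<z', g>> = <<z, g>>.
Proof.
by move=> uz gv zz;
apply: (eq_RS_integral ip_norm T_ge0 uz gv (lexx 0) T_ge0 (lexx T) zz).
Qed.

(** The chain rule for |k|^2 / 2: its increment is exactly the scalar product of
    the mean of the end values of k with the increment of k. *)
Lemma pairing_self k v : ucont T k -> dominated T k v -> k 0 = 0 ->
  <<k, k>> = `|k T| ^+ 2 / 2.
Proof.
move=> uk kv k0; have [G [pG GE]] := RS_integral_primitive ip_norm T_ge0 uk kv.
rewrite /pairing GE //; have vT := dominated_ge0 kv (lexx 0) T_ge0 (lexx T).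
pose D r := G r - `|k r| ^+ 2 / 2.
suff key e : 0 < e -> `|D T - D 0| <= e * (v T - v 0).
  suff : D T = D 0 by rewrite /D k0 normr0 expr0n mul0r subr0; lra.
  apply/eqP; rewrite -subr_eq0 -normr_eq0 eq_le normr_ge0 andbT leNgt.
  apply/negP => D0; have V1 : 0 < v T - v 0 + 1 by lra.
  have e0 : 0 < `|D T - D 0| / (v T - v 0 + 1) by rewrite divr_gt0.
  have := key _ e0; set e := _ / _ in e0 *.
  have : e * (v T - v 0 + 1) = `|D T - D 0| by rewrite divfK // gt_eqF.
  by rewrite mulrDr; lra.
move=> e0; have [d d0 hd] := uk _ e0.
apply: (@chain_interval _ T (fun s t => `|D t - D s| <= e * (v t - v s)) _ d0 _ _ 0 T) => //.
  move=> r s t r0 rs st tT h1 h2.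
  by have := ler_distD (D s) (D t) (D r); lra.
move=> s t s0 st tT ts.
have sI : 0 <= s <= T by apply/andP; split; lra.
have tI : 0 <= t <= T by apply/andP; split; lra.
have := pG s t (2^-1 *: (k s + k t)) e s0 st tT.
(* The mean of the end values makes the difference quotient of |k|^2 / 2 exact. *)
have -> : G t - G s - ip (2^-1 *: (k s + k t)) (k t - k s) = D t - D s.
  by rewrite /D -!ip_norm !ipE (ipC ip (k t) (k s)); field.
apply=> r /andP[sr rt]; have rI : 0 <= r <= T by apply/andP; split; lra.
have -> : 2^-1 *: (k s + k t) - k r = 2^-1 *: (k s - k r) + 2^-1 *: (k t - k r).
  rewrite -scalerDr addrACA -opprD scalerBr; congr (_ - _).
  by rewrite -mulr2n -(scaler_nat 2 (k r)) scalerA mulVf ?scale1r // pnatr_eq0.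
have h1 : `|k s - k r| <= e by apply: hd => //; rewrite ltr_norml; apply/andP; split; lra.
have h2 : `|k t - k r| <= e by apply: hd => //; rewrite ltr_norml; apply/andP; split; lra.
apply: le_trans (ler_normD _ _) _; rewrite !normrZ ger0_norm ?invr_ge0 //; lra.
Qed.

(** On a ball of BV0 the pairing is continuous in k for the uniform norm: cut
    [0,T] into pieces on which u is almost constant; their number does not depend
    on k, and on each piece the pairing is close to a finite difference. *)
Lemma pairing_weak_cont u rho e : ucont T u -> 0 <= rho -> 0 < e ->
  exists2 d, 0 < d & forall k k', YY T rho k -> YY T rho k' ->
    (forall t, 0 <= t <= T -> `|k t - k' t| <= d) -> `|<<u, k>> - <<u, k'>>| <= e.
Proof.
move=> uu rho0 e0; have [U U0 hU] := ucont_bounded uu.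
pose eta := e / (4 * (rho + 1)).
have eta0 : 0 < eta by rewrite divr_gt0 //; lra.
have etaE : eta * (2 * (rho + 1)) = e / 2 by rewrite /eta; field; lra.
have [dl dl0 hdl] := uu _ eta0.
pose N := (Num.truncn (T / (dl / 2))).+1.
have dl20 : 0 < dl / 2 by rewrite divr_gt0.
have TN : T <= N%:R * (dl / 2) by rewrite -ler_pdivrMr // ltW // truncnS_gt.
have N0 : 0 < N%:R :> R by rewrite ltr0n.
have NU : 0 <= 4 * N%:R * U by rewrite !mulr_ge0 // ltW.
have NU1 : 0 < 4 * N%:R * U + 1 by lra.
exists (e / (4 * N%:R * U + 1)); first by rewrite divr_gt0.
set d := e / _; move=> k k' /(YY_dominated T_gt0)[_ _ [v kv vr]].
move=> /(YY_dominated T_gt0)[_ _ [v' kv' vr']] kk.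
rewrite -(pairingBr uu kv kv').
have dom := dominatedB kv kv'.
have [G [pG GE]] := RS_integral_primitive ip_norm T_ge0 uu dom.
rewrite /pairing GE //.
have d0 : 0 <= d by rewrite divr_ge0 // ltW.
pose V r := v r + v' r.
suff ind n s t : 0 <= s -> s <= t -> t <= T -> t - s <= n%:R * (dl / 2) ->
    `|G t - G s| <= eta * (V t - V s) + n%:R * (U * (2 * d)).
  have := ind N 0 T (lexx 0) T_ge0 (lexx T); rewrite subr0 => /(_ TN) h.
  apply: le_trans h _.
  have : eta * (V T - V 0) <= eta * (2 * (rho + 1)) by rewrite ler_pM2l // /V; lra.
  have : N%:R * (U * (2 * d)) <= e / 2.
    have -> : N%:R * (U * (2 * d)) = 4 * N%:R * U * d / 2 by field.
    rewrite ler_pM2r ?invr_gt0 //; apply: (@le_trans _ _ ((4 * N%:R * U + 1) * d)).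
      by rewrite ler_wpM2r //; lra.
    by rewrite /d mulrC divfK // gt_eqF.
  by lra.
have d20 : 0 <= U * (2 * d) by apply: mulr_ge0 => //; apply: mulr_ge0.
elim: n s t => [|n IH] s t s0 st tT.
  rewrite !mul0r => ts; have -> : t = s by lra.
  by rewrite !subrr normr0 mulr0 addr0.
have nS : n.+1%:R * (dl / 2) = n%:R * (dl / 2) + dl / 2 by rewrite -natr1 mulrDl mul1r.
rewrite nS => ts.
pose r := Num.max s (t - dl / 2).
have sr : s <= r by rewrite le_max lexx.
have rt : r <= t by rewrite ge_max st /=; lra.
have tr0 : t - dl / 2 <= r by rewrite le_max lexx orbT.
have tr : t - r < dl by lra.
have rs : r - s <= n%:R * (dl / 2).
  rewrite lerBlDr ge_max; apply/andP; split; last lra.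
  by rewrite -lerBlDr subrr mulr_ge0 // ltW.
have h1 := IH s r s0 sr (le_trans rt tT) rs.
have rI : 0 <= r <= T by apply/andP; split; lra.
have tI : 0 <= t <= T by apply/andP; split; lra.
have h2 : `|G t - G r - ip (u r) (k t - k' t - (k r - k' r))| <= eta * (V t - V r).
  apply: pG => //; first lra.
  move=> q /andP[rq qt]; apply: hdl => //; first by apply/andP; split; lra.
  by rewrite ltr_norml; apply/andP; split; lra.
have h3 : `|ip (u r) (k t - k' t - (k r - k' r))| <= U * (2 * d).
  apply: le_trans (Cauchy_Schwarz ip_norm _ _) _; apply: ler_pM => //; first exact: hU.
  by apply: le_trans (ler_normB _ _) _; have := kk _ tI; have := kk _ rI; lra.
have := ler_distD (G r) (G t) (G s).
have := ler_normD (G t - G r - ip (u r) (k t - k' t - (k r - k' r)))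
  (ip (u r) (k t - k' t - (k r - k' r))).
rewrite subrK -natr1 mulrDl mul1r; lra.
Qed.

End Pairing.

(** * The Fitzpatrick function on Y_R *)

Section Fitzpatrick.
Context {R : realType} {H : completeNormedModType R}.
Context (ip : {dot H for idfun}) (ip_norm : forall h : H, ip h h = `|h| ^+ 2).
Variables (A : set (H * H)) (A_maxmon : maximal_monotone ip A).
Variables (T : R) (T_gt0 : 0 < T).
Implicit Types (x y k u us z g : R -> H) (v w : R -> R).
Let T_ge0 := ltW T_gt0.
Local Notation "<< z , g >>" := (pairing ip T z g).
Local Notation fitz := (fitzpatrick ip T A).

Lemma pairing_expand x u k us v w : ucont T x -> ucont T u ->
  dominated T k v -> dominated T us w ->
  RS_integral ip (fun r => x r - u r) (fun r => k r - us r) 0 T =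
  <<x, k>> - (<<u, k>> + <<x, us>> - <<u, us>>).
Proof.
move=> ux uu kv usw; have uxu := ucontB ux uu.
rewrite -/(pairing ip T _ _) (pairingBr ip_norm T_gt0 uxu kv usw).
rewrite (pairingBl ip_norm T_gt0 ux uu kv) (pairingBl ip_norm T_gt0 ux uu usw).
by ring.
Qed.

Lemma realizationP u us : realization ip T A (u, us) ->
  [/\ ucont T u, exists w, dominated T us w & realization_ineq ip T A u us].
Proof. by move=> [/= /CT_ucont uu /(BV0_dominated T_gt0)]. Qed.

Lemma realizationE rho x k : ucont T x -> YY T rho k ->
  realization ip T A (x, k) <-> realization_ineq ip T A x k.
Proof.
move=> ux Yk; split=> [[]//|xk]; have [uk k0 [v kv _]] := YY_dominated T_gt0 Yk.
by split=> //=; [exact/CT_ucont|exact: ucont_BV0 uk kv k0].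
Qed.

(** The supremum is already large enough at (x, k) itself if this lies in the
    realization, and otherwise at an element that separates it. *)
Lemma fitzpatrick_ge rho x k : ucont T x -> YY T rho k -> (<<x, k>>%:E <= fitz x k)%E.
Proof.
move=> ux Yk; have [uk k0 [v kv _]] := YY_dominated T_gt0 Yk.
have [xk|nxk] := pselect (realization_ineq ip T A x k).
  apply: ereal_sup_ubound; exists (x, k); first exact/(realizationE ux Yk).
  by rewrite /= addrK.
have [u [us [uus uu lt0]]] := not_realization_separated ip_norm A_maxmon T_gt0 ux uk kv nxk.
have [_ [w usw] _] := realizationP uus.
apply: le_trans (_ : (<<u, k>> + <<x, us>> - <<u, us>>)%:E <= _)%E; last first.
  by apply: ereal_sup_ubound; exists (u, us).
by move: lt0; rewrite (pairing_expand ux uu kv usw) lee_fin; lra.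
Qed.

(** Equality says that (x, k) is monotonically related to the realization:
    sufficient by its monotonicity, necessary by its maximality. *)
Lemma fitzpatrick_eq rho x k : ucont T x -> YY T rho k ->
  fitz x k = <<x, k>>%:E <-> realization ip T A (x, k).
Proof.
move=> ux Yk; have [uk k0 [v kv _]] := YY_dominated T_gt0 Yk.
split=> [FE|xk].
  apply/(realizationE ux Yk); apply: contrapT => nxk.
  have [u [us [uus uu]]] := not_realization_separated ip_norm A_maxmon T_gt0 ux uk kv nxk.
  have [_ [w usw] _] := realizationP uus.
  have : ((<<u, k>> + <<x, us>> - <<u, us>>)%:E <= fitz x k)%E.
    by apply: ereal_sup_ubound; exists (u, us).
  by rewrite FE (pairing_expand ux uu kv usw) lee_fin; lra.
apply/eqP; rewrite eq_le (fitzpatrick_ge ux Yk) andbT.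
apply: ge_ereal_sup => _ [[u us] /= uus <-]; rewrite lee_fin.
have [uu [w usw] ui] := realizationP uus.
have := realization_monotone ip_norm A_maxmon T_gt0 ux kv
  ((realizationE ux Yk).1 xk) uu usw ui.
by rewrite (pairing_expand ux uu kv usw); lra.
Qed.

End Fitzpatrick.

(** * Sign and zeros of the functional *)

Section Functional.
Context {R : realType} {H : completeNormedModType R}.
Context (ip : {dot H for idfun}) (ip_norm : forall h : H, ip h h = `|h| ^+ 2).
Variables (A : set (H * H)) (A_maxmon : maximal_monotone ip A).
Variables (T : R) (T_gt0 : 0 < T) (x0 : H) (m : R -> H) (um : ucont T m).
Variables (rho : R) (rho_gt0 : 0 < rho) (alpha : R -> R).
Hypothesis alpha_ge0 : forall e, 0 <= e -> 0 <= alpha e.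
Implicit Types (a : H) (x y k u us z g mu nu : R -> H) (v w : R -> R).
Let T_ge0 := ltW T_gt0.
Local Notation "<< z , g >>" := (pairing ip T z g).
Local Notation fitz := (fitzpatrick ip T A).
Local Notation J := (Jhat ip T A x0 m rho alpha).
Local Notation penalty mu k :=
  (ereal_sup [set (pairing ip T (mu - nu) k - rho * supnorm T (nu - m))%:E
    | nu in Calpha T alpha]).

Lemma Calpha_ucont nu : Calpha T alpha nu -> ucont T nu.
Proof. by move=> [[/CT_ucont]]. Qed.

Lemma Calpha0 : Calpha T alpha (fun=> 0 : H).
Proof.
split; first by split=> //; apply/CT_ucont; exact: ucont_cst.
move=> e e0; apply/(modulusP T_gt0 _ (ucont_cst T (0 : H)) e0) => t s _ _ _.
by rewrite subrr normr0 alpha_ge0.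
Qed.

Lemma penalty_gtNy mu k : (-oo < penalty mu k)%E.
Proof.
apply: (@lt_le_trans _ _ (pairing ip T (mu - (fun=> 0 : H)) k -
  rho * supnorm T ((fun=> 0 : H) - m))%:E); first by rewrite ltNyr.
by apply: ereal_sup_ubound; exists (fun=> 0 : H); first exact: Calpha0.
Qed.

Lemma penalty_ge mu k : YY T rho k -> Calpha T alpha mu ->
  ((- (rho * supnorm T (mu - m)))%:E <= penalty mu k)%E.
Proof.
move=> /(YY_dominated T_gt0)[uk k0 [v kv _]] Cmu; apply: ereal_sup_ubound.
exists mu => //; have -> : <<mu - mu, k>> = 0.
  have := pairingBl ip_norm T_gt0 (Calpha_ucont Cmu) (Calpha_ucont Cmu) kv.
  by rewrite subrr.
by rewrite sub0r.
Qed.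

(** <<m - nu, k>> is at most Var(k) |nu - m|, which the penalty absorbs. *)
Lemma penalty_eq0 mu k : YY T rho k -> Calpha T alpha mu ->
  (forall t, 0 <= t <= T -> mu t = m t) -> penalty mu k = 0%E.
Proof.
move=> Yk Cmu mum; have [uk k0 [v kv vr]] := YY_dominated T_gt0 Yk.
apply/eqP; rewrite eq_le; apply/andP; split; last first.
  apply: le_trans (penalty_ge Yk Cmu); rewrite lee_fin oppr_ge0.
  rewrite pmulr_rle0 //; apply: supnorm_le => // t tT.
  by rewrite -[X in `|X|]/(mu t - m t) mum // subrr normr0.
apply: ge_ereal_sup => _ [nu Cnu <-]; rewrite lee_fin subr_le0.
have unu := Calpha_ucont Cnu; have unm := ucontB unu um.
apply: le_trans (ler_norm _) _.
apply: (@le_trans _ _ (supnorm T (nu - m) * (v T - v 0))); last first.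
  by rewrite mulrC ler_wpM2r // supnorm_ge0.
apply: (pairing_norm ip_norm T_gt0 (ucontB (Calpha_ucont Cmu) unu) kv) => t tT.
rewrite mum // distrC; exact: (supnorm_ub unm tT).
Qed.

Lemma Jhat_gtNy a x k mu : ucont T x -> YY T rho k -> (-oo < J a x k mu)%E.
Proof.
move=> ux Yk; rewrite /Jhat; have := fitzpatrick_ge ip_norm A_maxmon T_gt0 ux Yk.
have := penalty_gtNy mu k; case: (penalty mu k) => [s| |] //; case: (fitz x k) => [f| |] //= _ _.
exact: ltNyr.
Qed.

(** By penalty_ge the functional is bounded below by the sum of three
    nonnegative terms |a - x0|^2, F(x, k) - <<x, k>> and rho |mu - m|. *)
Lemma Jhat_dichotomy a x k mu : ucont T x -> YY T rho k -> Calpha T alpha mu ->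
  (0 <= J a x k mu)%E /\ (J a x k mu = 0%E <->
   [/\ a = x0, (forall t, 0 <= t <= T -> mu t = m t) & fitz x k = <<x, k>>%:E]).
Proof.
move=> ux Yk Cmu; have umu := Calpha_ucont Cmu.
have umm : ucont T (mu - m) := ucontB umu um.
have N0 := supnorm_ge0 T_gt0 umm.
have F1 := fitzpatrick_ge ip_norm A_maxmon T_gt0 ux Yk.
have S1 := penalty_ge Yk Cmu.
have S0 := penalty_eq0 Yk Cmu.
have suff0 : [/\ a = x0, (forall t, 0 <= t <= T -> mu t = m t) & fitz x k = <<x, k>>%:E] ->
    J a x k mu = 0%E.
  move=> [-> mum FE]; rewrite /Jhat S0 // FE.
  have -> : supnorm T (mu - m) = 0.
    apply/eqP; rewrite eq_le N0 andbT; apply: supnorm_le => // t tT.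
    by rewrite -[X in `|X|]/(mu t - m t) mum // subrr normr0.
  by rewrite subrr normr0 expr0n /= mulr0 add0e -EFinB subrr !adde0.
have aN := sqr_ge0 `|a - x0|.
have rN : 0 <= rho * supnorm T (mu - m) by rewrite mulr_ge0 // ltW.
split.
  move: F1 S1; rewrite /Jhat.
  case: (fitz x k) => [f| |] //; last by rewrite addey // addye ?leey // -ltNye penalty_gtNy.
  case: (penalty mu k) => [s| |] //; last by rewrite addey ?leey.
  by rewrite !lee_fin => h1 h2; rewrite -[2 * rho * _]mulrA; lra.
split=> // JE.
suff [h1 h2 h3] : [/\ `|a - x0| ^+ 2 = 0, rho * supnorm T (mu - m) = 0 & fitz x k = <<x, k>>%:E].
  split=> //.
    by move/eqP: h1; rewrite sqrf_eq0 normr_eq0 subr_eq0 => /eqP.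
  move=> t tT; apply/eqP; rewrite -subr_eq0 -normr_eq0 eq_le normr_ge0 andbT.
  move/eqP: h2; rewrite mulf_eq0 gt_eqF //= => /eqP <-.
  exact: (supnorm_ub umm tT).
move: F1 S1 JE; rewrite /Jhat.
case: (fitz x k) => [f| |] //; last by rewrite addey // addye // -ltNye penalty_gtNy.
case: (penalty mu k) => [s| |] //.
rewrite !lee_fin => h1 h2 []; rewrite -[2 * rho * _]mulrA => h3.
by split; [lra|lra|congr EFin; lra].
Qed.

Lemma realization_GSP x k mu : ucont T x -> YY T rho k ->
  (forall t, 0 <= t <= T -> x t + k t = x0 + mu t) ->
  (forall t, 0 <= t <= T -> mu t = m t) ->
  realization ip T A (x, k) <-> is_GSP ip T A x0 m x k.
Proof.
move=> ux Yk xk mum; have [uk k0 [v kv _]] := YY_dominated T_gt0 Yk.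
rewrite (realizationE ip A T_gt0 ux Yk); split=> [ri|[]//]; split=> //.
- split; first exact/CT_ucont.
  by move=> t; rewrite in_itv; exact: (realization_Dom ip_norm A_maxmon T_gt0 ux kv ri).
- by split; [exact/CT_ucont|exact: ucont_BV0 uk kv k0].
- by move=> t; rewrite in_itv => tT; rewrite xk // mum.
Qed.

End Functional.

(** * The constraint set *)

Section StateSpace.
Context {R : realType} {H : completeNormedModType R}.
Variables (T : R) (T_gt0 : 0 < T) (rho : R) (rho_gt0 : 0 < rho) (alpha : R -> R).
Implicit Types (a : H) (x k mu : R -> H).
Local Notation K := (KK (H := H) T rho alpha).

Definition unif_close (d : R) (p q : H * (R -> H) * (R -> H) * (R -> H)) : Prop :=
  [/\ `|p.1.1.1 - q.1.1.1| < d,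
      forall t, 0 <= t <= T -> `|p.1.1.2 t - q.1.1.2 t| < d,
      forall t, 0 <= t <= T -> `|p.1.2 t - q.1.2 t| < d
    & forall t, 0 <= t <= T -> `|p.2 t - q.2 t| < d].

Lemma nbhs_uniform (f : R -> H) d : 0 < d ->
  nbhs (f : {uniform` `[(0 : R), T]%classic -> H})
    [set h | forall t, 0 <= t <= T -> `|f t - h t| < d].
Proof.
move=> d0; apply/uniform_nbhs; exists [set xy | ball xy.1 d xy.2]; split.
  exact: entourage_ball (PosNum d0).
move=> h /= hh t tT; have := hh t; rewrite in_itv /= => /(_ tT).
by rewrite -ball_normE.
Qed.

(** Closedness and lower semicontinuity only use these neighbourhoods. *)
Lemma nbhs_unif_close (p : state_space R H T) d : 0 < d -> nbhs p [set q | unif_close d p q].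
Proof.
move=> d0; case: p => [[[a x] k] mu].
exists ([set q | [/\ `|a - q.1.1| < d,
      forall t, 0 <= t <= T -> `|x t - q.1.2 t| < d &
      forall t, 0 <= t <= T -> `|k t - q.2 t| < d]],
   [set h | forall t, 0 <= t <= T -> `|mu t - h t| < d]) => /=; last first.
  by move=> [[[a' x'] k'] mu'] /= [[? ? ?] ?]; split.
split; last exact: nbhs_uniform.
exists ([set q | `|a - q.1| < d /\ forall t, 0 <= t <= T -> `|x t - q.2 t| < d],
   [set h | forall t, 0 <= t <= T -> `|k t - h t| < d]) => /=; last first.
  by move=> [[a' x'] k'] /= [[? ?] ?]; split.
split; last exact: nbhs_uniform.
exists ([set b | `|a - b| < d],
   [set h | forall t, 0 <= t <= T -> `|x t - h t| < d]) => /=; last first.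
  by move=> [a' x'] /= [? ?]; split.
split; last exact: nbhs_uniform.
by have := nbhsx_ballx a d d0; rewrite -ball_normE.
Qed.

Lemma ucont_closed x : (forall d, 0 < d -> exists2 y, ucont T y &
  forall t, 0 <= t <= T -> `|x t - y t| < d) -> ucont T x.
Proof.
move=> hx e e0; have e3 : 0 < e / 3 by rewrite divr_gt0.
have [y uy xy] := hx _ e3; have [d d0 hd] := uy _ e3.
exists d => // s t sT tT st.
have := hd _ _ sT tT st; have := xy _ sT; have := xy _ tT.
have := ler_distD (y s) (x s) (x t); have := ler_distD (y t) (y s) (x t).
by rewrite (distrC (y t)); lra.
Qed.

Lemma vsum_unif_close k k' (d : R) (s : seq R) (a : R) : 0 <= a -> path <%O a s -> last a s = T ->
  (forall t, 0 <= t <= T -> `|k t - k' t| < d) ->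
  vsum k a s <= vsum k' a s + (size s)%:R * (2 * d).
Proof.
move=> + + + kk; elim: s a => [|b s IH] a a0 /=; first by rewrite mul0r addr0.
move=> /andP[ab ps] ls; have b0 := le_trans a0 (ltW ab).
have bT : b <= T by rewrite -ls path_le_last.
have h := IH b b0 ps ls.
have ha : `|k a - k' a| < d by apply: kk; rewrite a0 (le_trans (ltW ab)).
have hb : `|k b - k' b| < d by apply: kk; rewrite b0.
have : `|k b - k a| <= `|k' b - k' a| + 2 * d.
  have := ler_distD (k' b) (k b) (k a); have := ler_distD (k' a) (k' b) (k a).
  by rewrite (distrC (k' a)); lra.
by rewrite -natr1 mulrDl mul1r; lra.
Qed.

Lemma YY_closed k : (forall d, 0 < d -> exists2 k', YY T rho k' &
  forall t, 0 <= t <= T -> `|k t - k' t| < d) -> YY T rho k.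
Proof.
move=> hk; split.
- apply/CT_ucont/ucont_closed => d /hk[k' [/CT_ucont uk _ _] kk]; by exists k'.
- apply/eqP; rewrite -normr_eq0 eq_le normr_ge0 andbT leNgt; apply/negP => k0.
  have [k' [_ k'0 _] /(_ 0)] := hk _ k0.
  by rewrite lexx ltW // k'0 subr0 ltxx => /(_ isT).
apply: ge_ereal_sup => _ [s ps <-]; rewrite lee_fin vvariation_vsum.
have [ps1 /eqP ls] := ps.
rewrite leNgt; apply/negP => lt.
pose n := (size s)%:R : R; have n0 : 0 <= n by rewrite ler0n.
have d0 : 0 < (vsum k 0 s - rho) / (4 * (n + 1)) by rewrite divr_gt0 //; lra.
have [k' [_ _ Vk'] kk] := hk _ d0.
have := vsum_unif_close (lexx 0) ps1 ls kk.
have : vsum k' 0 s <= rho.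
  rewrite -lee_fin; apply: le_trans Vk'; apply: ereal_sup_ubound.
  by exists s => //; rewrite vvariation_vsum.
rewrite -/n; set d := _ / _ in d0 *.
have : vsum k 0 s - rho = 4 * (n * d) + 4 * d by rewrite /d; field; lra.
have : 0 <= n * d by rewrite mulr_ge0 // ltW.
by rewrite (mulrCA n 2 d); lra.
Qed.

Lemma Calpha_closed mu : (forall d, 0 < d -> exists2 mu', Calpha T alpha mu' &
  forall t, 0 <= t <= T -> `|mu t - mu' t| < d) -> Calpha T alpha mu.
Proof.
move=> hm; have um : ucont T mu.
  by apply: ucont_closed => d /hm[mu' [[/CT_ucont ? _] _] ?]; exists mu'.
split; first split; first exact/CT_ucont.
  apply/eqP; rewrite -normr_eq0 eq_le normr_ge0 andbT leNgt; apply/negP => k0.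
  have [k' [[_ k'0] _] /(_ 0)] := hm _ k0.
  by rewrite lexx ltW // k'0 subr0 ltxx => /(_ isT).
move=> e e0; apply/(modulusP T_gt0 _ um e0) => t s tT sT ts.
rewrite leNgt; apply/negP => lt.
have d0 : 0 < (`|mu t - mu s| - alpha e) / 2 by rewrite divr_gt0 //; lra.
have [mu' Cm mm] := hm _ d0; have um' := Calpha_ucont Cm.
have := (modulusP T_gt0 _ um' e0).1 (Cm.2 _ e0) _ _ tT sT ts.
have := mm _ tT; have := mm _ sT.
have := ler_distD (mu' t) (mu t) (mu s); have := ler_distD (mu' s) (mu' t) (mu s).
by rewrite (distrC (mu' s)); lra.
Qed.

Lemma KK_closed : closed (K : set (state_space R H T)).
Proof.
move=> [[[a x] k] mu] cl.
have near d : 0 < d -> exists q, K q /\ unif_close d (a, x, k, mu) q.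
  by move=> d0; have [q [Kq cq]] := cl _ (nbhs_unif_close (a, x, k, mu) d0); exists q.
split.
- apply/CT_ucont/ucont_closed => d /near[[[[a' x'] k'] mu'] [[/CT_ucont ? _ _ _] [_ ? _ _]]].
  by exists x'.
- by apply: YY_closed => d /near[[[[a' x'] k'] mu'] [[_ ? _ _] [_ _ ? _]]]; exists k'.
- by apply: Calpha_closed => d /near[[[[a' x'] k'] mu'] [[_ _ ? _] [_ _ _ ?]]]; exists mu'.
move=> t tI; have tT : 0 <= t <= T by rewrite in_itv in tI.
apply/eqP; rewrite -subr_eq0 -normr_eq0 eq_le normr_ge0 andbT leNgt; apply/negP => e0.
set e := `|_| in e0.
have e4 : 0 < e / 4 by rewrite divr_gt0.
have [[[[a' x'] k'] mu'] [[_ _ _ E]]] := near _ e4.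
move=> [/= ha /(_ t tT) hx /(_ t tT) hk /(_ t tT) hm].
have : e <= `|x t - x' t| + `|k t - k' t| + `|a - a'| + `|mu t - mu' t|.
  rewrite /e; have -> : x t + k t - (a + mu t) =
     (x t - x' t) + (k t - k' t) - (a - a') - (mu t - mu' t).
    have /eqP := E t tI; rewrite -subr_eq0 => /eqP E0.
    rewrite -[LHS]subr0 -E0 !opprD !opprK !addrA.
    by rewrite [RHS](ACl (1*3*5*7*2*4*6*8)).
  apply: le_trans (ler_normB _ _) _; rewrite lerD2r.
  apply: le_trans (ler_normB _ _) _; rewrite lerD2r.
  exact: ler_normD.
lra.
Qed.

Lemma dominated_conv k k' v v' t : 0 <= t -> t <= 1 ->
  dominated T k v -> dominated T k' v' ->
  dominated T (t *: k + (1 - t) *: k') (fun r => t * v r + (1 - t) * v' r).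
Proof.
move=> t0 t1 kv kv'; have t1' : 0 <= 1 - t by lra.
have kv0 : dominated T (fun r => 0 : H) (fun=> 0).
  by move=> *; rewrite !subrr normr0.
have := dominated_lin t kv (dominated_lin (1 - t) kv' kv0).
rewrite !ger0_norm // => h p q p0 pq qT; have := h p q p0 pq qT.
by rewrite !addr0.
Qed.

Lemma ucont_conv x x' t : ucont T x -> ucont T x' -> ucont T (t *: x + (1 - t) *: x').
Proof.
move=> ux ux'; have := ucont_lin t ux (ucont_lin (1 - t) ux' (ucont_cst T 0)).
by congr ucont; apply/funext => r; rewrite addr0.
Qed.

Lemma norm_conv (t : R) (h h' : H) c c' : 0 <= t -> t <= 1 -> `|h| <= c -> `|h'| <= c' ->
  `|t *: h + (1 - t) *: h'| <= t * c + (1 - t) * c'.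
Proof.
move=> t0 t1 hc hc'; apply: le_trans (ler_normD _ _) _.
rewrite !normrZ !ger0_norm //; last lra.
by apply: lerD; apply: ler_wpM2l => //; lra.
Qed.

Lemma conv_sub (t : R) (h h' g g' : H) :
  t *: h + (1 - t) *: h' - (t *: g + (1 - t) *: g') = t *: (h - g) + (1 - t) *: (h' - g').
Proof. by rewrite !scalerBr opprD addrACA. Qed.

Lemma KK_conv p q t : K p -> K q -> 0 <= t -> t <= 1 -> K (t *: p + (1 - t) *: q).
Proof.
case: p => [[[a x] k] mu]; case: q => [[[a' x'] k'] mu'].
move=> [/CT_ucont ux Yk Cm E] [/CT_ucont ux' Yk' Cm' E'] t0 t1.
have [uk k0 [v kv vr]] := YY_dominated T_gt0 Yk.
have [uk' k'0 [v' kv' vr']] := YY_dominated T_gt0 Yk'.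
have um := Calpha_ucont Cm; have um' := Calpha_ucont Cm'.
have t1' : 0 <= 1 - t by lra.
split.
- exact/CT_ucont/ucont_conv.
- apply: (dominated_YY _ _ (dominated_conv t0 t1 kv kv')).
  + exact: ucont_conv.
  + by rewrite -[LHS]/(t *: k 0 + (1 - t) *: k' 0) k0 k'0 !scaler0 addr0.
  + have : t * (v T - v 0) <= t * rho by rewrite ler_wpM2l.
    have : (1 - t) * (v' T - v' 0) <= (1 - t) * rho by rewrite ler_wpM2l.
    by lra.
- split; first split; first exact/CT_ucont/ucont_conv.
    rewrite -[LHS]/(t *: mu 0 + (1 - t) *: mu' 0).
    by rewrite Cm.1.2 Cm'.1.2 !scaler0 addr0.
  move=> e e0; apply/(modulusP T_gt0 _ (ucont_conv t um um') e0) => r s rT sT rs.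
  have h1 := (modulusP T_gt0 _ um e0).1 (Cm.2 _ e0) _ _ rT sT rs.
  have h2 := (modulusP T_gt0 _ um' e0).1 (Cm'.2 _ e0) _ _ rT sT rs.
  have -> : (t *: mu + (1 - t) *: mu') r - (t *: mu + (1 - t) *: mu') s =
      t *: (mu r - mu s) + (1 - t) *: (mu' r - mu' s) by exact: conv_sub.
  have -> : alpha e = t * alpha e + (1 - t) * alpha e by ring.
  exact: norm_conv.
move=> r rT.
rewrite -[LHS]/(t *: x r + (1 - t) *: x' r + (t *: k r + (1 - t) *: k' r)).
rewrite -[RHS]/(t *: a + (1 - t) *: a' + (t *: mu r + (1 - t) *: mu' r)).
by rewrite addrACA [RHS]addrACA -!scalerDr E // E'.
Qed.

Lemma KK_convex : convex_set K.
Proof.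
move=> p q t; rewrite !inE => Kp Kq.
apply: (KK_conv (t := t%:num) Kp Kq).
  exact: ge0.
exact: le1.
Qed.

End StateSpace.

(** * Convexity and lower semicontinuity on the constraint set *)

Section Envelope.
Context {R : realType} {H : completeNormedModType R}.
Context (ip : {dot H for idfun}) (ip_norm : forall h : H, ip h h = `|h| ^+ 2).
Variables (A : set (H * H)) (A_maxmon : maximal_monotone ip A).
Variables (T : R) (T_gt0 : 0 < T) (x0 : H) (m : R -> H) (um : ucont T m).
Variables (rho : R) (rho_gt0 : 0 < rho) (alpha : R -> R).
Hypothesis alpha_ge0 : forall e, 0 <= e -> 0 <= alpha e.
Implicit Types (a : H) (x y k u us z g mu nu : R -> H) (v w : R -> R).
Let T_ge0 := ltW T_gt0.
Local Notation "<< z , g >>" := (pairing ip T z g).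
Local Notation fitz := (fitzpatrick ip T A).
Local Notation J := (Jhat ip T A x0 m rho alpha).
Local Notation J4 := (Jhat4 ip T A x0 m rho alpha).
Local Notation K := (KK (H := H) T rho alpha).

(** The functional is the supremum of these real-valued functions over (u, us)
    in the realization and nu in C_alpha: minorant_le and minorant_gt. *)
Definition minorant u us nu a x k mu : R :=
  `|a - x0| ^+ 2 + (<<u, k>> + <<x, us>> - <<u, us>>) - <<x, k>>
  + 2 * rho * supnorm T (mu - m) + (<<mu - nu, k>> - rho * supnorm T (nu - m)).

Lemma minorant_le u us nu a x k mu : realization ip T A (u, us) ->
  Calpha T alpha nu -> ((minorant u us nu a x k mu)%:E <= J a x k mu)%E.
Proof.
move=> Ru Cn; rewrite /minorant /Jhat.
apply: (@leeD _ (_ - _ + _)%:E _ (_ - _)%:E); last first.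
  by apply: ereal_sup_ubound; exists nu.
apply: (@leeD _ (_ - _)%:E _ _%:E) => //.
apply: (@leeD _ (_ + _)%:E _ (- _)%:E) => //.
apply: (@leeD _ _%:E _ (_ - _)%:E) => //.
by apply: ereal_sup_ubound; exists (u, us).
Qed.

(** The two suprema in the functional range over independent parameters, so
    their sum is the supremum of the sums. *)
Lemma minorant_gt c a x k mu : ucont T x -> YY T rho k -> (c%:E < J a x k mu)%E ->
  exists u us nu, [/\ realization ip T A (u, us), Calpha T alpha nu &
    c < minorant u us nu a x k mu].
Proof.
move=> ux Yk; apply: contraPP => none; apply/negP; rewrite -leNgt.
have {none} none u us nu : realization ip T A (u, us) -> Calpha T alpha nu ->
    minorant u us nu a x k mu <= c.
  move=> Ru Cn; rewrite leNgt; apply/negP => lt; apply: none.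
  by exists u, us, nu.
pose B := `|a - x0| ^+ 2 - <<x, k>> + 2 * rho * supnorm T (mu - m).
have hF nu : Calpha T alpha nu ->
    (fitz x k <= (c - B - (<<mu - nu, k>> - rho * supnorm T (nu - m)))%:E)%E.
  move=> Cn; apply: ge_ereal_sup => _ [[u us] /= Ru <-]; rewrite lee_fin.
  by have := none u us nu Ru Cn; rewrite /minorant /B; lra.
have := fitzpatrick_ge ip_norm A_maxmon T_gt0 ux Yk.
have := hF _ (Calpha0 T_gt0 alpha_ge0); rewrite /Jhat.
move: hF; case: (fitz x k) => [f| |] // hF _ _.
set S := ereal_sup _.
have : (S <= (c - B - f)%:E)%E.
  apply: ge_ereal_sup => _ [nu Cn <-]; have := hF nu Cn; rewrite !lee_fin; lra.
move: (S) => [s| |] //=; last by move=> _; rewrite addeNy; exact: leNye.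
by rewrite -!EFinD !lee_fin /B; lra.
Qed.

Definition affine_part u us nu x k : R :=
  <<u, k>> + <<x, us>> - <<u, us>> - <<nu, k>> - rho * supnorm T (nu - m).

(** This is a convex quadratic form plus an affine map, since
    |a|^2 - <a, b> + |b|^2/2 = |a - b/2|^2 + |b|^2/4. *)
Definition quad a (b : H) : R := `|a - x0| ^+ 2 - ip a b + `|b| ^+ 2 / 2.

(** On the constraint x = a + mu - k, so that
    <<x, k>> = <a, k T> + <<mu, k>> - |k T|^2 / 2; the terms <<mu, k>> cancel and
    the nonconvex bilinear term disappears. *)
Lemma minorantE u us nu a x k mu : Calpha T alpha nu -> K (a, x, k, mu) ->
  minorant u us nu a x k mu =
  quad a (k T) + affine_part u us nu x k + 2 * rho * supnorm T (mu - m).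
Proof.
move=> Cn [/CT_ucont ux Yk Cm E]; have [uk k0 [v kv vr]] := YY_dominated T_gt0 Yk.
have umu := Calpha_ucont Cm; have unu := Calpha_ucont Cn.
rewrite /minorant /quad /affine_part.
have -> : <<mu - nu, k>> = <<mu, k>> - <<nu, k>>.
  exact: (pairingBl ip_norm T_gt0 umu unu kv).
have ua : ucont T (fun r => a + mu r) := ucontD (ucont_cst T a) umu.
have -> : <<x, k>> = ip a (k T) + <<mu, k>> - `|k T| ^+ 2 / 2.
  have -> : <<x, k>> = <<fun r => (a + mu r) - k r, k>>.
    apply: (eq_pairing ip_norm T_gt0 (ucontB ua uk) kv) => t tT.
    by rewrite -E ?in_itv // addrK.
  rewrite (pairingBl ip_norm T_gt0 ua uk kv) (pairing_self ip_norm T_gt0 uk kv k0).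
  rewrite -(pairing_cst ip_norm T_gt0 a kv k0).
  rewrite (pairing_linl ip_norm T_gt0 (c := 1) (ucont_cst T a) umu kv) ?mul1r //.
  by move=> r; rewrite scale1r.
ring.
Qed.

Lemma quad_convex a b a' b' t : 0 <= t -> t <= 1 ->
  quad (t *: a + (1 - t) *: a') (t *: b + (1 - t) *: b') <=
  t * quad a b + (1 - t) * quad a' b'.
Proof.
move=> t0 t1; rewrite -subr_ge0.
have -> : t * quad a b + (1 - t) * quad a' b' -
    quad (t *: a + (1 - t) *: a') (t *: b + (1 - t) *: b') =
    t * (1 - t) * (`|(a - a') - 2^-1 *: (b - b')| ^+ 2 + `|b - b'| ^+ 2 / 4).
  rewrite /quad -!ip_norm !ipE (ipC ip x0 a) (ipC ip x0 a') (ipC ip a' a).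
  rewrite (ipC ip b' b) (ipC ip b a) (ipC ip b a') (ipC ip b' a) (ipC ip b' a').
  by field.
rewrite mulr_ge0 ?addr_ge0 ?mulr_ge0 ?sqr_ge0 //; lra.
Qed.

Lemma pairing_convr z g g' v v' t : ucont T z -> dominated T g v -> dominated T g' v' ->
  <<z, t *: g + (1 - t) *: g'>> = t * <<z, g>> + (1 - t) * <<z, g'>>.
Proof.
move=> uz gv gv'.
have z0 : dominated T (fun=> 0 : H) (fun=> 0) by move=> *; rewrite !subrr normr0.
have gt := dominated_lin (1 - t) gv' z0.
rewrite (pairing_linr ip_norm T_gt0 (c := t) uz gv gt); last first.
  by move=> r; rewrite addr0.
congr (_ + _).
rewrite (pairing_linr ip_norm T_gt0 (c := 1 - t) uz gv' z0); last by [].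
have [M M0 hM] := ucont_bounded uz.
have := pairing_norm ip_norm T_gt0 uz z0 hM.
by rewrite subrr mulr0 normr_le0 => /eqP ->; rewrite addr0.
Qed.

Lemma pairing_convl z z' g v t : ucont T z -> ucont T z' -> dominated T g v ->
  <<t *: z + (1 - t) *: z', g>> = t * <<z, g>> + (1 - t) * <<z', g>>.
Proof.
move=> uz uz' gv.
have gt := ucont_lin (1 - t) uz' (ucont_cst T (0 : H)).
rewrite (pairing_linl ip_norm T_gt0 (c := t) uz gt gv); last first.
  by move=> r; rewrite addr0.
congr (_ + _).
rewrite (pairing_linl ip_norm T_gt0 (c := 1 - t) uz' (ucont_cst T (0 : H)) gv); last by [].
have h0 t' : 0 <= t' <= T -> `|(fun=> 0 : H) t'| <= 0 by rewrite normr0.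
have := pairing_norm ip_norm T_gt0 (ucont_cst T (0 : H)) gv h0.
by rewrite mul0r normr_le0 => /eqP ->; rewrite addr0.
Qed.

Lemma minorant_convex u us nu a x k mu a' x' k' mu' t :
  realization ip T A (u, us) -> Calpha T alpha nu -> 0 <= t -> t <= 1 ->
  K (a, x, k, mu) -> K (a', x', k', mu') ->
  minorant u us nu (t *: a + (1 - t) *: a') (t *: x + (1 - t) *: x')
    (t *: k + (1 - t) *: k') (t *: mu + (1 - t) *: mu') <=
  t * minorant u us nu a x k mu + (1 - t) * minorant u us nu a' x' k' mu'.
Proof.
move=> Ru Cn t0 t1 Kp Kq.
have Kpq : K (t *: a + (1 - t) *: a', t *: x + (1 - t) *: x',
    t *: k + (1 - t) *: k', t *: mu + (1 - t) *: mu') := KK_conv T_gt0 Kp Kq t0 t1.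
rewrite (minorantE _ _ Cn Kpq) (minorantE _ _ Cn Kp) (minorantE _ _ Cn Kq).
move: Kp Kq => [/CT_ucont ux Yk Cm _] [/CT_ucont ux' Yk' Cm' _].
have [uk k0 [v kv vr]] := YY_dominated T_gt0 Yk.
have [uk' k'0 [v' kv' vr']] := YY_dominated T_gt0 Yk'.
have [uu [w usw] _] := realizationP T_gt0 Ru.
have unu := Calpha_ucont Cn.
have umu := ucontB (Calpha_ucont Cm) um; have umu' := ucontB (Calpha_ucont Cm') um.
have hq := quad_convex a (k T) a' (k' T) t0 t1.
have ha : affine_part u us nu (t *: x + (1 - t) *: x') (t *: k + (1 - t) *: k') =
    t * affine_part u us nu x k + (1 - t) * affine_part u us nu x' k'.
  rewrite /affine_part (pairing_convr _ uu kv kv') (pairing_convl _ ux ux' usw).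
  by rewrite (pairing_convr _ unu kv kv'); ring.
have hs : supnorm T (t *: mu + (1 - t) *: mu' - m) <=
    t * supnorm T (mu - m) + (1 - t) * supnorm T (mu' - m).
  apply: (supnorm_le T_gt0) => r rT.
  have -> : (t *: mu + (1 - t) *: mu' - m) r =
      t *: (mu r - m r) + (1 - t) *: (mu' r - m r).
    rewrite -conv_sub -[LHS]/(t *: mu r + (1 - t) *: mu' r - m r); congr (_ - _).
    by rewrite -scalerDl addrC subrK scale1r.
  apply: norm_conv => //; [exact: (supnorm_ub umu rT)|exact: (supnorm_ub umu' rT)].
rewrite -[(t *: k + _) T]/(t *: k T + (1 - t) *: k' T) ha.
have : 2 * rho * supnorm T (t *: mu + (1 - t) *: mu' - m) <=
   2 * rho * (t * supnorm T (mu - m) + (1 - t) * supnorm T (mu' - m)).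
  by rewrite ler_pM2l // mulr_gt0.
lra.
Qed.

Lemma Jhat4_convex : econvex_on K J4.
Proof.
move=> [[[a x] k] mu] [[[a' x'] k'] mu'] t Kp Kq /andP[t0 t1].
have t0' : 0 <= t by exact: ltW.
have t1' : t <= 1 by exact: ltW.
have tt : 0 < 1 - t by rewrite subr_gt0.
change (J (t *: a + (1 - t) *: a')%R (t *: x + (1 - t) *: x')%R
    (t *: k + (1 - t) *: k')%R (t *: mu + (1 - t) *: mu')%R <=
    t%:E * J a x k mu + (1 - t)%:E * J a' x' k' mu')%E.
have [/CT_ucont ux Yk Cm _] := Kp; have [/CT_ucont ux' Yk' Cm' _] := Kq.
have [/CT_ucont uxx Ykk _ _] := KK_conv T_gt0 Kp Kq t0' t1'.
have := Jhat_gtNy ip_norm A_maxmon T_gt0 x0 m alpha_ge0 a mu ux Yk.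
have := Jhat_gtNy ip_norm A_maxmon T_gt0 x0 m alpha_ge0 a' mu' ux' Yk'.
have min1 u us nu Ru Cn := @minorant_le u us nu a x k mu Ru Cn.
have min2 u us nu Ru Cn := @minorant_le u us nu a' x' k' mu' Ru Cn.
move: min1 min2.
case: (J a x k mu) => [j| |] //; case: (J a' x' k' mu') => [j'| |] // min1 min2 _ _.
- rewrite leNgt; apply/negP => lt.
  have [u [us [nu [Ru Cn]]]] := minorant_gt uxx Ykk lt.
  have := minorant_convex Ru Cn t0' t1' Kp Kq.
  have := min1 _ _ _ Ru Cn; have := min2 _ _ _ Ru Cn; rewrite !lee_fin => h2 h1.
  have : t * minorant u us nu a x k mu <= t * j by rewrite ler_wpM2l.
  have : (1 - t) * minorant u us nu a' x' k' mu' <= (1 - t) * j'.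
    by rewrite ler_wpM2l // ltW.
  lra.
- by rewrite gt0_muley ?lte_fin // addey // leey.
- by rewrite gt0_muley ?lte_fin // addye // leey.
- by rewrite !gt0_muley ?lte_fin // leey.
Qed.

(** A convex quadratic function lies above its tangents. *)
Lemma quad_lower a b a' b' d : 0 <= d -> `|a' - a| <= d -> `|b' - b| <= d ->
  quad a b - (2 * `|a - x0| + `|a| + 2 * `|b|) * d <= quad a' b'.
Proof.
move=> d0 ha hb; set al := a' - a in ha; set be := b' - b in hb.
have aE : a' = a + al by rewrite addrC subrK.
have bE : b' = b + be by rewrite addrC subrK.
clearbody al be; subst a' b'.
have E : quad (a + al) (b + be) = quad a b + 2 * ip (a - x0) al - ip a be - ip b al + ip b be
    + (`|al - 2^-1 *: be| ^+ 2 + `|be| ^+ 2 / 4).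
  rewrite /quad -!ip_norm !ipE (ipC ip x0 a) (ipC ip al a) (ipC ip be b).
  by rewrite (ipC ip be al) (ipC ip al x0) (ipC ip al b); field.
have h (p q : H) : `|q| <= d -> - (`|p| * d) <= ip p q.
  move=> qd; apply: le_trans (ip_ge ip_norm _ _); rewrite lerN2; exact: ler_wpM2l.
have h1 := h (a - x0) al ha; have h2 := h (- a) be; have h3 := h (- b) al ha.
have h4 := h b be hb; move: (h2 hb) h3; rewrite !normrN !ipNl.
have := sqr_ge0 `|al - 2^-1 *: be|; have := sqr_ge0 `|be|; rewrite E.
by lra.
Qed.

(** In the form minorantE every term is continuous on the constraint set:
    quad_lower for the quadratic part, pairing_weak_cont for the pairings with k,
    and the bounded variation of us for the pairing with x. *)
Lemma minorant_lsc u us nu a x k mu c : realization ip T A (u, us) ->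
  Calpha T alpha nu -> K (a, x, k, mu) -> c < minorant u us nu a x k mu ->
  exists2 d, 0 < d & forall a' x' k' mu', K (a', x', k', mu') ->
    unif_close T d (a, x, k, mu) (a', x', k', mu') -> c < minorant u us nu a' x' k' mu'.
Proof.
move=> Ru Cn Kp; rewrite (minorantE _ _ Cn Kp) => hc.
have [/CT_ucont ux Yk Cm _] := Kp.
have [uk k0 [v kv vr]] := YY_dominated T_gt0 Yk.
have [uu [w usw] _] := realizationP T_gt0 Ru.
have unu := Calpha_ucont Cn.
have umu := ucontB (Calpha_ucont Cm) um.
pose e := quad a (k T) + affine_part u us nu x k + 2 * rho * supnorm T (mu - m) - c.
have e0 : 0 < e by rewrite subr_gt0.
have e8 : 0 < e / 8 by rewrite divr_gt0.
have [d1 d10 h1] := pairing_weak_cont ip_norm T_gt0 uu (ltW rho_gt0) e8.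
have [d2 d20 h2] := pairing_weak_cont ip_norm T_gt0 unu (ltW rho_gt0) e8.
have wT := dominated_ge0 usw (lexx 0) T_ge0 (lexx T).
pose C := (2 * `|a - x0| + `|a| + 2 * `|k T|) + (w T - w 0) + 2 * rho + 1.
have C0 : 0 < C.
  by have rg := rho_gt0; rewrite /C; have := normr_ge0 (a - x0); have := normr_ge0 a;
     have := normr_ge0 (k T); lra.
pose d := Num.min (Num.min d1 d2) (e / 8 / C).
have d0 : 0 < d by rewrite !lt_min d10 d20 divr_gt0.
have dd1 : d <= d1 by rewrite !ge_min lexx.
have dd2 : d <= d2 by rewrite !ge_min lexx orbT.
have dC : C * d <= e / 8 by rewrite mulrC -ler_pdivlMr // !ge_min lexx orbT.
exists d => // a' x' k' mu' Kq [/= ha hx hk hm].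
rewrite (minorantE _ _ Cn Kq).
have [/CT_ucont ux' Yk' Cm' _] := Kq.
have umu' := ucontB (Calpha_ucont Cm') um.
have TT : 0 <= T <= T by rewrite lexx ltW.
have i1 : quad a (k T) - (2 * `|a - x0| + `|a| + 2 * `|k T|) * d <= quad a' (k' T).
  apply: quad_lower; [exact: ltW|by rewrite distrC ltW|].
  by rewrite distrC ltW // hk.
have i2 : <<u, k>> - e / 8 <= <<u, k'>>.
  have := h1 _ _ Yk Yk' _; rewrite ler_norml => /(_ _)/andP[|_].
    by move=> t tT; apply: le_trans dd1; exact/ltW/hk.
  lra.
have i3 : <<nu, k'>> <= <<nu, k>> + e / 8.
  have := h2 _ _ Yk Yk' _; rewrite ler_norml => /(_ _)/andP[|+ _].
    by move=> t tT; apply: le_trans dd2; exact/ltW/hk.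
  lra.
have i4 : <<x, us>> - d * (w T - w 0) <= <<x', us>>.
  have hxd t : 0 <= t <= T -> `|x t - x' t| <= d by move=> tT; exact/ltW/hx.
  have := pairing_norm ip_norm T_gt0 (ucontB ux ux') usw hxd.
  rewrite (pairingBl ip_norm T_gt0 ux ux' usw) ler_norml => /andP[_]; lra.
have i5 : supnorm T (mu - m) - d <= supnorm T (mu' - m).
  rewrite lerBlDr; apply: (supnorm_le T_gt0) => t tT.
  have s1 : `|mu' t - m t| <= supnorm T (mu' - m) := supnorm_ub umu' tT.
  have := hm t tT; have := ler_distD (mu' t) (mu t) (m t).
  rewrite -[X in _ -> _ -> `|X| <= _]/(mu t - m t); lra.
have i6 : rho * (supnorm T (mu - m) - d) <= rho * supnorm T (mu' - m).
  by rewrite ler_pM2l.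
have : c = quad a (k T) + affine_part u us nu x k + 2 * rho * supnorm T (mu - m) - e.
  by rewrite /e; ring.
move: dC; rewrite /affine_part /C; lra.
Qed.

Lemma Jhat4_lsc :
  lower_semicontinuous (J4 : subspace (K : set (state_space R H T)) -> \bar R).
Proof.
move=> p c hc; have [Kp|nKp] := pselect (K p); last first.
  exists [set p]; last by move=> q ->.
  by have := @nbhs_subspace_out (state_space R H T) K p nKp; rewrite /nbhs /= => <-.
move: p Kp hc => [[[a x] k] mu] Kp hc.
have [/CT_ucont ux Yk Cm _] := Kp.
have [u [us [nu [Ru Cn lt]]]] := minorant_gt ux Yk hc.
have [d d0 hd] := minorant_lsc Ru Cn Kp lt.
exists [set q | K q /\ unif_close T d (a, x, k, mu) q].
  rewrite /nbhs /= -(@nbhs_subspace_in (state_space R H T) K _ Kp).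
  have := @nbhs_unif_close _ _ T (a, x, k, mu) d d0.
  by apply: filterS => q cq Kq.
move=> [[[a' x'] k'] mu'] [Kq cq].
apply: lt_le_trans (minorant_le a' x' k' mu' Ru Cn).
by rewrite lte_fin; apply: hd.
Qed.

End Envelope.

Theorem proposition7 (R : realType) (H : completeNormedModType R)
    (ip : {dot H for idfun})
    (ip_norm : forall h : H, ip h h = `|h| ^+ 2)
    (H_separable : separable H)
    (T : R) (T_gt0 : 0 < T)
    (A : set (H * H)) (A_maxmon : maximal_monotone ip A)
    (x0 : H) (x0_dom : closure (Dom A) x0)
    (m : R -> H) (m_cont : {within `[0, +oo[, continuous m}) (m0 : m 0 = 0)
    (rho : R) (rho_gt0 : 0 < rho)
    (alpha : R -> R) (alpha_ge0 : forall e, 0 <= e -> 0 <= alpha e)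
    (alpha_cont : {within `[0, +oo[, continuous alpha}) (alpha0 : alpha 0 = 0) :
  let J := Jhat ip T A x0 m rho alpha in
  let K := KK (H := H) T rho alpha in
  let J4 := Jhat4 ip T A x0 m rho alpha in
  [/\ (* Jhat takes its values in ]-oo, +oo] *)
      forall (a : H) (x k mu : R -> H),
        CT T x -> YY T rho k -> XX T mu -> (-oo < J a x k mu)%E,
      (* (a) *)
      forall (a : H) (x k mu : R -> H),
        CT T x -> YY T rho k -> Calpha T alpha mu -> (0 <= J a x k mu)%E,
      (* (b) *)
      forall (a : H) (x k mu : R -> H),
        CT T x -> YY T rho k -> Calpha T alpha mu ->
        (J a x k mu = 0%E <->
         [/\ a = x0, (forall t, t \in `[0, T] -> mu t = m t)
           & realization ip T A (x, k)])
    & (* (c) *)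
      [/\ closed (K : set (state_space R H T)),
          convex_set K,
          econvex_on K J4,
          lower_semicontinuous
            (J4 : subspace (K : set (state_space R H T)) -> \bar R)
        & forall (a : H) (x k mu : R -> H), K (a, x, k, mu) ->
            (J a x k mu = 0%E <->
             [/\ a = x0, (forall t, t \in `[0, T] -> mu t = m t)
               & is_GSP ip T A x0 m x k])]].
Proof.
move=> J K J4.
have um : ucont T m.
  apply/ucontP; apply: continuous_subspaceW m_cont.
  by move=> t /=; rewrite !in_itv /= andbT => /andP[].
have partb a x k mu : CT T x -> YY T rho k -> Calpha T alpha mu ->
    (J a x k mu = 0%E <-> [/\ a = x0, (forall t, t \in `[0, T] -> mu t = m t)
           & realization ip T A (x, k)]).
  move=> /CT_ucont ux Yk Cm.
  have [_ JE] := Jhat_dichotomy ip_norm A_maxmon T_gt0 x0 um rho_gt0 alpha_ge0 a ux Yk Cm.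
  have FE := fitzpatrick_eq ip_norm A_maxmon T_gt0 ux Yk.
  split=> [/JE[aE mum /FE xk]|[aE mum /FE xk]]; last first.
    by apply/JE; split=> // t tT; apply: mum; rewrite in_itv.
  by split=> // t; rewrite in_itv; exact: mum.
split=> //.
- by move=> a x k mu /CT_ucont ux Yk _; exact: (Jhat_gtNy ip_norm A_maxmon T_gt0 x0 m alpha_ge0).
- move=> a x k mu /CT_ucont ux Yk Cm.
  by have [] := Jhat_dichotomy ip_norm A_maxmon T_gt0 x0 um rho_gt0 alpha_ge0 a ux Yk Cm.
split.
- exact: KK_closed.
- exact: KK_convex.
- exact: (Jhat4_convex ip_norm A_maxmon T_gt0 x0 um rho_gt0 alpha_ge0).
- exact: (Jhat4_lsc ip_norm A_maxmon T_gt0 um rho_gt0 alpha_ge0).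
move=> a x k mu [CTx Yk Cm E]; have JE := partb a x k mu CTx Yk Cm.
have ux : ucont T x by exact/CT_ucont.
have gsp : a = x0 -> (forall t, t \in `[0, T] -> mu t = m t) ->
    realization ip T A (x, k) <-> is_GSP ip T A x0 m x k.
  move=> aE mum; apply: (realization_GSP ip_norm A_maxmon T_gt0 ux Yk) => t tT.
    by rewrite -aE; apply: E; rewrite in_itv.
  by apply: mum; rewrite in_itv.
split=> [/JE[aE mum xk]|[aE mum xk]]; first by split=> //; exact/gsp.
by apply/JE; split=> //; exact/gsp.
Qed.
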